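(* Let $H_1, H_2$ be two complex Hilbert spaces. Consider three contractions $W_1 \in \mathcal{B}(H_1)$, $W_2 \in \mathcal{B}(H_2)$ and $V \in \mathcal{B}(H_2, H_1)$. Assume that $\sigma(W_1) \cap \sigma(W_2) = \emptyset$, and that $f \in \mathcal{H}(\mathbb{D},\mathbb{D})$ is holomorphic on an open neighborhood of $\sigma(W_1) \cup \sigma(W_2)$. Denote by $X\in\mathcal{B}(H_2,H_1)$ the unique solution of Sylvester's equation $$W_1X-XW_2= D_{W_ 1^*}VD_{W_2}.$$ Then there exists a contraction $Y \in \mathcal{B}(H_2,H_1)$ such that $$f(W_1)X-Xf(W_2)=D_{f(W_1)^*}YD_{f(W_2)}.$$
   Context: $\mathbb{D}$ is the open unit disk in $\mathbb{C}$ and $\mathcal{H}(\mathbb{D},\mathbb{D})$ is the set of holomorphic functions on $\mathbb{D}$ mapping $\mathbb{D}$ to $\mathbb{D}$. The assumption on $f$ means that $f$ is (extends to) a holomorphic function on the union of $\mathbb{D}$ with an open neighborhood of the given spectra; $f(W_i)$ is defined by the holomorphic functional calculus, and is a contraction by von Neumann's inequality. $\mathcal{B}(H,K)$ denotes the bounded linear operators from $H$ to $K$, $\mathcal{B}(H)=\mathcal{B}(H,H)$; $\sigma(T)$ is the spectrum of $T$; a contraction is an operator with $\|T\|\le 1$. For a contraction $T$, $D_T=(\mathrm{Id}-T^*T)^{1/2}$ is its defect operator, so $D_{T^*}=(\mathrm{Id}-TT^* )^{1/2}$. By Rosenblum's theorem, if $A\in\mathcal{B}(H_1)$ and $B\in\mathcal{B}(H_2)$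 have disjoint spectra, then for each $C\in\mathcal{B}(H_2,H_1)$ the equation $AX-XB=C$ has a unique solution $X\in\mathcal{B}(H_2,H_1)$. *)

(* Defs.v *)
(* The complex field is R[i] for an arbitrary R : realType.  The alias R[i]^o
   (convertible to R[i]) is the one on which the library puts the topology of
   the complex plane. *)
From HB Require Import structures.
From mathcomp Require Import all_boot all_order all_algebra.
From mathcomp Require Import complex.
From mathcomp Require Import all_classical all_reals all_analysis.

Set Implicit Arguments.
Unset Strict Implicit.
Unset Printing Implicit Defensive.

Import Order.TTheory GRing.Theory Num.Theory numFieldNormedType.Exports.

Local Open Scope classical_set_scope.
Local Open Scope ring_scope.
Local Open Scope complex_scope.

(* {dot H for conjC}: linear in the first argument, conjugate-symmetric,
   positive definite. *)
HB.mixin Record CompleteNormedModule_isHilbert (R : realType) H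
    & CompleteNormedModule R[i] H := {
  hdot : {dot H for (@Num.conj R[i])} ;
  normr_hdot : forall x : H, `|x| ^+ 2 = hdot x x
}.

#[short(type="hilbertType")]
HB.structure Definition Hilbert (R : realType) :=
  {H of CompleteNormedModule R[i] H & CompleteNormedModule_isHilbert R H}.

Section bounded_operators.
Context {R : realType}.
Implicit Types H K : hilbertType R.

Definition bounded_op H K : set (H -> K) :=
  [set T | linear T /\ exists M, forall x, `|T x| <= M * `|x|].

Definition contraction_op H K : set (H -> K) :=
  [set T | linear T /\ forall x, `|T x| <= `|x|].

Definition inverse_op H (T S : H -> H) : Prop :=
  [/\ bounded_op S, S \o T = id & T \o S = id].

Definition spectrum H (T : H -> H) : set R[i]^o :=
  [set z | ~ exists S, inverse_op (z *: id - T) S].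

(* Here and below xget selects the operator having the stated property; it
   would return 0 if there were none. *)

Definition resolvent H (T : H -> H) (z : R[i]) : H -> H :=
  xget 0 [set S | inverse_op (z *: id - T) S].

Definition adjoint_op H K (T : H -> K) : K -> H :=
  xget 0 [set S | bounded_op S /\ forall x y, hdot (T x) y = hdot x (S y)].

(* the positive square root; in the order of R[i], 0 <= z means that z is
   real and nonnegative *)
Definition sqrt_op H (P : H -> H) : H -> H :=
  xget 0 [set S | [/\ bounded_op S, forall x, 0 <= hdot (S x) x & S \o S = P]].

Definition defect_op H K (T : H -> K) : H -> H :=
  sqrt_op (id - (adjoint_op T \o T)).

End bounded_operators.

Section contours.
Context {R : realType}.
Local Notation C := R[i]^o.

Definition unit_disk : set C := [set z | `|z| < 1].

(* The base field is R[i], so this is complex differentiability at every point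
   of A; it is holomorphy on A when A is open. *)
Definition holomorphic_on (A : set C) (f : C -> C) : Prop :=
  forall z, A z -> derivable f z 1.

Definition cintegral01 (g : R -> R[i]) : R[i] :=
  Rintegral lebesgue_measure `[0, 1] (fun t => complex.Re (g t)) +i*
  Rintegral lebesgue_measure `[0, 1] (fun t => complex.Im (g t)).

(* A contour is a finite family of oriented segments (a, b), from a to b. *)

Definition segment_pt (e : R[i] * R[i]) (t : R) : R[i] :=
  e.1 + t%:C * (e.2 - e.1).

Definition contour_support (G : seq (R[i] * R[i])) : set R[i] :=
  [set z | exists2 e, e \in G & exists2 t, t \in `[0, 1] & z = segment_pt e t].

Definition contour_integral (G : seq (R[i] * R[i])) (g : R[i] -> R[i]) : R[i] :=
  \sum_(e <- G) (e.2 - e.1) * cintegral01 (g \o segment_pt e).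

Definition two_pi_i : R[i] := 0 +i* (2 * pi).

Definition winding_number (G : seq (R[i] * R[i])) (a : R[i]) : R[i] :=
  two_pi_i^-1 * contour_integral G (fun z => (z - a)^-1).

(* The contour G surrounds K in A: it is closed (every point is as often an
   initial as a terminal point of its segments), it lies in A minus K, and
   its index is 1 at the points of K and 0 at the points outside A. *)
Definition surrounds (G : seq (R[i] * R[i])) (K A : set R[i]) : Prop :=
  [/\ perm_eq (unzip1 G) (unzip2 G),
      contour_support G `<=` A `\` K,
      forall a, K a -> winding_number G a = 1 &
      forall a, ~ A a -> winding_number G a = 0].

End contours.

(* Riesz-Dunford holomorphic functional calculus:
     f(T) = (2 pi i)^-1 \int_G f(z) (z - T)^-1 dz,
   where f is holomorphic on an open neighborhood A of the spectrum of T and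
   the contour G surrounds the spectrum in A.  The integral of the
   operator-valued function is understood weakly, and f(T) depends neither on
   A nor on G. *)
Definition hfcalc (R : realType) (H : hilbertType R) (f : R[i]^o -> R[i]^o)
    (T : H -> H) : H -> H :=
  xget 0 [set F | bounded_op F /\
    exists (A : set R[i]^o) (G : seq (R[i] * R[i])),
      [/\ open A, spectrum T `<=` A, holomorphic_on A f,
          surrounds G (spectrum T) A &
          forall x y, hdot (F x) y =
            two_pi_i^-1 *
            contour_integral G (fun z => f z * hdot (resolvent T z x) y)]].

(* Main.v *)
Require Import Defs.
From HB Require Import structures.
From mathcomp Require Import all_boot all_order all_algebra.
From mathcomp Require Import separable cyclotomic cyclic.
From mathcomp Require Import complex ring lra zify.
From mathcomp Require Import all_classical all_reals all_analysis.

Set Implicit Arguments.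
Unset Strict Implicit.
Unset Printing Implicit Defensive.

Import Order.TTheory GRing.Theory Num.Theory numFieldNormedType.Exports.

Local Open Scope classical_set_scope.
Local Open Scope ring_scope.
Local Open Scope complex_scope.

(** The proof passes to a 2 x 2 block operator.

    Let C = W1 X - X W2.  That C = D_{W1^*} V D_{W2} with V a contraction says that
    the operator T on H1 x H2 with rows (W1, C) and (0, W2) is a contraction: the
    row (W1, D_{W1^*}) is a contraction ([defect_row]), and |D_{W2} y| ^ 2 =
    |y| ^ 2 - |W2 y| ^ 2.  The map (x, y) |-> (x + X y, y) conjugates T to the
    diagonal operator with entries W1, W2; hence f(T) has the diagonal f(W1), f(W2)
    and the corner Z = f(W1) X - X f(W2).  By von Neumann's inequality f(T) is a
    contraction ([block_von_neumann]).  Tested on suitable vectors, this says that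
    |(Z y, x)| is at most |D_{f(W2)} y| |D_{f(W1)^*} x|, and Douglas' factorisation
    ([douglas_factor]) produces Y ([block_corner]).

    Von Neumann's inequality is first proved for polynomials ([von_neumann_poly]),
    by averaging a positive Poisson kernel over roots of unity.  It reaches f
    through the dilates f (r z), r < 1: these are limits of their Taylor
    polynomials on a disk larger than the unit disk ([dilate_taylor]), and their
    calculus tends to that of f as r tends to 1 ([calculus_dilate]).  The open set
    and the contour behind f(W) are arbitrary, and the last step changes the
    contour, so it needs Cauchy's theorem in homology form ([cauchy_homology]).

    The homology form rests on the contours of [grid_contour], boundaries of unions
    of small squares, which surround a given compact set and satisfy Cauchy's
    formula by [goursat] and [cauchy_rectangle].  The same contours show that f(W)
    exists ([hfcalcP]).

    On the Hilbert space side, adjoints, the operators defined by bounded forms and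
    Douglas' factorisation are all instances of one minimisation ([riesz_factor]);
    square roots are limits of polynomials ([sqrt_exists]).  Integrals are computed
    from primitives, and estimates use real-valued norms. *)

Local Notation Re := complex.Re.
Local Notation Im := complex.Im.

(** * Real-valued norms and semi-inner products *)

Section real_norm.
Variable R : realType.
Local Notation C := R[i].

(** A norm over R[i] takes its values in R[i], which is only partially ordered;
    its real part is a norm in the totally ordered field R. *)
Definition rnorm (V : normedZmodType C) (x : V) : R := complex.Re `|x|.

Section zmod.
Variable V : normedZmodType C.
Implicit Types x y : V.

Lemma rnormE x : `|x| = (rnorm x)%:C.
Proof. by rewrite /rnorm RRe_real // normr_real. Qed.

Lemma rnorm_ge0 x : 0 <= rnorm x.
Proof. by rewrite -ler0c -rnormE. Qed.

Lemma rnormD x y : rnorm (x + y) <= rnorm x + rnorm y.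
Proof. by rewrite -lecR rmorphD/= -!rnormE ler_normD. Qed.

Lemma rnormN x : rnorm (- x) = rnorm x.
Proof. by rewrite /rnorm normrN. Qed.

Lemma rnormB x y : rnorm (x - y) <= rnorm x + rnorm y.
Proof. by rewrite -[rnorm y]rnormN rnormD. Qed.

Lemma rnormBC x y : rnorm (x - y) = rnorm (y - x).
Proof. by rewrite -rnormN opprB. Qed.

Lemma rnorm0 : rnorm (0 : V) = 0.
Proof. by rewrite /rnorm normr0. Qed.

Lemma rnorm_eq0 x : rnorm x = 0 -> x = 0.
Proof. by move=> h; apply/normr0_eq0; rewrite rnormE h. Qed.

Lemma rnorm_gt0 x : x != 0 -> 0 < rnorm x.
Proof.
move=> xN0; rewrite lt_neqAle rnorm_ge0 andbT eq_sym.
by apply: contra_neq xN0 => /rnorm_eq0.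
Qed.

Lemma rnormDist z x y : rnorm (x - y) <= rnorm (x - z) + rnorm (z - y).
Proof. by have := rnormD (x - z) (z - y); rewrite addrA subrK. Qed.

Lemma rnorm_lowerB x y : rnorm x - rnorm y <= rnorm (x - y).
Proof. by rewrite lerBlDr; have := rnormD (x - y) y; rewrite subrK. Qed.

Lemma rnorm_sum I (r : seq I) (P : pred I) (F : I -> V) :
  rnorm (\sum_(i <- r | P i) F i) <= \sum_(i <- r | P i) rnorm (F i).
Proof.
elim/big_ind2 : _ => //; first by rewrite rnorm0.
by move=> x a y b xa yb; rewrite (le_trans (rnormD _ _)) ?lerD.
Qed.

End zmod.

Lemma rnormZ (V : normedModType C) (a : C) (x : V) :
  rnorm (a *: x) = rnorm a * rnorm x.
Proof. by apply: complexI; rewrite rmorphM/= -!rnormE normrZ. Qed.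

Lemma rnormM (a b : C) : rnorm (a * b) = rnorm a * rnorm b.
Proof. by apply: complexI; rewrite rmorphM/= -!rnormE normrM. Qed.

Lemma rnormV (a : C) : rnorm a^-1 = (rnorm a)^-1.
Proof. by apply: complexI; rewrite fmorphV/= -!rnormE normfV. Qed.

Lemma rnorm1 : rnorm (1 : C) = 1.
Proof. by apply: complexI; rewrite -!rnormE normr1. Qed.

Lemma rnormX (a : C) n : rnorm (a ^+ n) = rnorm a ^+ n.
Proof. by apply: complexI; rewrite rmorphXn/= -!rnormE normrX. Qed.

Lemma rnormc (a : R) : rnorm (a%:C) = `|a|.
Proof.
by rewrite /rnorm normc_def/= expr0n addr0 sqrtr_sqr.
Qed.

Lemma rnorm_conj (a : C) : rnorm (conjc a) = rnorm a.
Proof. by rewrite /rnorm normcJ. Qed.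

Lemma Re_le_rnorm (a : C) : complex.Re a <= rnorm a.
Proof.
rewrite (le_trans (ler_norm _))// -lecR (le_trans (normc_ge_Re a))//.
Qed.

Lemma rnormE2 (a : C) : rnorm a ^+ 2 = complex.Re a ^+ 2 + complex.Im a ^+ 2.
Proof. by apply: complexI; rewrite add_Re2_Im2 rmorphXn/= -rnormE. Qed.

Lemma absRe_le_rnorm (a : C) : `|complex.Re a| <= rnorm a.
Proof.
rewrite -(@ler_pXn2r _ 2) ?nnegrE ?rnorm_ge0//.
by rewrite rnormE2 -normrX ger0_norm ?sqr_ge0// lerDl sqr_ge0.
Qed.

Lemma absIm_le_rnorm (a : C) : `|complex.Im a| <= rnorm a.
Proof.
rewrite -(@ler_pXn2r _ 2) ?nnegrE ?rnorm_ge0//.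
by rewrite rnormE2 -normrX ger0_norm ?sqr_ge0// lerDr sqr_ge0.
Qed.

Lemma rnorm_le_ReIm (a : C) :
  rnorm a <= `|complex.Re a| + `|complex.Im a|.
Proof.
rewrite -(@ler_pXn2r _ 2) ?nnegrE ?rnorm_ge0// ?addr_ge0//.
rewrite rnormE2 sqrrD !real_normK ?num_real//.
by rewrite lerD2r lerDl mulrn_wge0// mulr_ge0.
Qed.

Lemma unimodular_mul (z : C) : exists2 u : C, rnorm u = 1 & u * z = (rnorm z)%:C.
Proof.
have [->|z0] := eqVneq z 0; first by exists 1; rewrite ?rnorm1// mulr0 rnorm0.
exists (conjc z / (rnorm z)%:C).
  rewrite rnormM rnormV rnorm_conj rnormc ger0_norm ?rnorm_ge0//.
  by rewrite divff// gt_eqF// rnorm_gt0.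
have nz : (rnorm z)%:C != 0 :> C by rewrite -rnormE normr_eq0.
rewrite mulrAC [conjc z * z]mulrC -sqr_normc.
by rewrite rnormE expr2 mulfK.
Qed.

(** The best scaling is t = q / p; when p or q is 0 the bound is reached only in
    the limit, which is why the proof has room for an e > 0. *)
Lemma le_mul_of_scaling (b p q : R) : 0 <= p -> 0 <= q ->
  (forall t, 0 < t -> 2 * b <= t * p ^+ 2 + q ^+ 2 / t) -> b <= p * q.
Proof.
move=> p0 q0 h; apply/ler_addgt0Pr => e e0.
move: p0; rewrite le_eqVlt => /predU1P[p0|p0].
  have q1 : 0 < (q ^+ 2 + 1) / e by rewrite divr_gt0// ltr_wpDl ?sqr_ge0.
  have := h _ q1; rewrite -p0 expr0n mulr0 add0r mul0r add0r invf_div mulrA.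
  have Q0 := sqr_ge0 q.
  suff : q ^+ 2 * e / (q ^+ 2 + 1) <= e by lra.
  by rewrite ler_pdivrMr; nra.
have q1 : 0 < (q + e) / p by rewrite divr_gt0// ltr_wpDl.
pose s := e / p.
have [Q|Q] := leP q 0.
  have qE : q = 0 by lra.
  have t0 : 0 < e / p ^+ 2 by rewrite divr_gt0// exprn_gt0.
  have := h _ t0; rewrite qE expr0n mul0r addr0 divfK ?gt_eqF ?exprn_gt0//.
  by lra.
have t0 : 0 < q / p by rewrite divr_gt0.
have := h _ t0.
rewrite invf_div.
have -> : q / p * p ^+ 2 = p * q by field; rewrite gt_eqF.
have -> : q ^+ 2 * (p / q) = p * q by field; rewrite gt_eqF.
lra.
Qed.

End real_norm.

Section semi_inner_product.
Variables (R : realType).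
Local Notation C := R[i].

Record semi_dot (V : lmodType C) (B : V -> V -> C) : Prop := SemiDot {
  semi_dotP : forall a x y z, B (a *: x + y) z = a * B x z + B y z ;
  semi_dotC : forall x y, B x y = conjc (B y x) ;
  semi_dot_ge0 : forall x, 0 <= Re (B x x) }.

Variables (V : lmodType C) (B : V -> V -> C) (hB : semi_dot B).
Implicit Types x y z : V.

Lemma sdotDl x y z : B (x + y) z = B x z + B y z.
Proof. by have := semi_dotP hB 1 x y z; rewrite scale1r mul1r. Qed.

Lemma sdot0l z : B 0 z = 0.
Proof. by apply: (addrI (B 0 z)); rewrite -sdotDl !addr0. Qed.

Lemma sdotZl a x z : B (a *: x) z = a * B x z.
Proof. by have := semi_dotP hB a x 0 z; rewrite sdot0l !addr0. Qed.

Lemma sdotNl x z : B (- x) z = - B x z.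
Proof. by rewrite -scaleN1r sdotZl mulN1r. Qed.

Lemma sdotDr x y z : B z (x + y) = B z x + B z y.
Proof. by rewrite !(semi_dotC hB z) sdotDl rmorphD. Qed.

Lemma sdot0r z : B z 0 = 0.
Proof. by rewrite (semi_dotC hB) sdot0l rmorph0. Qed.

Lemma sdotZr a x z : B z (a *: x) = conjc a * B z x.
Proof. by rewrite !(semi_dotC hB z) sdotZl rmorphM. Qed.

Lemma sdotNr x z : B z (- x) = - B z x.
Proof. by rewrite !(semi_dotC hB z) sdotNl rmorphN. Qed.

Lemma sdot_suml I (r : seq I) (P : pred I) (F : I -> V) z :
  B (\sum_(i <- r | P i) F i) z = \sum_(i <- r | P i) B (F i) z.
Proof. by elim/big_rec2 : _ => [|i a b _ <-]; rewrite ?sdot0l// sdotDl. Qed.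

Lemma sdot_sumr I (r : seq I) (P : pred I) (F : I -> V) z :
  B z (\sum_(i <- r | P i) F i) = \sum_(i <- r | P i) B z (F i).
Proof. by elim/big_rec2 : _ => [|i a b _ <-]; rewrite ?sdot0r// sdotDr. Qed.

Lemma sdot_real x : B x x = (Re (B x x))%:C.
Proof.
have := semi_dotC hB x x; case: (B x x) => a b /= [b0].
by apply/eqP; rewrite eq_complex/= eqxx/=; apply/eqP; lra.
Qed.

Lemma Re_sdotC x y : Re (B x y) = Re (B y x).
Proof. by rewrite (semi_dotC hB); case: (B y x). Qed.

Lemma sdot_normB x y :
  Re (B (x - y) (x - y)) = Re (B x x) + Re (B y y) - 2 * Re (B x y).
Proof.
have := Re_sdotC x y; rewrite sdotDl !sdotDr !sdotNl !sdotNr.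
by case: (B x x) (B y y) (B x y) (B y x) => [a b] [c d] [e g] [k l] /=; lra.
Qed.

(** The square of the norm of x - y is nonnegative. *)
Lemma sdot_young x y : 2 * Re (B x y) <= Re (B x x) + Re (B y y).
Proof.
by rewrite -subr_ge0 -sdot_normB (semi_dot_ge0 hB).
Qed.

Lemma sdot_normZ a x : Re (B (a *: x) (a *: x)) = rnorm a ^+ 2 * Re (B x x).
Proof.
rewrite sdotZl sdotZr mulrA [B x x]sdot_real -sqr_normc rnormE.
by rewrite -rmorphXn -rmorphM.
Qed.

Lemma sdot_young_norm x y : 2 * rnorm (B x y) <= Re (B x x) + Re (B y y).
Proof.
have [u u1 ux] := unimodular_mul (B x y).
have := sdot_young (u *: x) y.
by rewrite sdotZl ux/= sdot_normZ u1 expr1n mul1r.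
Qed.

End semi_inner_product.

Section semi_norm.
Variables (R : realType) (V : lmodType R[i]) (B : V -> V -> R[i]).
Hypothesis hB : semi_dot B.

Definition snorm x := Num.sqrt (Re (B x x)).

Lemma snorm_ge0 x : 0 <= snorm x. Proof. exact: sqrtr_ge0. Qed.

Lemma snormE x : snorm x ^+ 2 = Re (B x x).
Proof. by rewrite sqr_sqrtr// (semi_dot_ge0 hB). Qed.

Lemma snormZ a x : snorm (a *: x) = rnorm a * snorm x.
Proof.
rewrite /snorm (sdot_normZ hB) sqrtrM ?sqr_ge0// sqrtr_sqr ger0_norm//.
exact: rnorm_ge0.
Qed.

Lemma sdot_cauchy_schwarz x y : rnorm (B x y) <= snorm x * snorm y.
Proof.
apply: le_mul_of_scaling; rewrite ?snorm_ge0// => t t0; rewrite !snormE.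
pose s := Num.sqrt t; have s0 : 0 < s by rewrite sqrtr_gt0.
have sE : s ^+ 2 = t by rewrite sqr_sqrtr// ltW.
have := sdot_young_norm hB (s%:C *: x) (s^-1%:C *: y).
rewrite (sdotZl hB) (sdotZr hB) conjc_real mulrA.
rewrite -rmorphM/= divff ?gt_eqF// mul1r !(sdot_normZ hB).
by rewrite !rnormc !real_normK ?num_real// exprVn sE [_ / t]mulrC.
Qed.

End semi_norm.

(** * Hilbert spaces *)

Section rnorm_topology.
Variable R : realType.
Local Notation C := R[i].

Lemma gt0c_Re (e : C) : 0 < e -> e = (complex.Re e)%:C /\ 0 < complex.Re e.
Proof.
move=> e0; have eR : e \is Num.real by rewrite gtr0_real.
by rewrite RRe_real//; split => //; rewrite -ltcR RRe_real.
Qed.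

Lemma rnorm_nbhsP (V : normedModType C) (x : V) (A : set V) :
  nbhs x A <-> exists2 e : R, 0 < e & forall y, rnorm (y - x) < e -> A y.
Proof.
split=> [/nbhs_ballP[e /= e0 hA]|[e e0 hA]].
  have [eE e1] := gt0c_Re e0; exists (complex.Re e) => // y yx.
  by apply: hA; rewrite -ball_normE/= rnormE eE ltcR rnormBC.
apply/nbhs_ballP; exists e%:C => /=; first by rewrite ltcR.
by move=> y; rewrite -ball_normE/= rnormE ltcR rnormBC => /hA.
Qed.

(** Every limit below comes from a sequence with an explicit rate of convergence;
    keeping the rate lets the properties of the limit be read off from those of
    the sequence. *)
Lemma rnorm_complete (V : completeNormedModType C) (u : nat -> V) (e : nat -> R) :
  (forall n m, (n <= m)%N -> rnorm (u m - u n) <= e n) ->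
  e @ \oo --> (0 : R) ->
  exists l, forall n, rnorm (u n - l) <= e n.
Proof.
move=> ue e0.
have small (d : R) : 0 < d -> exists N, forall n, (N <= n)%N -> e n < d.
  move=> d0; have /cvgrPdist_lt/(_ _ d0)[N _ hN] := e0.
  exists N => n Nn; have := hN _ Nn; rewrite /= sub0r normrN.
  exact/le_lt_trans/ler_norm.
have cu : cvg (u @ \oo).
  apply: cauchy_cvg; apply/cauchy_exP => d d0.
  have [dE d1] := gt0c_Re d0; have [N hN] := small _ d1.
  exists (u N); exists N => // n /= Nn.
  rewrite -ball_normE/= rnormE dE ltcR rnormBC.
  exact/(le_lt_trans (ue _ _ Nn))/hN.
pose l := lim (u @ \oo); have ul : u @ \oo --> l := cu.
exists l => n; apply/ler_addgt0Pr => d d0.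
have nl : nbhs l [set y | rnorm (y - l) < d] by apply/rnorm_nbhsP; exists d.
have [N _ hN] := ul _ nl.
have h1 := hN (maxn N n) (leq_maxl _ _).
have h2 := ue n (maxn N n) (leq_maxr _ _).
rewrite (le_trans (rnormDist (u (maxn N n)) _ _))//.
rewrite lerD//; first by rewrite rnormBC.
exact: ltW.
Qed.

End rnorm_topology.

Section hilbert.
Variable R : realType.
Local Notation C := R[i].

Lemma hdot_semi (H : hilbertType R) : semi_dot (fun x y : H => hdot x y).
Proof.
split=> [a x y z|x y|x]; first by rewrite linearDl linearZl_LR.
  by rewrite hermC expr0 mul1r.
by rewrite -normr_hdot rnormE -rmorphXn/= sqr_ge0.
Qed.

Lemma Re_hdotxx (H : hilbertType R) (x : H) : Re (hdot x x) = rnorm x ^+ 2.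
Proof. by rewrite -normr_hdot rnormE -rmorphXn. Qed.

Lemma hdotxx (H : hilbertType R) (x : H) : hdot x x = (rnorm x ^+ 2)%:C.
Proof. by rewrite -normr_hdot rnormE -rmorphXn. Qed.

Lemma cauchy_schwarz (H : hilbertType R) (x y : H) :
  rnorm (hdot x y) <= rnorm x * rnorm y.
Proof.
have := sdot_cauchy_schwarz (hdot_semi H) x y.
by rewrite /snorm !Re_hdotxx !sqrtr_sqr !ger0_norm ?rnorm_ge0.
Qed.

Lemma hdot_eq (H : hilbertType R) (x y : H) :
  (forall z, hdot x z = hdot y z) -> x = y.
Proof.
move=> h; apply/eqP; rewrite -subr_eq0; apply/eqP/rnorm_eq0/eqP.
rewrite -sqrf_eq0 -Re_hdotxx (sdotDl (hdot_semi H)) (sdotNl (hdot_semi H)).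
by rewrite h subrr.
Qed.

Lemma hdot_eqr (H : hilbertType R) (x y : H) :
  (forall z, hdot z x = hdot z y) -> x = y.
Proof.
move=> h; apply: hdot_eq => z.
by rewrite (semi_dotC (hdot_semi H)) h -(semi_dotC (hdot_semi H)).
Qed.

End hilbert.

(** * Riesz representation along a linear map *)

Section linear_facts.
Variables (K : nzRingType) (U V : lmodType K) (T : U -> V) (hT : linear T).

Lemma linear_opD x y : T (x + y) = T x + T y.
Proof. by have := hT 1 x y; rewrite !scale1r. Qed.

Lemma linear_op0 : T 0 = 0.
Proof. by apply: (addrI (T 0)); rewrite -linear_opD !addr0. Qed.

Lemma linear_opZ a x : T (a *: x) = a *: T x.
Proof. by have := hT a x 0; rewrite linear_op0 !addr0. Qed.

Lemma linear_opN x : T (- x) = - T x.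
Proof. by rewrite -scaleN1r linear_opZ scaleN1r. Qed.

Lemma linear_opB x y : T (x - y) = T x - T y.
Proof. by rewrite linear_opD linear_opN. Qed.

Lemma linear_op_sum I (r : seq I) (P : pred I) (F : I -> U) :
  T (\sum_(i <- r | P i) F i) = \sum_(i <- r | P i) T (F i).
Proof.
elim/big_rec2 : _ => [|i a b _ <-]; first exact: linear_op0.
by rewrite linear_opD.
Qed.

End linear_facts.

Section riesz.
Variable R : realType.
Local Notation C := R[i].

Lemma hnormD (H : hilbertType R) (x y : H) :
  rnorm (x + y) ^+ 2 = rnorm x ^+ 2 + rnorm y ^+ 2 + 2 * Re (hdot x y).
Proof.
have := sdot_normB (hdot_semi H) x (- y).
rewrite opprK !Re_hdotxx rnormN (sdotNr (hdot_semi H)) => ->.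
by case: (hdot x y) => a b /=; lra.
Qed.

Section functional.
Variables (K : lmodType C) (H : hilbertType R) (D : K -> H) (l : K -> C).
Variable (N : R).
Hypotheses (linD : linear D).
Hypotheses (linl : forall a x y, l (a *: x + y) = a * l x + l y).
Hypothesis (N0 : 0 <= N).
Hypothesis (lN : forall y, rnorm (l y) <= rnorm (D y) * N).

Let hS := hdot_semi H.

Let lin_l : linear (l : K -> C^o).
Proof. exact: linl. Qed.

Let J y := rnorm (D y) ^+ 2 - 2 * Re (l y).

Let J_lower y : - N ^+ 2 <= J y.
Proof.
rewrite /J; have := Re_le_rnorm (l y); have := lN y.
have := sqr_ge0 (rnorm (D y) - N); nra.
Qed.

Let J_has_inf : has_inf (range J).
Proof.
split; first by exists (J 0); exists 0.
by exists (- N ^+ 2) => _ [y _ <-]; exact: J_lower.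
Qed.

Let m := inf (range J).

Let J_ge y : m <= J y.
Proof. by apply: inf_lbound; [case: J_has_inf|exists y]. Qed.

Let J_near e : 0 < e -> exists y, J y < m + e.
Proof.
by move=> e0; have [_ [y _ <-] ?] := inf_adherent e0 J_has_inf; exists y.
Qed.

Let J_mid x y : rnorm (D x - D y) ^+ 2 =
  2 * J x + 2 * J y - 4 * J ((2^-1 : R)%:C *: (x + y)).
Proof.
have E1 := sdot_normB hS (D x) (D y).
have E2 := sdot_normB hS (D x) (- D y).
have N2 := sdot_normZ hS ((2^-1 : R)%:C) (D x + D y).
move: E1 E2 N2; rewrite !opprK !Re_hdotxx => -> E2 N2.
rewrite /J (linear_opZ linD) (linear_opD linD) N2.
have -> : l ((2^-1 : R)%:C *: (x + y)) = (2^-1 : R)%:C * (l x + l y).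
  by rewrite (linear_opZ lin_l) (linear_opD lin_l).
move: E2; rewrite rnormN (sdotNr hS) rnormc ger0_norm ?invr_ge0//.
by case: (hdot (D x) (D y)) (l x) (l y) => [a b] [c d] [e f]/=; lra.
Qed.

(** A minimising sequence y_n of |D y| ^ 2 - 2 Re (l y) makes D y_n a Cauchy
    sequence, by the parallelogram law, and the limit represents l because the
    first variation vanishes there.  The limit lies in the closure of the range of
    D: this makes it unique, hence linear in l. *)
Lemma riesz_functional : exists u : H,
  [/\ forall y, l y = hdot (D y) u, rnorm u <= N &
      forall e, 0 < e -> exists y, rnorm (D y - u) <= e].
Proof.
pose d n : R := n.+1%:R^-1.
have d0 n : 0 < d n by rewrite invr_gt0.
have /choice[y hy] n : exists y, J y < m + (d n / 2) ^+ 2.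
  by apply: J_near; rewrite exprn_gt0// divr_gt0.
have [u hu] : exists u, forall n, rnorm (D (y n) - u) <= d n.
  apply: rnorm_complete; last exact: cvg_harmonic.
  move=> n k nk; rewrite -(@ler_pXn2r _ 2) ?nnegrE ?rnorm_ge0// 1?ltW//.
  have dk : d k <= d n by rewrite lef_pV2 ?posrE// ler_nat ltnS.
  rewrite J_mid; have := J_ge ((2^-1 : R)%:C *: (y k + y n)).
  have := hy n; have := hy k; have := d0 k; have := d0 n; nra.
have dlim e : 0 < e -> exists n, d n < e.
  move=> e0; have /cvgrPdist_lt/(_ _ e0)[n _ hn] := @cvg_harmonic R.
  exists n; have := hn n (leqnn n).
  by rewrite /= sub0r normrN ger0_norm// ltW// d0.
have key x : l x = hdot (D x) u.
  apply/eqP; rewrite -subr_eq0; apply/eqP/rnorm_eq0.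
  set z := _ - _; have [w w1 wz] := unimodular_mul z.
  apply/eqP; rewrite eq_le rnorm_ge0 andbT.
  apply/ler_addgt0Pr => e e0; rewrite add0r.
  (* the first variation of J along a small multiple of w x *)
  pose A := rnorm (D x) ^+ 2 + 2 * rnorm (D x) + 1.
  have A0 : 0 < A by rewrite ltr_wpDl// addr_ge0 ?sqr_ge0// mulr_ge0 ?rnorm_ge0.
  have [n hn] := dlim (e / A) (divr_gt0 e0 A0).
  rewrite ltr_pdivlMr// in hn.
  have J1 := J_ge (y n + ((d n)%:C * w) *: x).
  have J2 := hy n; have un := hu n; have dn := d0 n.
  have JE : J (y n + ((d n)%:C * w) *: x) - J (y n) =
      (d n) ^+ 2 * rnorm (D x) ^+ 2 +
      2 * (d n * Re (w * hdot (D x) (D (y n) - u)) - d n * rnorm z).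
    rewrite /J (linear_opD linD) (linear_opZ linD) (linear_opD lin_l).
    rewrite (linear_opZ lin_l) hnormD -!Re_hdotxx (sdot_normZ hS).
    rewrite rnormM w1 mulr1 rnormc ger0_norm ?(ltW dn)//.
    rewrite (Re_sdotC hS (D (y n)) (_ *: _)) (sdotZl hS) -[rnorm z]/(Re (rnorm z)%:C) -wz /z.
    rewrite (sdotDr hS) (sdotNr hS) /GRing.scale/=.
    move: (hdot (D x) (D (y n))) (l x) (l (y n)) (hdot (D x) u) w {w1 wz J1}.
    move=> [a b] [a' b'] [a'' b''] [a3 b3] [a4 b4] /=; ring.
  have B1 : Re (w * hdot (D x) (D (y n) - u)) <= rnorm (D x) * d n.
    rewrite (le_trans (Re_le_rnorm _))// rnormM w1 mul1r.
    by rewrite (le_trans (cauchy_schwarz _ _))// ler_wpM2l ?rnorm_ge0.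
  suff : rnorm z <= d n * A by move=> /le_trans; apply; exact: ltW.
  rewrite -(ler_pM2l dn) /A.
  have := rnorm_ge0 (D x); have := rnorm_ge0 z; nra.
exists u; split => //; last first.
  move=> e e0; have [n hn] := dlim _ e0; exists (y n).
  by rewrite (le_trans (hu n))// ltW.
have [u0|/rnorm_gt0 u0] := eqVneq u 0; first by rewrite u0 rnorm0.
rewrite -(ler_pM2r u0); apply/ler_addgt0Pr => e e0.
pose A := rnorm u + N; have A0 : 0 < A by rewrite ltr_wpDr.
have [n hn] := dlim (e / A) (divr_gt0 e0 A0).
rewrite ltr_pdivlMr// in hn.
have E1 : rnorm u * rnorm u = Re (hdot (u - D (y n)) u) + Re (l (y n)).
  rewrite key -expr2 -Re_hdotxx (sdotDl hS) (sdotNl hS).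
  by case: (hdot u u) (hdot (D (y n)) u) => [a b] [c f]/=; lra.
have E2 : Re (hdot (u - D (y n)) u) <= d n * rnorm u.
  rewrite (le_trans (Re_le_rnorm _))// (le_trans (cauchy_schwarz _ _))//.
  by rewrite ler_wpM2r ?rnorm_ge0// rnormBC.
have E3 := le_trans (Re_le_rnorm _) (lN (y n)).
have E4 : rnorm (D (y n)) <= rnorm u + d n.
  by have := rnorm_lowerB (D (y n)) u; have := hu n; lra.
have E5 := ler_wpM2r N0 E4; rewrite /A in hn.
move: hn; rewrite E1 mulrDr => hn; lra.
Qed.

End functional.

(** With D the identity this gives adjoints, and operators defined by bounded
    sesquilinear forms; with D a defect operator it is one half of Douglas'
    lemma: the range of D may fail to be closed. *)
Lemma riesz_factor (K L : lmodType C) (H : hilbertType R) (D : K -> H)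
    (b : K -> L -> C) (N : L -> R) :
  linear D ->
  (forall x a y z, b (a *: y + z) x = a * b y x + b z x) ->
  (forall y a x z, b y (a *: x + z) = conjc a * b y x + b y z) ->
  (forall x, 0 <= N x) ->
  (forall y x, rnorm (b y x) <= rnorm (D y) * N x) ->
  exists T : L -> H, [/\ linear T, forall x, rnorm (T x) <= N x &
    forall y x, b y x = hdot (D y) (T x)].
Proof.
move=> linD bl br N0 bN.
have hS := hdot_semi H.
have /choice[T hT] x : exists u, [/\ forall y, b y x = hdot (D y) u,
    rnorm u <= N x & forall e, 0 < e -> exists y, rnorm (D y - u) <= e].
  exact: riesz_functional.
exists T; split => [a x z|x|y x]; [|by case: (hT x)..].
apply/eqP; rewrite -subr_eq0; apply/eqP.
set w := _ - _.
have w0 y : hdot (D y) w = 0.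
  rewrite /w (sdotDr hS) (sdotNr hS) (sdotDr hS) (sdotZr hS).
  by have [<- _ _] := hT (a *: x + z); have [<- _ _] := hT x;
    have [<- _ _] := hT z; rewrite br subrr.
have wlim e : 0 < e -> exists y, rnorm (D y - w) <= e.
  move=> e0; pose A := rnorm a + 2; have A0 : 0 < A.
    by rewrite ltr_wpDl// rnorm_ge0.
  have eA := divr_gt0 e0 A0.
  have [_ _ /(_ _ eA)[y1 h1]] := hT (a *: x + z).
  have [_ _ /(_ _ eA)[y2 h2]] := hT x.
  have [_ _ /(_ _ eA)[y3 h3]] := hT z.
  exists (y1 - (a *: y2 + y3)).
  have -> : D (y1 - (a *: y2 + y3)) - w =
      (D y1 - T (a *: x + z)) - (a *: (D y2 - T x) + (D y3 - T z)).
    rewrite /w (linear_opB linD) linD scalerBr.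
    have zm (p q r p' q' r' : H) :
        p - (q + r) - (p' - (q' + r')) = p - p' - (q - q' + (r - r')).
      by rewrite !opprD !opprK !addrA [LHS](ACl (1*4*2*5*3*6)%AC).
    exact: zm.
  apply: (le_trans (rnormB _ _)).
  have h4 := rnormD (a *: (D y2 - T x)) (D y3 - T z).
  have h5 := ler_wpM2l (rnorm_ge0 a) h2.
  rewrite rnormZ in h4.
  have -> : e = e / A + (rnorm a * (e / A) + e / A).
    by rewrite /A; field; rewrite gt_eqF.
  lra.
clearbody w; apply: (@rnorm_eq0 _ H); apply/eqP; rewrite eq_le rnorm_ge0 andbT.
apply/ler_addgt0Pr => e e0; rewrite add0r.
have [y hy] := wlim _ e0.
have E : rnorm w ^+ 2 = - Re (hdot (D y - w) w).
  rewrite -Re_hdotxx (sdotDl hS) (sdotNl hS) w0 add0r.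
  by case: (hdot w w) => p q /=; rewrite opprK.
have := Re_le_rnorm (- hdot (D y - w) w).
rewrite rnormN => /le_trans /(_ (cauchy_schwarz _ _)).
have -> : Re (- hdot (D y - w) w) = rnorm w ^+ 2.
  by rewrite E; case: (hdot (D y - w) w).
have [w00|w00] := eqVneq (rnorm w) 0; first by move=> _; rewrite w00 ltW.
have w1 : 0 < rnorm w by rewrite lt_neqAle eq_sym w00 rnorm_ge0.
by rewrite expr2 ler_pM2r// => /le_trans; apply.
Qed.

End riesz.

(** * Adjoints, square roots and defect operators *)

Section adjoints.
Variable R : realType.
Local Notation C := R[i].
Implicit Types H K : hilbertType R.

Lemma bounded_opP H K (T : H -> K) : bounded_op T <->
  linear T /\ exists2 M : R, 0 <= M & forall x, rnorm (T x) <= M * rnorm x.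
Proof.
split=> [[linT [M hM]]|[linT [M M0 hM]]]; split => //.
  exists `|Re M| => // x; have := hM x; rewrite !rnormE => h.
  have : rnorm (T x) <= Re M * rnorm x.
    move: h; rewrite lecE => /andP[_]/=.
    by case: (M) => a b /=; rewrite mulr0 subr0.
  by move=> /le_trans; apply; rewrite ler_wpM2r ?rnorm_ge0// ler_norm.
by exists M%:C => x; rewrite !rnormE -rmorphM/= lecR.
Qed.

Lemma contraction_opP H K (T : H -> K) : contraction_op T <->
  linear T /\ forall x, rnorm (T x) <= rnorm x.
Proof.
by split=> -[linT h]; split => // x; have := h x; rewrite !rnormE lecR.
Qed.

Lemma contraction_bounded H K (T : H -> K) :
  contraction_op T -> bounded_op T.
Proof.
move=> /contraction_opP[linT h]; apply/bounded_opP; split => //.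
by exists 1 => // x; rewrite mul1r.
Qed.

Lemma adjoint_exists H K (T : H -> K) (M : R) : linear T -> 0 <= M ->
  (forall x, rnorm (T x) <= M * rnorm x) ->
  exists S : K -> H, [/\ linear S, forall y, rnorm (S y) <= M * rnorm y &
    forall x y, hdot (T x) y = hdot x (S y)].
Proof.
move=> linT M0 hM.
apply: (@riesz_factor R H K H id (fun x y => hdot (T x) y)
  (fun y => M * rnorm y)) => //.
- by move=> x a y z; rewrite linT (semi_dotP (hdot_semi K)).
- move=> x a y z.
  by rewrite (sdotDr (hdot_semi K)) (sdotZr (hdot_semi K)).
- by move=> y; rewrite mulr_ge0 ?rnorm_ge0.
- move=> x y; rewrite (le_trans (cauchy_schwarz _ _))//.
  by rewrite mulrCA mulrA ler_wpM2r ?rnorm_ge0.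
Qed.

Lemma adjoint_opP H K (T : H -> K) : bounded_op T ->
  bounded_op (adjoint_op T) /\ forall x y, hdot (T x) y = hdot x (adjoint_op T y).
Proof.
move=> /bounded_opP[linT [M M0 hM]].
have [S [linS hS adjS]] := adjoint_exists linT M0 hM.
apply: (@xgetPex _ 0 [set S | bounded_op S /\
  forall x y, hdot (T x) y = hdot x (S y)]).
by exists S; split => //; apply/bounded_opP; split => //; exists M.
Qed.

Lemma adjoint_op_bound H K (T : H -> K) (M : R) : bounded_op T -> 0 <= M ->
  (forall x, rnorm (T x) <= M * rnorm x) ->
  forall y, rnorm (adjoint_op T y) <= M * rnorm y.
Proof.
move=> bT M0 hM y; have [_ adjT] := adjoint_opP bT.
have [->|z0] := eqVneq (adjoint_op T y) 0.
  by rewrite rnorm0 mulr_ge0 ?rnorm_ge0.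
rewrite -(ler_pM2r (rnorm_gt0 z0)) -expr2 -Re_hdotxx -adjT.
rewrite (le_trans (Re_le_rnorm _))// (le_trans (cauchy_schwarz _ _))//.
by rewrite mulrAC ler_wpM2r ?rnorm_ge0.
Qed.

Lemma adjoint_contraction H K (T : H -> K) :
  contraction_op T -> contraction_op (adjoint_op T).
Proof.
move=> cT; have bT := contraction_bounded cT.
have [/bounded_opP[linT _] _] := adjoint_opP bT.
apply/contraction_opP; split => // y; rewrite -[leRHS]mul1r.
apply: adjoint_op_bound => // x; rewrite mul1r.
by case/contraction_opP : cT.
Qed.

(** Polarisation: the form (D x, y) - (x, D y) vanishes on the diagonal. *)
Lemma pos_selfadjoint H (D : H -> H) : linear D ->
  (forall x, 0 <= hdot (D x) x) -> forall x y, hdot (D x) y = hdot x (D y).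
Proof.
move=> linD D0; have hS := hdot_semi H.
pose E x y := hdot (D x) y - hdot x (D y).
have E0 x : E x x = 0.
  rewrite /E (semi_dotC hS x); have := D0 x.
  case: (hdot (D x) x) => a b; rewrite lecE/= => /andP[/eqP-> _].
  by apply/eqP; rewrite eq_complex/= opprK subrr addr0 !eqxx.
have EDl x y z : E (x + y) z = E x z + E y z.
  rewrite /E (linear_opD linD) !(sdotDl hS) opprD -!addrA; congr (_ + _).
  by rewrite addrCA.
have EDr x y z : E z (x + y) = E z x + E z y.
  rewrite /E (linear_opD linD) !(sdotDr hS) opprD -!addrA; congr (_ + _).
  by rewrite addrCA.
have EZl a x y : E (a *: x) y = a * E x y.
  by rewrite /E (linear_opZ linD) !(sdotZl hS) mulrBr.
have EZr a x y : E y (a *: x) = conjc a * E y x.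
  by rewrite /E (linear_opZ linD) !(sdotZr hS) mulrBr.
have Eanti x y : E x y = - E y x.
  have := E0 (x + y); rewrite EDl !EDr !E0 add0r addr0 => /eqP.
  by rewrite addr_eq0 => /eqP.
move=> x y; apply/eqP; rewrite -subr_eq0; apply/eqP.
have := Eanti ('i *: x) y; rewrite EZl EZr -/(E x y) [E y x]Eanti.
case: (E x y) => a b/= [h1 h2]; apply/eqP; rewrite eq_complex/=.
by apply/andP; split; apply/eqP; lra.
Qed.

End adjoints.

Section square_roots.
Variables (R : realType) (H : hilbertType R) (A : H -> H).
Local Notation C := R[i].
Hypothesis (cA : linear A) (nA : forall x, rnorm (A x) <= rnorm x).
Hypothesis (sA : forall x y, hdot (A x) y = hdot x (A y)).

Let hS := hdot_semi H.
Let h2 : C := (2^-1 : R)%:C.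

Let h2n : rnorm h2 = 2^-1.
Proof. by rewrite rnormc ger0_norm// invr_ge0. Qed.

Let S := fix S n : H -> H :=
  if n is k.+1 then fun x => h2 *: (A x + S k (S k x)) else fun=> 0.
Let s := fix s n : R := if n is k.+1 then (1 + s k ^+ 2) / 2 else 0.

Let s_bounds n : 0 <= s n <= 1.
Proof. by elim: n => [|n ih]//=; first lra; nra. Qed.

Let s_nd n : s n <= s n.+1.
Proof. by have := s_bounds n; have := sqr_ge0 (1 - s n) => /=; nra. Qed.

Let S_lin n : linear (S n).
Proof.
elim: n => [|n ih] a x y /=; first by rewrite scaler0 addr0.
rewrite cA !ih scalerA mulrC -scalerA -scalerDr; congr (_ *: _).
by rewrite scalerDr addrACA.
Qed.

Let S_norm n x : rnorm (S n x) <= s n * rnorm x.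
Proof.
elim: n x => [|n ih] x /=; first by rewrite rnorm0 mul0r.
rewrite rnormZ h2n.
have h1 := rnormD (A x) (S n (S n x)); have h3 := nA x.
have h4 := ih (S n x).
have /andP[s0 _] := s_bounds n; have h5 := ler_wpM2l s0 (ih x).
lra.
Qed.

Let S_sa n x y : hdot (S n x) y = hdot x (S n y).
Proof.
elim: n x y => [|n ih] x y /=; first by rewrite (sdot0l hS) (sdot0r hS).
rewrite (sdotZl hS) (sdotZr hS) /h2 conjc_real (sdotDl hS) (sdotDr hS).
by rewrite sA !ih.
Qed.

Let S_step n x : rnorm (S n.+1 x - S n x) <= (s n.+1 - s n) * rnorm x.
Proof.
elim: n x => [|n ih] x.
  have := S_norm 1 x; rewrite [S 0 x]/=/= subr0; lra.
have -> : S n.+2 x - S n.+1 x =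
    h2 *: (S n.+1 (S n.+1 x - S n x) + (S n.+1 (S n x) - S n (S n x))).
  rewrite (linear_opB (S_lin n.+1)) addrA subrK.
  transitivity (h2 *: (A x + S n.+1 (S n.+1 x)) - h2 *: (A x + S n (S n x))).
    by [].
  rewrite -scalerBr; congr (_ *: _).
  by rewrite opprD addrACA subrr add0r.
rewrite rnormZ h2n.
set a := S n.+1 _; set b := _ - S n _.
have h1 := rnormD a b.
have h3 : rnorm a <= s n.+1 * ((s n.+1 - s n) * rnorm x).
  rewrite (le_trans (S_norm _ _))// ler_wpM2l//.
  by case/andP : (s_bounds n.+1).
have h4 : rnorm b <= (s n.+1 - s n) * (s n * rnorm x).
  by rewrite (le_trans (ih _))// ler_wpM2l// subr_ge0.
have e1 : s n.+2 = (1 + s n.+1 ^+ 2) / 2 by [].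
have e2 : s n.+1 * rnorm x = (1 + s n ^+ 2) / 2 * rnorm x by [].
rewrite e1 mulrBl e2; move: (s n.+1) (s n) h1 h3 h4 e2 => p q *; lra.
Qed.

Let S_cauchy n m x : (n <= m)%N ->
  rnorm (S m x - S n x) <= (s m - s n) * rnorm x.
Proof.
move=> /subnK <-; elim: (m - n)%N => [|k ih].
  by rewrite add0n !subrr rnorm0 mul0r.
have := rnormDist (S (k + n)%N x) (S (k.+1 + n)%N x) (S n x).
have := S_step (k + n) x; rewrite -addSn; lra.
Qed.

Let L := limn s.

Let s_cvg : s @ \oo --> L.
Proof.
apply: nondecreasing_is_cvgn.
  by apply/nondecreasing_seqP => n; exact: s_nd.
by exists 1 => _ [n _ <-]; case/andP : (s_bounds n).
Qed.

Let d n := L - s n.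

Let d_cvg : d @ \oo --> (0 : R).
Proof. by rewrite -(subrr L); apply: cvgB => //; exact: cvg_cst. Qed.

Let s_leL n : s n <= L.
Proof.
apply: nondecreasing_cvgn_le; last by apply/cvg_ex; exists L.
by apply/nondecreasing_seqP => k; exact: s_nd.
Qed.

Let d_small (M x : R) : (forall n, x <= M * d n) -> x <= 0.
Proof.
move=> h; apply/ler_addgt0Pr => e e0; rewrite add0r.
have M0 : 0 < `|M| + 1 by rewrite ltr_wpDl.
have /cvgrPdist_lt/(_ _ (divr_gt0 e0 M0))[n _ /(_ n (leqnn n))] := d_cvg.
rewrite /= sub0r normrN => hn; rewrite (le_trans (h n))//.
rewrite (le_trans (ler_norm _))// normrM ltW//.
move: hn; rewrite ltr_pdivlMr//; have := normr_ge0 (d n); nra.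
Qed.

(** The square root of 1 - A is 1 - S, where S is the limit of the polynomials
    S_(n+1) = (A + S_n ^ 2) / 2 in A.  Their increments are dominated in norm by
    those of the scalar sequence s_(n+1) = (1 + s_n ^ 2) / 2, which increases and
    is bounded by 1; so the limit exists in norm. *)
Lemma sqrt_exists : exists D : H -> H,
  [/\ bounded_op D, forall x, 0 <= hdot (D x) x & D \o D = id - A].
Proof.
have /choice[T hT] x : exists l, forall n, rnorm (S n x - l) <= d n * rnorm x.
  apply: rnorm_complete.
    move=> n m nm; rewrite (le_trans (S_cauchy x nm))//.
    by rewrite ler_wpM2r ?rnorm_ge0// lerD2r.
  by rewrite -(mul0r (rnorm x)); apply: cvgMr_tmp.
have lim_eq (x y : H) (M : R) : (forall n, rnorm (x - y) <= M * d n) -> x = y.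
  move=> /d_small h; apply/eqP; rewrite -subr_eq0; apply/eqP/rnorm_eq0.
  by apply/eqP; rewrite eq_le h rnorm_ge0.
have linT : linear T.
  move=> a x y.
  apply: (@lim_eq _ _ (rnorm (a *: x + y) + rnorm a * rnorm x + rnorm y)) => n.
  have h1 := hT (a *: x + y) n; have h3 := hT x n; have h4 := hT y n.
  have -> : T (a *: x + y) - (a *: T x + T y) =
    a *: (S n x - T x) + (S n y - T y) - (S n (a *: x + y) - T (a *: x + y)).
    rewrite S_lin scalerBr !opprD !opprK !addrA.
    by rewrite [RHS](ACl (7*2*4*(1*5)*(3*6))%AC)/= !subrr !addr0.
  apply: (le_trans (rnormB _ _)).
  have h5 := rnormD (a *: (S n x - T x)) (S n y - T y).
  have h6 := ler_wpM2l (rnorm_ge0 a) h3; rewrite rnormZ in h5; lra.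
have L1 : L <= 1.
  rewrite -subr_le0; apply: (@d_small 1) => n.
  by have /andP[_ s1] := s_bounds n; rewrite /d mul1r lerD2l lerN2.
have T_norm x : rnorm (T x) <= rnorm x.
  have := hT x 0; rewrite /d /= sub0r subr0 rnormN => h.
  by rewrite (le_trans h)// ler_piMl ?rnorm_ge0.
have T_sa x y : hdot (T x) y = hdot x (T y).
  apply/eqP; rewrite -subr_eq0; apply/eqP/rnorm_eq0.
  apply/eqP; rewrite eq_le rnorm_ge0 andbT.
  apply: (@d_small (2 * rnorm x * rnorm y)) => n.
  have -> : hdot (T x) y - hdot x (T y) =
      hdot x (S n y - T y) - hdot (S n x - T x) y.
    rewrite (sdotDr hS) (sdotNr hS) (sdotDl hS) (sdotNl hS) S_sa.
    by rewrite opprD opprK addrACA subrr add0r addrC.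
  apply: (le_trans (rnormB _ _)).
  have h1 := cauchy_schwarz x (S n y - T y).
  have h3 := cauchy_schwarz (S n x - T x) y.
  have h4 := ler_wpM2l (rnorm_ge0 x) (hT y n).
  have h5 := ler_wpM2r (rnorm_ge0 y) (hT x n).
  lra.
have d_nd n : d n.+1 <= d n by rewrite lerD2l lerN2.
have T_fix x : T x = h2 *: (A x + T (T x)).
  apply: (@lim_eq _ _ (2 * rnorm x + rnorm (T x))) => n.
  have -> : T x - h2 *: (A x + T (T x)) = - (S n.+1 x - T x) +
      h2 *: (S n (S n x - T x) + (S n (T x) - T (T x))).
    rewrite (linear_opB (S_lin n)) [_ + (_ - T (T x))]addrA subrK.
    rewrite (_ : S n (S n x) - T (T x) =
      (A x + S n (S n x)) - (A x + T (T x))); last first.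
      by rewrite opprD addrACA subrr add0r.
    by rewrite scalerBr -[h2 *: (A x + S n _)]/(S n.+1 x) addrA opprB subrK.
  rewrite (le_trans (rnormD _ _))// rnormN rnormZ h2n.
  have h1 := hT x n.+1; have h3 := hT (T x) n.
  have h4 := S_norm n (S n x - T x).
  have /andP[s0 s1] := s_bounds n.
  have h5 := rnormD (S n (S n x - T x)) (S n (T x) - T (T x)).
  have h6 := ler_wpM2l s0 (hT x n).
  have d0 : 0 <= d n * rnorm x.
    by rewrite mulr_ge0 ?rnorm_ge0// subr_ge0.
  have h7 := ler_wpM2r (rnorm_ge0 x) (d_nd n).
  have h8 := ler_wpM2r d0 s1.
  have d1 : 0 <= d n * rnorm (T x) by rewrite mulr_ge0 ?rnorm_ge0// subr_ge0.
  lra.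
have linD : linear (fun x => x - T x).
  by move=> a x y; rewrite linT scalerBr opprD addrACA.
exists (fun x => x - T x); split.
- apply/bounded_opP; split=> //; exists 2 => // x.
  by rewrite (le_trans (rnormB _ _))//; have := T_norm x; lra.
- move=> x; rewrite (sdotDl hS) (sdotNl hS) hdotxx.
  have xr : hdot (T x) x = (Re (hdot (T x) x))%:C.
    have := T_sa x x; rewrite (semi_dotC hS x).
    case: (hdot (T x) x) => a b /= [b0]; apply/eqP.
    by rewrite eq_complex/= eqxx/=; apply/eqP; lra.
  rewrite xr -rmorphB/= ler0c subr_ge0 (le_trans (Re_le_rnorm _))//.
  rewrite (le_trans (cauchy_schwarz _ _))// expr2 ler_wpM2r ?rnorm_ge0//.
apply/funext => x; rewrite /= (linear_opB linT).
have TT : T (T x) = (2%:R : C) *: T x - A x.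
  rewrite [in RHS](T_fix x) scalerA /h2.
  have -> : (2 : C) * (2^-1 : R)%:C = 1.
    by rewrite -(rmorph_nat (real_complex R)) -rmorphM/= divff// pnatr_eq0.
  by rewrite scale1r addrC addKr.
rewrite TT scaler_nat mulr2n -[(id - A) x]/(x - A x).
rewrite opprB -addrA; congr (_ + _).
by rewrite !addrA addNr add0r addrAC subrr add0r.
Qed.

End square_roots.

Section defect.
Variable R : realType.
Local Notation C := R[i].
Implicit Types H K : hilbertType R.

Lemma defect_opP H K (T : H -> K) : contraction_op T ->
  [/\ linear (defect_op T),
    forall x y, hdot (defect_op T x) y = hdot x (defect_op T y) &
    forall x, rnorm (defect_op T x) ^+ 2 = rnorm x ^+ 2 - rnorm (T x) ^+ 2].
Proof.
move=> cT; have bT := contraction_bounded cT.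
have [bS adjS] := adjoint_opP bT; have cS := adjoint_contraction cT.
have [linT nT] := (contraction_opP _).1 cT.
have [linS nS] := (contraction_opP _).1 cS.
pose A := adjoint_op T \o T.
have linA : linear A by move=> a x y; rewrite /A/= linT linS.
have nA x : rnorm (A x) <= rnorm x by rewrite (le_trans (nS _)).
have AE x y : hdot (A x) y = hdot (T x) (T y).
  by rewrite (semi_dotC (hdot_semi H)) -adjS -(semi_dotC (hdot_semi K)).
have sA x y : hdot (A x) y = hdot x (A y) by rewrite AE adjS.
have [bD D0 DD] : [set D | [/\ bounded_op D, forall x, 0 <= hdot (D x) x &
    D \o D = id - A]] (defect_op T).
  by apply: (@xgetPex _ (0 : H -> H)); exact: sqrt_exists.
have linD : linear (defect_op T) by case: bD.
have saD := pos_selfadjoint linD D0.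
split => // x; rewrite -!Re_hdotxx saD -[defect_op T (_ x)]/((_ \o _) x) DD.
rewrite -[(id - A) x]/(x - A x) (sdotDr (hdot_semi H)) (sdotNr (hdot_semi H)).
by rewrite -sA AE; case: (hdot x x) (hdot (T x) (T x)) => [a b] [c d].
Qed.

(** With D the defect operator of the adjoint, the column of T^* and D is
    isometric, so its adjoint, the row of T and D, is a contraction. *)
Lemma defect_row H K (T : H -> K) (x : H) (w : K) : contraction_op T ->
  rnorm (T x + defect_op (adjoint_op T) w) ^+ 2 <= rnorm x ^+ 2 + rnorm w ^+ 2.
Proof.
move=> cT; have bT := contraction_bounded cT.
have [linD saD nD] := defect_opP (adjoint_contraction cT).
have [_ adjS] := adjoint_opP bT.
set D := defect_op _ in linD saD nD *.
set u := T x + D w.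
have E : rnorm u ^+ 2 = Re (hdot x (adjoint_op T u)) + Re (hdot w (D u)).
  rewrite -Re_hdotxx {1}/u (sdotDl (hdot_semi K)) adjS saD.
  by case: (hdot x _) (hdot w _) => [a b] [c d].
have h1 := sdot_young (hdot_semi H) x (adjoint_op T u).
have h2 := sdot_young (hdot_semi K) w (D u).
have := nD u; rewrite !Re_hdotxx in h1 h2; lra.
Qed.

(** Factor first through E, then through D on the other side; the second factor
    comes out as the adjoint of Y. *)
Lemma douglas_factor H K (Z : K -> H) (D : K -> K) (E : H -> H) :
  linear Z -> linear D -> linear E ->
  (forall x y, hdot (E x) y = hdot x (E y)) ->
  (forall y x, rnorm (hdot (Z y) x) <= rnorm (D y) * rnorm (E x)) ->
  exists2 Y : K -> H, contraction_op Y & Z = E \o Y \o D.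
Proof.
move=> linZ linD linE saE hZ; have hH := hdot_semi H; have hK := hdot_semi K.
have [Z' [linZ' nZ' Z'E]] : exists T : K -> H, [/\ linear T,
    forall y, rnorm (T y) <= rnorm (D y) &
    forall x y, hdot x (Z y) = hdot (E x) (T y)].
  apply: (@riesz_factor R H K H E (fun x y => hdot x (Z y))) => //.
  - by move=> y a x z; rewrite (semi_dotP hH).
  - by move=> x a y z; rewrite linZ (sdotDr hH) (sdotZr hH).
  - by move=> y; exact: rnorm_ge0.
  - by move=> x y; rewrite (semi_dotC hH) rnorm_conj mulrC.
have [S [linS nS SE]] : exists T : H -> K, [/\ linear T,
    forall x, rnorm (T x) <= rnorm x &
    forall y x, hdot (Z' y) x = hdot (D y) (T x)].
  apply: (@riesz_factor R K H K D (fun y x => hdot (Z' y) x)) => //.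
  - by move=> x a y z; rewrite linZ' (semi_dotP hH).
  - by move=> y a x z; rewrite (sdotDr hH) (sdotZr hH).
  - by move=> x; exact: rnorm_ge0.
  - move=> y x; rewrite (le_trans (cauchy_schwarz _ _))//.
    by rewrite ler_wpM2r ?rnorm_ge0.
have cS : contraction_op S by apply/contraction_opP.
have [_ adjS] := adjoint_opP (contraction_bounded cS).
exists (adjoint_op S); first exact: adjoint_contraction.
apply/funext => y; apply: hdot_eqr => x; rewrite Z'E /= -saE.
congr (hdot _ _); apply: hdot_eq => z; rewrite SE.
by rewrite (semi_dotC hK) adjS -(semi_dotC hH).
Qed.

End defect.

(** * Von Neumann's inequality for polynomials *)

Section roots_of_unity.
Variable R : realType.
Local Notation C := R[i].

Lemma prim_root_exists n : (0 < n)%N -> exists w : C, n.-primitive_root w.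
Proof.
move=> n0; pose p : {poly C} := 'X^n - 1.
have [r pE] := closed_field_poly_normal p.
have mp : p \is monic by rewrite monicXnsubC.
rewrite (monicP mp) scale1r in pE.
have sr : size r = n.
  by have := size_prod_XsubC r id; rewrite -pE size_XnsubC// => -[].
have all_r : all n.-unity_root r.
  apply/allP => z zr; rewrite unity_rootE -subr_eq0.
  have : root p z by rewrite pE root_prod_XsubC.
  by rewrite /root !hornerE.
have ur : uniq r.
  rewrite -separable_prod_XsubC -pE separable_Xn_sub_1//.
  by rewrite pnatr_eq0 -lt0n.
have := has_prim_root n0 all_r ur; rewrite sr leqnn => /(_ isT)/hasP[w _ hw].
by exists w.
Qed.

Lemma prim_root_norm n (w : C) : (0 < n)%N -> n.-primitive_root w ->
  rnorm w = 1.
Proof.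
move=> n0 /prim_expr_order wn; apply/eqP.
rewrite -(@pexpr_eq1 _ _ n) ?rnorm_ge0//.
by rewrite -rnormX wn rnorm1.
Qed.

Lemma unimodular_conj (w : C) : rnorm w = 1 -> conjc w * w = 1.
Proof. by move=> w1; rewrite mulrC -sqr_normc rnormE w1 expr1n. Qed.

Lemma sum_root_unity n (z : C) : z ^+ n = 1 ->
  \sum_(j < n) z ^+ j = if z == 1 then n%:R else 0.
Proof.
move=> zn; case: eqVneq => [->|z1].
  by under eq_bigr do rewrite expr1n; rewrite sumr_const card_ord.
have /eqP := subrX1 z n; rewrite zn subrr eq_sym mulf_eq0 subr_eq0 (negPf z1).
by move=> /eqP.
Qed.

End roots_of_unity.

Section von_neumann.
Variables (R : realType) (V : lmodType R[i]) (B : V -> V -> R[i]).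
Hypothesis hB : semi_dot B.
Variable T : V -> V.
Hypothesis (linT : linear T).
Hypothesis (cT : forall x, Re (B (T x) (T x)) <= Re (B x x)).
Variable (s : R).
Hypothesis (s1 : 1 < s).
Local Notation C := R[i].

Let s0 : 0 < s. Proof. exact: lt_trans s1. Qed.
Let sC0 : s%:C != 0 :> C. Proof. by rewrite eq_complex/= eqxx andbT gt_eqF. Qed.

Let a k x : V := (s%:C ^- k) *: iter k T x.
Let A x := (s%:C^-1) *: T x.

Let linA : linear A.
Proof. by move=> b x y; rewrite /A linT scalerDr scalerA mulrC -scalerA. Qed.

Let A_a k x : A (a k x) = a k.+1 x.
Proof. by rewrite /A /a (linear_opZ linT) scalerA -invfM exprS. Qed.

Let snormA x : Re (B (A x) (A x)) <= Re (B x x).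
Proof.
rewrite /A (sdot_normZ hB) rnormV rnormc gtr0_norm// exprVn.
rewrite (le_trans _ (cT x))// ler_piMl ?(semi_dot_ge0 hB)//.
by rewrite invf_le1 ?exprn_gt0// exprn_ege1// ltW.
Qed.

Let snorm_a k x : snorm B (a k x) <= s ^- k * snorm B x.
Proof.
rewrite /a (snormZ hB) rnormV rnormX rnormc gtr0_norm// ler_wpM2l//.
  by rewrite invr_ge0 exprn_ge0// ltW.
elim: k => [|k ih]//=; rewrite (le_trans _ ih)// ler_sqrt ?semi_dot_ge0//.
Qed.

Let b x y := B x y - B (A x) (A y).

Let hb : semi_dot b.
Proof.
split=> [c x y z|x y|x]; rewrite /b.
- by rewrite linA !(semi_dotP hB); ring.
- by rewrite rmorphB/= -!(semi_dotC hB).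
- have := snormA x; case: (B x x) (B (A x) (A x)) => [? ?] [? ?]/=.
  by rewrite subr_ge0.
Qed.

Section fourier.
Variables (N : nat) (w : C).
Hypotheses (N0 : (0 < N)%N) (wN : N.-primitive_root w).

Let w1 : rnorm w = 1. Proof. exact: prim_root_norm wN. Qed.
Let wc : conjc w * w = 1. Proof. exact: unimodular_conj. Qed.

(* u j x is (1 - w^-j A)^-1 (1 - A^N) x: at an N-th root of unity the geometric
   series reduces to this finite sum *)
Let u j x : V := \sum_(k < N) conjc w ^+ (j * k) *: a k x.
Let x' x := x - a N x.

Let Fk j x k := conjc w ^+ (j * k) *: a k x.

Let Fk_top j x : Fk j x N = a N x.
Proof.
by rewrite /Fk mulnC exprM -rmorphXn/= (prim_expr_order wN) rmorph1 expr1n scale1r.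
Qed.

Let Fk0 j x : Fk j x 0 = x.
Proof. by rewrite /Fk /a muln0 !expr0 invr1 !scale1r. Qed.

Let AuE j x : conjc w ^+ j *: A (u j x) = \sum_(k < N) Fk j x k.+1.
Proof.
rewrite /u (linear_op_sum linA) scaler_sumr; apply: eq_bigr => k _.
by rewrite (linear_opZ linA) A_a scalerA -exprD -mulnS.
Qed.

Let Au j x : conjc w ^+ j *: A (u j x) = u j x - x' x.
Proof.
rewrite AuE; apply/eqP; rewrite -subr_eq0 opprB addrCA /u -sumrB.
have -> : \sum_(i < N) (Fk j x i.+1 - Fk j x i) = Fk j x N - Fk j x 0%N.
  by rewrite -(telescope_sumr _ (leq0n N)) big_mkord.
by rewrite Fk_top Fk0 /x' addrA subrK subrr.
Qed.

(* the form on the left is the Poisson kernel of A at the root of unity w^j,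
   applied to (1 - A^N) x and (1 - A^N) y; it is positive since A is a
   contraction *)
Let b_u j x y : b (u j x) (u j y) = B (u j x) (x' y) + B (x' x) (u j y - x' y).
Proof.
have e z : A (u j z) = w ^+ j *: (u j z - x' z).
  by rewrite -Au scalerA -exprMn [w * _]mulrC wc expr1n scale1r.
rewrite /b !e (sdotZl hB) (sdotZr hB) mulrA rmorphXn/= -exprMn [w * _]mulrC wc.
rewrite expr1n mul1r; move: (u j x) (u j y) (x' x) (x' y) => p q r t.
rewrite !(sdotDl hB) !(sdotDr hB) !(sdotNl hB) !(sdotNr hB).
ring.
Qed.

Let pe d (c : nat -> C) (z : C) : C := \sum_(m < d) c m * z ^+ m.
Let z_ j : C := s%:C * w ^+ j.

Let Pe d (c : nat -> C) x : V := \sum_(m < d) c m *: iter m T x.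
Let Qe d (c : nat -> C) x : V :=
  \sum_(m < d) conjc (c m * s%:C ^+ m) *: a (N - m) x.

Section polynomial.
Variables (d : nat) (c : nat -> C).
Hypothesis dN : (d <= N)%N.
Local Notation p := (pe d c).
Local Notation P := (Pe d c).
Local Notation Q := (Qe d c).

Let ratio (m k : nat) : (k < N)%N -> (m < N)%N ->
  (w ^+ m * conjc w ^+ k == 1) = (m == k).
Proof.
move=> kN mN.
have -> : (w ^+ m * conjc w ^+ k == 1) = (w ^+ m == w ^+ k).
  apply/eqP/eqP => [h|->]; last by rewrite -exprMn [w * _]mulrC wc expr1n.
  have : w ^+ m * (conjc w ^+ k * w ^+ k) = w ^+ k by rewrite mulrA h mul1r.
  by rewrite -exprMn wc expr1n mulr1.
by rewrite (eq_prim_root_expr wN) !modn_small.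
Qed.

(* Fourier inversion on the N-th roots of unity *)
Let sum_u x : \sum_(j < N) p (z_ j) *: u j x = N%:R *: P x.
Proof.
transitivity (\sum_(m < d) \sum_(k < N) (c m * s%:C ^+ m *
    \sum_(j < N) (w ^+ m * conjc w ^+ k) ^+ j) *: a k x).
  under eq_bigr do rewrite /pe scaler_suml.
  rewrite exchange_big/=; apply: eq_bigr => m _.
  under eq_bigr do rewrite /u scaler_sumr.
  rewrite exchange_big/=; apply: eq_bigr => k _.
  rewrite mulr_sumr scaler_suml; apply: eq_bigr => j _.
  rewrite scalerA; congr (_ *: _); rewrite /z_ exprMn -!mulrA; congr (_ * (_ * _)).
  by rewrite exprMn -!exprM [(m * j)%N]mulnC [(k * j)%N]mulnC.
rewrite /Pe scaler_sumr; apply: eq_bigr => m _.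
have mN : (m < N)%N by exact: leq_trans dN.
rewrite (bigD1 (Ordinal mN))//= [X in _ + X]big1 ?addr0; last first.
  move=> k km; rewrite sum_root_unity.
    rewrite ratio// ifN ?mulr0 ?scale0r//.
    by apply: contraNneq km => mk; apply/eqP/val_inj.
  by rewrite exprMn -!exprM ![(_ * N)%N]mulnC !exprM -rmorphXn/=
    (prim_expr_order wN) rmorph1 !expr1n mulr1.
under eq_bigr do rewrite -exprMn [w * _]mulrC wc !expr1n.
rewrite sumr_const card_ord /a !scalerA; congr (_ *: _).
have t0 : s%:C ^+ m != 0 :> C by rewrite expf_neq0.
by rewrite -[1 *+ N]/(N%:R); field.
Qed.

Let ratio_conj (m k : nat) : (k < N)%N -> (m < N)%N ->
  (conjc w ^+ (m + k.+1) == 1) = (k == N - m.+1)%N.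
Proof.
move=> kN mN.
have -> : (conjc w ^+ (m + k.+1) == 1) = (w ^+ (m + k.+1) == 1).
  by rewrite -rmorphXn/= -[X in _ == X]conjc1 (inj_eq (can_inj (@conjcK R))).
rewrite -(prim_order_dvd wN).
apply/idP/eqP => [/dvdnP[q qE]|->]; last first.
  by have -> : (m + (N - m.+1).+1 = N)%N by lia.
have q1 : q = 1%N.
  by case: q qE => [|[|q]] // qE; nia.
lia.
Qed.

(* the conjugate half of the Poisson kernel pairs the coefficient of degree m
   with A^(N - m), which is small when N is large *)
Let sum_Q y : \sum_(j < N) conjc (p (z_ j)) *: (u j y - x' y) = N%:R *: Q y.
Proof.
transitivity (\sum_(m < d) \sum_(k < N) (conjc (c m * s%:C ^+ m) *
    \sum_(j < N) (conjc w ^+ (m + k.+1)) ^+ j) *: a k.+1 y).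
  under eq_bigr do rewrite -Au AuE /pe rmorph_sum/= scaler_suml.
  rewrite exchange_big/=; apply: eq_bigr => m _.
  under eq_bigr do rewrite scaler_sumr.
  rewrite exchange_big/=; apply: eq_bigr => k _.
  rewrite mulr_sumr scaler_suml; apply: eq_bigr => j _.
  rewrite /Fk scalerA; congr (_ *: _); rewrite /z_ exprMn !rmorphM/= -!mulrA.
  congr (_ * (_ * _)).
  by rewrite !rmorphXn/= -!exprM -exprD -mulnDr mulnC.
rewrite /Qe scaler_sumr; apply: eq_bigr => m _.
have mN : (m < N)%N by exact: leq_trans dN.
have kN : (N - m.+1 < N)%N by rewrite ltn_subrL N0.
rewrite (bigD1 (Ordinal kN))//= [X in _ + X]big1 ?addr0; last first.
  move=> k km; rewrite sum_root_unity.
    rewrite ratio_conj// ifN ?mulr0 ?scale0r//.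
  by rewrite -exprM mulnC exprM -rmorphXn/= (prim_expr_order wN) rmorph1 expr1n.
rewrite sum_root_unity; last first.
  by rewrite -exprM mulnC exprM -rmorphXn/= (prim_expr_order wN) rmorph1 expr1n.
rewrite ratio_conj// eqxx -subSn// subSS.
by rewrite [_ * N%:R]mulrC -scalerA.
Qed.

Lemma sum_b x y : \sum_(j < N) p (z_ j) * b (u j x) (u j y) =
  N%:R * (B (P x) (x' y) + B (x' x) (Q y)).
Proof.
under eq_bigr do rewrite b_u mulrDr -(sdotZl hB) -[p _]conjcK
  -(sdotZr hB (conjc (p _))) conjcK.
rewrite big_split/= -(sdot_suml hB) -(sdot_sumr hB) sum_u sum_Q.
by rewrite (sdotZl hB) (sdotZr hB) mulrDr conjc_nat.
Qed.

End polynomial.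

Let z_norm j : rnorm (z_ j) = s.
Proof. by rewrite /z_ rnormM rnormX w1 expr1n mulr1 rnormc gtr0_norm. Qed.

Let sum_b1 x : \sum_(j < N) Re (b (u j x) (u j x)) <= N%:R * Re (B x x).
Proof.
have := @sum_b 1%N (fun=> 1) N0 x x.
have -> : Pe 1 (fun=> 1) x = x by rewrite /Pe big_ord1 scale1r.
have -> : Qe 1 (fun=> 1) x = a N x.
  by rewrite /Qe big_ord1 subn0 expr0 mulr1 conjc1 scale1r.
under eq_bigr do rewrite /pe big_ord1 expr0 !mul1r.
move=> E; rewrite -raddf_sum/= E -[N%:R]/(N%:R) -(rmorph_nat (real_complex R)).
have aN := semi_dot_ge0 hB (a N x).
have -> : Re ((N%:R)%:C * (B x (x' x) + B (x' x) (a N x))) =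
    N%:R * (Re (B x x) - Re (B (a N x) (a N x))).
  rewrite /x'; move: (a N x) => r; rewrite !(sdotDl hB) !(sdotDr hB) !(sdotNl hB).
  rewrite !(sdotNr hB).
  by case: (B x x) (B x r) (B r r) => [? ?] [? ?] [? ?]/=; ring.
by rewrite ler_wpM2l// lerBlDr lerDl.
Qed.

Lemma fourier_ineq d c m x y : (d <= N)%N ->
  (forall z, rnorm z = s -> rnorm (pe d c z) <= m) ->
  2 * rnorm (B (Pe d c x) (x' y) + B (x' x) (Qe d c y)) <=
  m * (Re (B x x) + Re (B y y)).
Proof.
move=> dN pm; have m0 : 0 <= m by rewrite (le_trans _ (pm _ (z_norm 0)))// rnorm_ge0.
have NR : 0 < N%:R :> R by rewrite ltr0n.
rewrite -(ler_pM2l NR) mulrCA.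
have <- : rnorm (\sum_(j < N) pe d c (z_ j) * b (u j x) (u j y)) =
    N%:R * rnorm (B (Pe d c x) (x' y) + B (x' x) (Qe d c y)).
  rewrite sum_b// rnormM; congr (_ * _).
  by rewrite -(rmorph_nat (real_complex R)) rnormc ger0_norm.
have -> : N%:R * (m * (Re (B x x) + Re (B y y))) =
   m * (N%:R * Re (B x x) + N%:R * Re (B y y)) by ring.
apply: (@le_trans _ _ (m * (\sum_(j < N) Re (b (u j x) (u j x)) +
    \sum_(j < N) Re (b (u j y) (u j y))))); last first.
  by rewrite ler_wpM2l// lerD.
apply: (le_trans (ler_wpM2l _ (rnorm_sum _ _ _))) => //.
rewrite -big_split/= !mulr_sumr ler_sum// => j _.
rewrite rnormM mulrCA ler_pM ?rnorm_ge0//.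
- by rewrite mulr_ge0 ?rnorm_ge0.
- by rewrite pm.
- exact: (sdot_young_norm hb).
Qed.

End fourier.

(** Von Neumann's inequality for polynomials.  The Poisson kernel of T / s at the
    N-th roots of unity is a positive form; averaged against the values of the
    polynomial p on the circle of radius s it gives p(T), up to terms containing
    high powers of T / s, which vanish as N grows.  The form B is an
    arbitrary semi-inner product, which covers the product of two Hilbert spaces. *)
Theorem von_neumann_poly (d : nat) (c : nat -> C) (m : R) x y :
  (forall z, rnorm z = s -> rnorm (\sum_(k < d) c k * z ^+ k) <= m) ->
  2 * rnorm (\sum_(k < d) c k * B (iter k T x) y) <=
  m * (Re (B x x) + Re (B y y)).
Proof.
move=> pm; pose P : V := \sum_(k < d) c k *: iter k T x.
have -> : \sum_(k < d) c k * B (iter k T x) y = B P y.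
  by rewrite (sdot_suml hB); apply: eq_bigr => k _; rewrite (sdotZl hB).
pose K := snorm B P * snorm B y +
  \sum_(k < d) rnorm (c k * s%:C ^+ k) * (2 * snorm B x * snorm B y).
have si0 : 0 <= s^-1 by rewrite invr_ge0 ltW.
have si1 : s^-1 <= 1 by rewrite invf_le1// ltW.
have K0 : 0 <= K.
  rewrite addr_ge0 ?mulr_ge0 ?snorm_ge0//; apply: sumr_ge0 => k _.
  by rewrite !mulr_ge0 ?rnorm_ge0 ?snorm_ge0.
have main M : 2 * rnorm (B P y) <=
    m * (Re (B x x) + Re (B y y)) + 2 * (K * s^-1 ^+ M).
  pose N := (d + M).+1; have N0 : (0 < N)%N by [].
  have [w wN] := prim_root_exists R N0.
  have dN : (d <= N)%N by rewrite ltnW// ltnS leq_addr.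
  have MN : (M <= N)%N by rewrite ltnW// ltnS leq_addl.
  have MNk (k : 'I_d) : (M <= N - k)%N.
    by rewrite leq_subRL ?(leq_trans (ltnW (ltn_ord k)))// ltnW// ltnS leq_add2r ltnW.
  have := @fourier_ineq N w N0 wN d c m x y dN pm.
  rewrite -/P; set x' := x - _; set y' := y - _; set Q := \sum_(i < d) _ => h.
  have aM k z : (M <= k)%N -> snorm B (a k z) <= s^-1 ^+ M * snorm B z.
    move=> Mk; rewrite (le_trans (snorm_a _ _))// ler_wpM2r ?snorm_ge0//.
    by rewrite -exprVn; apply: ler_wiXn2l.
  have e1 : B P y = (B P y' + B x' Q) + (B P (a N y) - B x' Q).
    by rewrite /y' (sdotDr hB) (sdotNr hB); move: (B x' Q) => t; ring.
  have e2 : rnorm (B P (a N y)) <= snorm B P * snorm B y * s^-1 ^+ M.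
    rewrite (le_trans (sdot_cauchy_schwarz hB _ _))// -mulrA.
    by rewrite ler_wpM2l ?snorm_ge0// mulrC aM.
  have e3 : rnorm (B x' Q) <=
    \sum_(k < d) rnorm (c k * s%:C ^+ k) * (2 * snorm B x * snorm B y) * s^-1 ^+ M.
    rewrite /Q (sdot_sumr hB) (le_trans (rnorm_sum _ _ _))// ler_sum// => k _.
    rewrite (sdotZr hB) conjcK rnormM -!mulrA ler_wpM2l ?rnorm_ge0//.
    have f1 := aM (N - k)%N y (MNk k).
    rewrite /x' (sdotDl hB) (sdotNl hB) (le_trans (rnormB _ _))//.
    have g1 := sdot_cauchy_schwarz hB x (a (N - k) y).
    have g2 := sdot_cauchy_schwarz hB (a N x) (a (N - k) y).
    have g3 := ler_wpM2l (snorm_ge0 B x) f1.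
    have g4 : snorm B (a N x) <= snorm B x.
      by rewrite (le_trans (aM N x MN)) ?ler_piMl ?snorm_ge0 ?exprn_ile1.
    have g5 := ler_wpM2r (snorm_ge0 B (a (N - k) y)) g4.
    lra.
  have e4 := rnormD (B P y' + B x' Q) (B P (a N y) - B x' Q).
  have e5 := rnormB (B P (a N y)) (B x' Q).
  rewrite -e1 in e4.
  have KE : K * s^-1 ^+ M = snorm B P * snorm B y * s^-1 ^+ M +
      \sum_(k < d) rnorm (c k * s%:C ^+ k) * (2 * snorm B x * snorm B y) * s^-1 ^+ M.
    by rewrite /K mulrDl; congr (_ + _); rewrite mulr_suml.
  rewrite KE; lra.
have c0 : (fun M => s^-1 ^+ M) @ \oo --> (0 : R).
  by apply: cvg_expr; rewrite ger0_norm// invf_lt1.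
apply/ler_addgt0Pr => e e0.
have e1 : 0 < e / (2 * K + 1) by rewrite divr_gt0// ltr_wpDl// mulr_ge0.
have /cvgrPdist_lt/(_ _ e1)[M _ /(_ M (leqnn M))] := c0.
rewrite /= sub0r normrN ger0_norm ?exprn_ge0// ltr_pdivlMr ?ltr_wpDl ?mulr_ge0//.
have := main M; have := exprn_ge0 M si0; nra.
Qed.

End von_neumann.

(** * Primitives and integrals along paths *)

Section real_primitives.
Variable R : realType.
Local Notation mu := (@lebesgue_measure R).
Implicit Types h P : R -> R.

Lemma is_derive_eps P (t l : R) :
  (forall e, 0 < e -> exists2 d, 0 < d & forall u, `|u - t| < d ->
     `|P u - P t - l * (u - t)| <= e * `|u - t|) ->
  is_derive t 1 P l.
Proof.
move=> hP.
have : (fun h : R => h^-1 *: (P (h *: 1 + t) - P t)) @ 0^' --> l.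
  apply/cvgrPdist_le => e e0.
  have [d d0 hd] := hP _ e0.
  near=> k.
  have k0 : k != 0 by near: k; exact: nbhs_dnbhs_neq.
  have kd : `|k| < d.
    by near: k; apply: dnbhs0_lt.
  have := hd (k + t); rewrite addrK => /(_ kd) h.
  rewrite /GRing.scale/= mulr1.
  have -> : l - k^-1 * (P (k + t) - P t) = - (k^-1 * (P (k + t) - P t - l * k)).
    by field.
  by rewrite normrN normrM normfV ler_pdivrMl ?normr_gt0// [_ * e]mulrC.
move=> H; split; first by apply/cvg_ex; exists l.
exact: cvg_lim.
Unshelve. all: by end_near. Qed.

Definition clamp01 (t : R) : R := Num.max 0 (Num.min 1 t).

Lemma clamp01_id t : 0 <= t <= 1 -> clamp01 t = t.
Proof. by move=> /andP[t0 t1]; rewrite /clamp01 (min_idPr t1) (max_idPr t0). Qed.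

Lemma clamp01_itv t : 0 <= clamp01 t <= 1.
Proof. by rewrite /clamp01 le_max lexx/= ge_max ler01 ge_min lexx. Qed.

Lemma clamp01_continuous : continuous clamp01.
Proof.
move=> t; apply: (@continuous_max R R (cst 0) (cst 1 \min id) t).
  exact: cvg_cst.
by apply: (@continuous_min R R (cst 1) id t); [exact: cvg_cst|exact: cvg_id].
Qed.

(** Extending h by constants to the left and to the right makes the end points
    interior, so that the primitive is differentiable there from both sides. *)
Lemma primitive_exists h : (forall t : R, 0 <= t <= 1 -> {for t, continuous h}) ->
  exists P, forall t : R, 0 <= t <= 1 -> is_derive t 1 P (h t).
Proof.
move=> ch; pose g := h \o clamp01.
have cg : continuous g.
  move=> t; apply: continuous_comp; first exact: clamp01_continuous.
  by apply: ch; exact: clamp01_itv.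
have ig : mu.-integrable `[(-1 : R), 2] (EFin \o g).
  apply: continuous_compact_integrable; first exact: segment_compact.
  by apply: continuous_subspaceT.
exists (fun x => \int[mu]_(t in `[-1, x]) g t)%R => t t01.
have [t0 t1] := andP t01.
have [||d dE] := @continuous_FTC1_closed _ g (-1) t 2 _ ig _ (cg t); [lra|lra|].
by split; [exact: d|rewrite -derive1E dE /g /= clamp01_id].
Qed.

Lemma Rintegral01_primitive h P : (forall t : R, 0 <= t <= 1 -> {for t, continuous h}) ->
  (forall t : R, 0 <= t <= 1 -> is_derive t 1 P (h t)) ->
  Rintegral mu `[0, 1] h = P 1 - P 0.
Proof.
move=> ch hP.
have cP t : 0 <= t <= 1 -> {for t, continuous P}.
  move=> /hP[dP _]; apply: differentiable_continuous.
  exact/derivable1_diffP.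
rewrite /Rintegral (@continuous_FTC2 _ h P)//.
- apply/subspace_continuousP => t; rewrite /= in_itv/= => t01.
  by apply: cvg_within_filter; exact: ch.
- split; [move=> t|..].
  + by rewrite in_itv/= => /andP[t0 t1]; have [|dP _] := hP t; rewrite ?ltW.
  + by apply: cvg_at_right_filter; apply: cP; rewrite lexx ler01.
  + by apply: cvg_at_left_filter; apply: cP; rewrite lexx ler01.
- move=> t; rewrite in_itv/= => /andP[t0 t1].
  by rewrite derive1E; have [|dP ->] := hP t; rewrite ?ltW.
Qed.

Lemma primitive_mvt h P : (forall t : R, 0 <= t <= 1 -> is_derive t 1 P (h t)) ->
  exists2 c, 0 <= c <= 1 & P 1 - P 0 = h c.
Proof.
move=> hP; have [||c c01 ->] := @MVT _ P h 0 1 ltr01.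
- by move=> x; rewrite in_itv/= => /andP[x0 x1]; apply: hP; rewrite !ltW.
- apply/subspace_continuousP => t; rewrite /= in_itv/= => t01.
  apply: cvg_within_filter; have [dP _] := hP _ t01.
  by apply: differentiable_continuous; exact/derivable1_diffP.
exists c; last by rewrite subr0 mulr1.
by move: c01; rewrite in_itv/= => /andP[x0 x1]; rewrite !ltW.
Qed.

Lemma eps_is_derive P (t l : R) : is_derive t 1 P l ->
  forall e, 0 < e -> exists2 d, 0 < d & forall u, `|u - t| < d ->
     `|P u - P t - l * (u - t)| <= e * `|u - t|.
Proof.
move=> [dP lE] e e0.
have : (fun h : R => h^-1 *: (P (h *: 1 + t) - P t)) @ 0^' --> l.
  by move: dP => /cvg_ex[k hk]; rewrite -lE /derive (cvg_lim _ hk).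
move=> /cvgrPdist_le/(_ _ e0); rewrite near_withinE.
move=> /nbhs_ballP[d d0 hd]; exists d => // u ud.
have [->|ut] := eqVneq u t; first by rewrite !subrr mulr0 subr0 normr0 mulr0.
have ut0 : u - t != 0 by rewrite subr_eq0.
have := hd (u - t); rewrite /ball/= sub0r normrN => /(_ ud ut0).
rewrite /GRing.scale/= mulr1 subrK => h.
have -> : P u - P t - l * (u - t) = - (l - (u - t)^-1 * (P u - P t)) * (u - t).
  by field.
by rewrite normrM normrN ler_wpM2r.
Qed.

End real_primitives.

Section path_integrals.
Variable R : realType.
Local Notation C := R[i].
Local Notation mu := (@lebesgue_measure R).
Implicit Types g P : R -> C.

Definition path_continuous g := forall t : R, 0 <= t <= 1 ->
  forall e, 0 < e -> exists2 d, 0 < d & forall u, `|u - t| < d ->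
  rnorm (g u - g t) < e.

Definition path_primitive g P := forall t : R, 0 <= t <= 1 ->
  forall e, 0 < e -> exists2 d, 0 < d & forall u, `|u - t| < d ->
  rnorm (P u - P t - g t * (u - t)%:C) <= e * `|u - t|.

Lemma path_continuous_Re g t : path_continuous g -> 0 <= t <= 1 ->
  {for t, continuous (fun u => Re (g u))}.
Proof.
move=> cg t01; apply/cvgrPdist_lt => e e0; have [d d0 hd] := cg t t01 e e0.
near=> u; have ut : `|u - t| < d.
  by rewrite distrC; near: u; exact: cvgr_dist_lt.
rewrite distrC; apply: le_lt_trans (hd _ ut).
by have := absRe_le_rnorm (g u - g t); case: (g u) (g t) => [? ?] [? ?].
Unshelve. all: by end_near. Qed.

Lemma path_continuous_Im g t : path_continuous g -> 0 <= t <= 1 ->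
  {for t, continuous (fun u => Im (g u))}.
Proof.
move=> cg t01; apply/cvgrPdist_lt => e e0; have [d d0 hd] := cg t t01 e e0.
near=> u; have ut : `|u - t| < d.
  by rewrite distrC; near: u; exact: cvgr_dist_lt.
rewrite distrC; apply: le_lt_trans (hd _ ut).
by have := absIm_le_rnorm (g u - g t); case: (g u) (g t) => [? ?] [? ?].
Unshelve. all: by end_near. Qed.

Lemma path_primitive_ReIm g P : path_primitive g P ->
  forall t : R, 0 <= t <= 1 -> is_derive t 1 (fun u => Re (P u)) (Re (g t)) /\
    is_derive t 1 (fun u => Im (P u)) (Im (g t)).
Proof.
move=> hP t t01; split; apply: is_derive_eps => e e0;
  have [d d0 hd] := hP t t01 e e0; exists d => // u ut;
  apply: le_trans (hd _ ut).
- have := absRe_le_rnorm (P u - P t - g t * (u - t)%:C).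
  by case: (P u) (P t) (g t) => [? ?] [? ?] [? ?]/=; rewrite mulr0 subr0.
- have := absIm_le_rnorm (P u - P t - g t * (u - t)%:C).
  by case: (P u) (P t) (g t) => [? ?] [? ?] [? ?]/=; rewrite mulr0 add0r.
Qed.

Lemma cintegral01_primitive g P : path_continuous g -> path_primitive g P ->
  cintegral01 g = P 1 - P 0.
Proof.
move=> cg /path_primitive_ReIm hP; rewrite /cintegral01.
have -> : Rintegral mu `[0, 1] (fun t => Re (g t)) = Re (P 1) - Re (P 0).
  apply: (@Rintegral01_primitive R _ (fun u => Re (P u))) => t t01.
    exact: path_continuous_Re.
  by have [] := hP t t01.
have -> : Rintegral mu `[0, 1] (fun t => Im (g t)) = Im (P 1) - Im (P 0).
  apply: (@Rintegral01_primitive R _ (fun u => Im (P u))) => t t01.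
    exact: path_continuous_Im.
  by have [] := hP t t01.
by case: (P 1) (P 0) => [? ?] [? ?].
Qed.

Lemma path_primitive_of_ReIm g (P1 P2 : R -> R) :
  (forall t : R, 0 <= t <= 1 -> is_derive t 1 P1 (Re (g t))) ->
  (forall t : R, 0 <= t <= 1 -> is_derive t 1 P2 (Im (g t))) ->
  path_primitive g (fun u => P1 u +i* P2 u).
Proof.
move=> hP1 hP2 t t01 e e0.
have e2 : 0 < e / 2 by rewrite divr_gt0.
have [d1 d10 h1] := eps_is_derive (hP1 t t01) e2.
have [d2 d20 h2] := eps_is_derive (hP2 t t01) e2.
exists (Num.min d1 d2); first by rewrite lt_min d10.
move=> u; rewrite lt_min => /andP[/h1{}h1 /h2{}h2].
have := rnorm_le_ReIm ((P1 u +i* P2 u) - (P1 t +i* P2 t) - g t * (u - t)%:C).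
move: h1 h2; case: (g t) => a b/=; rewrite !mulr0 subr0 add0r.
by lra.
Qed.

Lemma path_primitive_exists g : path_continuous g ->
  exists P, path_primitive g P.
Proof.
move=> cg.
have [P1 hP1] := @primitive_exists R (fun u => Re (g u))
  (fun t => path_continuous_Re cg).
have [P2 hP2] := @primitive_exists R (fun u => Im (g u))
  (fun t => path_continuous_Im cg).
by exists (fun u => P1 u +i* P2 u); exact: path_primitive_of_ReIm.
Qed.

(** The mean value theorem for the real and the imaginary part; the factor 2
    comes from adding the two bounds, which avoids rotating the integral. *)
Lemma cintegral01_bound g (M : R) : path_continuous g ->
  (forall t : R, 0 <= t <= 1 -> rnorm (g t) <= M) ->
  rnorm (cintegral01 g) <= 2 * M.
Proof.
move=> cg gM; have [P hP] := path_primitive_exists cg.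
rewrite (cintegral01_primitive cg hP).
have hP' := path_primitive_ReIm hP.
have [t1 t101 E1] := primitive_mvt (fun t t01 => (hP' t t01).1).
have [t2 t201 E2] := primitive_mvt (fun t t01 => (hP' t t01).2).
rewrite (le_trans (rnorm_le_ReIm _))//.
have -> : Re (P 1 - P 0) = Re (g t1).
  by rewrite -E1; case: (P 1) (P 0) => [? ?] [? ?].
have -> : Im (P 1 - P 0) = Im (g t2).
  by rewrite -E2; case: (P 1) (P 0) => [? ?] [? ?].
have := absRe_le_rnorm (g t1); have := absIm_le_rnorm (g t2).
have := gM _ t101; have := gM _ t201; lra.
Qed.

Lemma path_continuousD g1 g2 : path_continuous g1 -> path_continuous g2 ->
  path_continuous (fun t => g1 t + g2 t).
Proof.
move=> c1 c2 t t01 e e0.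
have e2 : 0 < e / 2 by rewrite divr_gt0.
have [d1 d10 h1] := c1 t t01 _ e2; have [d2 d20 h2] := c2 t t01 _ e2.
exists (Num.min d1 d2); first by rewrite lt_min d10.
move=> u; rewrite lt_min => /andP[/h1{}h1 /h2{}h2].
have := rnormD (g1 u - g1 t) (g2 u - g2 t).
by rewrite addrACA -opprD; lra.
Qed.

Lemma path_continuousZ (c : C) g : path_continuous g ->
  path_continuous (fun t => c * g t).
Proof.
move=> cg t t01 e e0.
have c0 : 0 < rnorm c + 1 by rewrite ltr_wpDl// rnorm_ge0.
have [d d0 hd] := cg t t01 _ (divr_gt0 e0 c0); exists d => // u /hd.
rewrite ltr_pdivlMr// -mulrBr rnormM; have := rnorm_ge0 (g u - g t); nra.
Qed.

Lemma cintegral01D g1 g2 : path_continuous g1 -> path_continuous g2 ->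
  cintegral01 (fun t => g1 t + g2 t) = cintegral01 g1 + cintegral01 g2.
Proof.
move=> c1 c2; have [P1 h1] := path_primitive_exists c1.
have [P2 h2] := path_primitive_exists c2.
rewrite (cintegral01_primitive c1 h1) (cintegral01_primitive c2 h2).
rewrite (@cintegral01_primitive _ (fun t => P1 t + P2 t)).
- by rewrite opprD addrACA.
- exact: path_continuousD.
move=> t t01 e e0; have e2 : 0 < e / 2 by rewrite divr_gt0.
have [d1 d10 k1] := h1 t t01 _ e2; have [d2 d20 k2] := h2 t t01 _ e2.
exists (Num.min d1 d2); first by rewrite lt_min d10.
move=> u; rewrite lt_min => /andP[/k1{}k1 /k2{}k2].
have := rnormD (P1 u - P1 t - g1 t * (u - t)%:C) (P2 u - P2 t - g2 t * (u - t)%:C).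
have -> : P1 u - P1 t - g1 t * (u - t)%:C + (P2 u - P2 t - g2 t * (u - t)%:C) =
  P1 u + P2 u - (P1 t + P2 t) - (g1 t + g2 t) * (u - t)%:C by ring.
lra.
Qed.

Lemma cintegral01Z (c : C) g : path_continuous g ->
  cintegral01 (fun t => c * g t) = c * cintegral01 g.
Proof.
move=> c1; have [P1 h1] := path_primitive_exists c1.
rewrite (cintegral01_primitive c1 h1).
rewrite (@cintegral01_primitive _ (fun t => c * P1 t)).
- by rewrite mulrBr.
- exact: path_continuousZ.
move=> t t01 e e0.
have c0 : 0 < rnorm c + 1 by rewrite ltr_wpDl// rnorm_ge0.
have [d d0 hd] := h1 t t01 _ (divr_gt0 e0 c0); exists d => // u /hd.
rewrite (_ : c * P1 u - c * P1 t - c * g t * (u - t)%:C =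
  c * (P1 u - P1 t - g t * (u - t)%:C)); last by ring.
rewrite mulrAC ler_pdivlMr// rnormM.
have := rnorm_ge0 (P1 u - P1 t - g t * (u - t)%:C); nra.
Qed.

End path_integrals.

(** * Complex differentiability *)

Section complex_functions.
Variable R : realType.
Local Notation C := R[i].
Implicit Types (f g : C -> C) (z a b : C).

Definition ccont g z := forall e : R, 0 < e -> exists2 d : R, 0 < d &
  forall w, rnorm (w - z) < d -> rnorm (g w - g z) < e.

Definition cderiv g z (l : C) := forall e : R, 0 < e -> exists2 d : R, 0 < d &
  forall w, rnorm (w - z) < d ->
  rnorm (g w - g z - l * (w - z)) <= e * rnorm (w - z).

Definition cdiff g z := exists l, cderiv g z l.

Lemma cdiff_ccont g z : cdiff g z -> ccont g z.
Proof.
move=> [l gl] e e0; have [d d0 hd] := gl 1 ltr01.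
have L0 : 0 < rnorm l + 1 by rewrite ltr_wpDl// rnorm_ge0.
exists (Num.min d (e / (rnorm l + 1))); first by rewrite lt_min d0 divr_gt0.
move=> w; rewrite lt_min => /andP[/hd h1]; rewrite ltr_pdivlMr// => h2.
have := rnormD (g w - g z - l * (w - z)) (l * (w - z)).
by rewrite subrK rnormM; lra.
Qed.

Lemma ccont_cst (c : C) z : ccont (fun=> c) z.
Proof. by move=> e e0; exists 1 => // w _; rewrite subrr rnorm0. Qed.

Lemma ccontD f g z : ccont f z -> ccont g z -> ccont (fun w => f w + g w) z.
Proof.
move=> cf cg e e0; have e2 : 0 < e / 2 by rewrite divr_gt0.
have [d1 d10 h1] := cf _ e2; have [d2 d20 h2] := cg _ e2.
exists (Num.min d1 d2); first by rewrite lt_min d10.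
move=> w; rewrite lt_min => /andP[/h1{}h1 /h2{}h2].
by rewrite opprD addrACA (le_lt_trans (rnormD _ _))//; lra.
Qed.

Lemma ccontM f g z : ccont f z -> ccont g z -> ccont (fun w => f w * g w) z.
Proof.
move=> cf cg e e0.
pose K := rnorm (g z) + rnorm (f z) + 1.
have K0 : 0 < K by rewrite ltr_wpDl// addr_ge0 ?rnorm_ge0.
have eK : 0 < e / K by rewrite divr_gt0.
have [d1 d10 h1] := cf _ eK.
have [d2 d20 h2] := cg (Num.min 1 (e / K)) (ltac:(by rewrite lt_min ltr01 eK)).
exists (Num.min d1 d2); first by rewrite lt_min d10.
move=> w; rewrite lt_min => /andP[/h1{}h1 /h2]; rewrite lt_min => /andP[h3 h4].
have -> : f w * g w - f z * g z = (f w - f z) * g w + f z * (g w - g z) by ring.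
have gw : rnorm (g w) <= rnorm (g z) + 1.
  by have := rnorm_lowerB (g w) (g z); lra.
apply: (le_lt_trans (rnormD _ _)); rewrite !rnormM.
have -> : e = e / K * (rnorm (g z) + 1) + rnorm (f z) * (e / K).
  by rewrite /K; field; rewrite gt_eqF.
rewrite ltr_leD//; last by rewrite ler_wpM2l ?rnorm_ge0// ltW.
apply: (le_lt_trans (ler_wpM2l (rnorm_ge0 _) gw)).
by rewrite ltr_pM2r// ltr_wpDl// rnorm_ge0.
Qed.

Lemma ccontZ (c : C) g z : ccont g z -> ccont (fun w => c * g w) z.
Proof. by apply: (@ccontM (fun=> c)); exact: ccont_cst. Qed.

Lemma cderiv_cst (c : C) z : cderiv (fun=> c) z 0.
Proof.
move=> e e0; exists 1 => // w _; rewrite subrr mul0r subr0 rnorm0.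
by rewrite mulr_ge0 ?rnorm_ge0// ltW.
Qed.

Lemma cderiv_id z : cderiv id z 1.
Proof.
move=> e e0; exists 1 => // w _; rewrite mul1r subrr rnorm0.
by rewrite mulr_ge0 ?rnorm_ge0// ltW.
Qed.

Lemma cderivD f g z l m : cderiv f z l -> cderiv g z m ->
  cderiv (fun w => f w + g w) z (l + m).
Proof.
move=> hf hg e e0; have e2 : 0 < e / 2 by rewrite divr_gt0.
have [d1 d10 h1] := hf _ e2; have [d2 d20 h2] := hg _ e2.
exists (Num.min d1 d2); first by rewrite lt_min d10.
move=> w; rewrite lt_min => /andP[/h1{}h1 /h2{}h2].
have -> : f w + g w - (f z + g z) - (l + m) * (w - z) =
  f w - f z - l * (w - z) + (g w - g z - m * (w - z)) by ring.
by rewrite (le_trans (rnormD _ _))//; lra.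
Qed.

Lemma cderivM f g z l m : cderiv f z l -> cderiv g z m ->
  cderiv (fun w => f w * g w) z (l * g z + f z * m).
Proof.
move=> hf hg e e0.
have cg := cdiff_ccont (ex_intro _ m hg).
pose K := rnorm (g z) + rnorm (f z) + rnorm l + 2.
have K0 : 0 < K.
  by rewrite /K; have := rnorm_ge0 (g z); have := rnorm_ge0 (f z);
    have := rnorm_ge0 l; lra.
have eK : 0 < e / K by rewrite divr_gt0.
have [d1 d10 h1] := hf _ eK; have [d2 d20 h2] := hg _ eK.
have [d3 d30 h3] := cg (Num.min 1 (e / K)) (ltac:(by rewrite lt_min ltr01 eK)).
exists (Num.min d1 (Num.min d2 d3)); first by rewrite !lt_min d10 d20.
move=> w; rewrite !lt_min => /andP[/h1{}h1 /andP[/h2{}h2 /h3]].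
rewrite lt_min => /andP[h5 h4].
have -> : f w * g w - f z * g z - (l * g z + f z * m) * (w - z) =
  (f w - f z - l * (w - z)) * g w + l * (g w - g z) * (w - z)
    + f z * (g w - g z - m * (w - z)) by ring.
have gw : rnorm (g w) <= rnorm (g z) + 1.
  by have := rnorm_lowerB (g w) (g z); lra.
apply: (le_trans (rnormD _ _)).
apply: (le_trans (lerD (rnormD _ _) (lexx _))); rewrite !rnormM.
set r := rnorm (w - z) in h1 h2 *; have r0 : 0 <= r := rnorm_ge0 _.
have k0 : 0 <= e / K * r by rewrite mulr_ge0// ltW.
have -> : e * r = (e / K * r) * K by field; rewrite gt_eqF.
have q1 := ler_pM (rnorm_ge0 _) (rnorm_ge0 _) h1 gw.
have q2 : rnorm l * rnorm (g w - g z) * r <= rnorm l * (e / K * r).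
  by rewrite -mulrA ler_wpM2l ?rnorm_ge0// ler_wpM2r// ltW.
have q3 := ler_wpM2l (rnorm_ge0 (f z)) h2.
by rewrite /K; lra.
Qed.

Lemma cderivV g z l : g z != 0 -> cderiv g z l ->
  cderiv (fun w => (g w)^-1) z (- l / g z ^+ 2).
Proof.
move=> gz0 hg e e0; have cg := cdiff_ccont (ex_intro _ l hg).
have r0 := rnorm_gt0 gz0; set r := rnorm (g z) in r0 *.
pose K := 2 / r ^+ 2 + 2 * rnorm l / r ^+ 3.
have r2 : 0 < r ^+ 2 by rewrite exprn_gt0.
have r3 : 0 < r ^+ 3 by rewrite exprn_gt0.
have K0 : 0 < K.
  rewrite ltr_pwDl ?divr_gt0// divr_ge0 ?mulr_ge0 ?rnorm_ge0// ltW//.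
have eK : 0 < e / K by rewrite divr_gt0.
have [d1 d10 h1] := hg _ eK.
have [d3 d30 h3] := cg (Num.min (r / 2) (e / K))
  (ltac:(by rewrite lt_min divr_gt0// eK)).
exists (Num.min d1 d3); first by rewrite lt_min d10.
move=> w; rewrite lt_min => /andP[/h1{}h1 /h3]; rewrite lt_min => /andP[h5 h4].
have gw : r / 2 <= rnorm (g w).
  by have := rnorm_lowerB (g z) (g w); rewrite -rnormBC -/r; lra.
have gw0 : 0 < rnorm (g w) by apply: lt_le_trans gw; rewrite divr_gt0.
have gwN0 : g w != 0 by apply: contraTneq gw0 => ->; rewrite rnorm0 ltxx.
have -> : (g w)^-1 - (g z)^-1 - - l / g z ^+ 2 * (w - z) =
  - (g w - g z - l * (w - z)) / (g w * g z)
  + (l * (w - z)) * (g w - g z) / (g w * g z ^+ 2).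
  by field; apply/andP.
have i1 : (rnorm (g w))^-1 <= 2 / r.
  by rewrite -[2 / r]invf_div lef_pV2// posrE divr_gt0.
apply: (le_trans (rnormD _ _)); rewrite !(rnormM, rnormN, rnormV, rnormX) -/r.
set q := rnorm (w - z) in h1 *; have q0 : 0 <= q := rnorm_ge0 _.
have s1 : rnorm (g w - g z - l * (w - z)) * (rnorm (g w) * r)^-1 <=
    e / K * q * (2 / r ^+ 2).
  rewrite ler_pM ?rnorm_ge0 ?invr_ge0 ?mulr_ge0 ?rnorm_ge0 ?(ltW r0)//.
  rewrite invfM (_ : 2 / r ^+ 2 = 2 / r * r^-1); last by field; rewrite gt_eqF.
  by rewrite ler_wpM2r// invr_ge0 ltW.
have s2 : rnorm l * q * rnorm (g w - g z) * (rnorm (g w) * r ^+ 2)^-1 <=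
    rnorm l * q * (e / K) * (2 / r ^+ 3).
  rewrite ler_pM ?invr_ge0 ?mulr_ge0 ?rnorm_ge0 ?(ltW r2)//.
    by rewrite ler_wpM2l ?mulr_ge0 ?rnorm_ge0// ltW.
  rewrite invfM (_ : 2 / r ^+ 3 = 2 / r * (r ^+ 2)^-1).
    by rewrite ler_wpM2r// invr_ge0 ltW.
  by field; rewrite gt_eqF.
have -> : e * q = e / K * q * K by field; rewrite gt_eqF.
rewrite {2}/K; lra.
Qed.

Lemma cderiv_sub_cst (a : C) z : cderiv (fun w => w - a) z 1.
Proof.
move=> e e0; exists 1 => // w _.
rewrite (_ : w - a - (z - a) - 1 * (w - z) = 0); last by ring.
by rewrite rnorm0 mulr_ge0 ?rnorm_ge0// ltW.
Qed.

Lemma cderiv_dilate f (r : R) z l : 0 < r -> cderiv f (r%:C * z) l ->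
  cderiv (fun w => f (r%:C * w)) z (l * r%:C).
Proof.
move=> r0 hf e e0; have [d d0 hd] := hf (e / r) (divr_gt0 e0 r0).
exists (d / r); first by rewrite divr_gt0.
move=> w; rewrite ltr_pdivlMr// => wz.
have N : rnorm (r%:C * (w - z)) = r * rnorm (w - z).
  by rewrite rnormM rnormc gtr0_norm.
have := hd (r%:C * w); rewrite -mulrBr N mulrA mulrC => /(_ wz).
by rewrite mulrC mulrA (_ : e / r * r = e) // divfK// gt_eqF.
Qed.

Lemma cdiffM f g z : cdiff f z -> cdiff g z -> cdiff (fun w => f w * g w) z.
Proof. by move=> [l hl] [m hm]; eexists; exact: cderivM hl hm. Qed.

Lemma cdiffV g z : g z != 0 -> cdiff g z -> cdiff (fun w => (g w)^-1) z.
Proof. by move=> g0 [l hl]; eexists; exact: cderivV g0 hl. Qed.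

Lemma cdiff_inv_sub a z : z != a -> cdiff (fun w => (w - a)^-1) z.
Proof.
move=> za; apply: (@cdiffV (fun w => w - a)); first by rewrite subr_eq0.
by exists 1; exact: cderiv_sub_cst.
Qed.

Lemma derivable_cdiff (f : R[i]^o -> R[i]^o) (z : R[i]^o) :
  derivable f z 1 -> cdiff f z.
Proof.
move=> /cvg_ex[l fl]; exists l => e e0.
have : nbhs (l : R[i]^o) [set y | rnorm (y - l) < e].
  by apply/rnorm_nbhsP; exists e.
move=> /fl h.
have {h} : nbhs (0 : R[i]^o) [set k : R[i]^o | k != 0 ->
  rnorm (k^-1 *: (f (k *: 1 + z) - f z) - l) < e] := h.
move=> /rnorm_nbhsP[d d0 hd].
exists d => // w wd.
have [->|wz] := eqVneq w z.
  by rewrite !subrr mulr0 subr0 rnorm0 mulr0.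
have /= := hd (w - z); rewrite subr0 subr_eq0 => /(_ wd wz).
rewrite /= /GRing.scale/= mulr1 subrK => h.
have wz0 : w - z != 0 by rewrite subr_eq0.
have -> : f w - f z - l * (w - z) = ((w - z)^-1 * (f w - f z) - l) * (w - z).
  by field.
by rewrite rnormM ler_wpM2r ?rnorm_ge0// ltW.
Qed.

End complex_functions.

(** * Integrals over segments and contours *)

Section segments.
Variable R : realType.
Local Notation C := R[i].
Implicit Types (f g : C -> C) (z a b : C).

Definition seg_int g a b : C := (b - a) * cintegral01 (g \o segment_pt (a, b)).

Definition on_segment a b (Q : C -> Prop) :=
  forall t : R, 0 <= t <= 1 -> Q (segment_pt (a, b) t).

Lemma segment_pt0 a b : segment_pt (a, b) 0 = a.
Proof. by rewrite /segment_pt mul0r addr0. Qed.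

Lemma segment_pt1 a b : segment_pt (a, b) 1 = b.
Proof. by rewrite /segment_pt mul1r/= addrC subrK. Qed.

Lemma segment_pt_sub a b s t :
  segment_pt (a, b) t - segment_pt (a, b) s = (t - s)%:C * (b - a).
Proof. by rewrite /segment_pt/= rmorphB/=; ring. Qed.

Lemma segment_pt_pt a b s t u :
  segment_pt (segment_pt (a, b) s, segment_pt (a, b) t) u =
  segment_pt (a, b) (s + u * (t - s)).
Proof.
rewrite /segment_pt /= !(rmorphD, rmorphM, rmorphN)/=; ring.
Qed.

Lemma itv01_comb (s t u : R) : 0 <= s <= 1 -> 0 <= t <= 1 -> 0 <= u <= 1 ->
  0 <= s + u * (t - s) <= 1.
Proof.
move=> /andP[s0 s1] /andP[t0 t1] /andP[u0 u1]; apply/andP; split; nra.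
Qed.

Lemma on_segment_sub a b s t Q : 0 <= s <= 1 -> 0 <= t <= 1 ->
  on_segment a b Q -> on_segment (segment_pt (a, b) s) (segment_pt (a, b) t) Q.
Proof. by move=> s01 t01 h u u01; rewrite segment_pt_pt; apply/h/itv01_comb. Qed.

Lemma segment_path_continuous g a b : on_segment a b (ccont g) ->
  path_continuous (g \o segment_pt (a, b)).
Proof.
move=> cg t t01 e e0; have [d d0 hd] := cg t t01 e e0.
have K0 : 0 < rnorm (b - a) + 1 by rewrite ltr_wpDl// rnorm_ge0.
exists (d / (rnorm (b - a) + 1)); first by rewrite divr_gt0.
move=> u; rewrite ltr_pdivlMr// => ut; apply: hd.
rewrite segment_pt_sub rnormM rnormc; have := normr_ge0 (u - t); nra.
Qed.

(** A single primitive along the segment serves for all subsegments in both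
    directions: additivity and reversal of integrals follow. *)
Lemma seg_int_param g a b : on_segment a b (ccont g) -> exists P : R -> C,
  forall s t, 0 <= s <= 1 -> 0 <= t <= 1 ->
  seg_int g (segment_pt (a, b) s) (segment_pt (a, b) t) = (b - a) * (P t - P s).
Proof.
move=> cg; have pg := segment_path_continuous cg.
have [P hP] := path_primitive_exists pg; exists P => s t s01 t01.
have pst := segment_path_continuous (on_segment_sub s01 t01 cg).
rewrite /seg_int segment_pt_sub [_%:C * _]mulrC -mulrA; congr (_ * _).
rewrite -cintegral01Z//.
rewrite (@cintegral01_primitive _ _ (fun u => P (s + u * (t - s)))).
- by rewrite (_ : s + 1 * (t - s) = t) 1?(_ : s + 0 * (t - s) = s)//; ring.
- exact: path_continuousZ.
move=> u u01 e e0.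
have K0 : 0 < `|t - s| + 1 by rewrite ltr_wpDl.
have [d d0 hd] := hP _ (itv01_comb s01 t01 u01) _ (divr_gt0 e0 K0).
exists (d / (`|t - s| + 1)); first by rewrite divr_gt0.
move=> v; rewrite ltr_pdivlMr// => vu.
have E : s + v * (t - s) - (s + u * (t - s)) = (t - s) * (v - u) by ring.
have := hd (s + v * (t - s)); rewrite E /= segment_pt_pt => h.
have {h} : rnorm (P (s + v * (t - s)) - P (s + u * (t - s)) -
    g (segment_pt (a, b) (s + u * (t - s))) * ((t - s) * (v - u))%:C) <=
    e / (`|t - s| + 1) * `|(t - s) * (v - u)|.
  by apply: h; rewrite normrM; have := normr_ge0 (v - u); nra.
rewrite rmorphM/= mulrA [g _ * _]mulrC => /le_trans; apply.
rewrite normrM mulrAC ler_pdivrMr//.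
have := normr_ge0 (v - u); have := normr_ge0 (t - s).
move: `|t - s| `|v - u| => p q; nra.
Qed.

Lemma seg_int_split g a b t : 0 <= t <= 1 -> on_segment a b (ccont g) ->
  seg_int g a b = seg_int g a (segment_pt (a, b) t) +
                  seg_int g (segment_pt (a, b) t) b.
Proof.
move=> t01 /seg_int_param[P hP].
have z01 : 0 <= (0 : R) <= 1 by rewrite lexx ler01.
have o01 : 0 <= (1 : R) <= 1 by rewrite lexx ler01.
have := hP 0 1 z01 o01; have := hP 0 t z01 t01; have := hP t 1 t01 o01.
by rewrite segment_pt0 segment_pt1 => -> -> ->; ring.
Qed.

Lemma seg_int_rev g a b : on_segment a b (ccont g) ->
  seg_int g b a = - seg_int g a b.
Proof.
move=> /seg_int_param[P hP].
have z01 : 0 <= (0 : R) <= 1 by rewrite lexx ler01.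
have o01 : 0 <= (1 : R) <= 1 by rewrite lexx ler01.
have := hP 0 1 z01 o01; have := hP 1 0 o01 z01.
by rewrite segment_pt0 segment_pt1 => -> ->; ring.
Qed.

Lemma seg_int_bound g a b (M : R) : on_segment a b (ccont g) ->
  on_segment a b (fun z => rnorm (g z) <= M) ->
  rnorm (seg_int g a b) <= 2 * M * rnorm (b - a).
Proof.
move=> cg gM; rewrite /seg_int rnormM mulrC ler_wpM2r ?rnorm_ge0//.
by apply: cintegral01_bound => //; exact: segment_path_continuous.
Qed.

Lemma seg_intD f g a b : on_segment a b (ccont f) -> on_segment a b (ccont g) ->
  seg_int (fun z => f z + g z) a b = seg_int f a b + seg_int g a b.
Proof.
move=> cf cg; rewrite /seg_int -mulrDr; congr (_ * _).
by apply: cintegral01D; exact: segment_path_continuous.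
Qed.

Lemma seg_intZ (c : C) g a b : on_segment a b (ccont g) ->
  seg_int (fun z => c * g z) a b = c * seg_int g a b.
Proof.
move=> cg; rewrite /seg_int mulrCA; congr (_ * _).
by apply: cintegral01Z; exact: segment_path_continuous.
Qed.

Lemma eq_cintegral01 (f g : R -> C) : (forall t : R, 0 <= t <= 1 -> f t = g t) ->
  cintegral01 f = cintegral01 g.
Proof.
move=> fg; rewrite /cintegral01.
by congr (_ +i* _); apply: eq_Rintegral => t; rewrite inE/= in_itv/= => /fg->.
Qed.

Lemma eq_seg_int f g a b : on_segment a b (fun z => f z = g z) ->
  seg_int f a b = seg_int g a b.
Proof. by move=> fg; rewrite /seg_int; congr (_ * _); exact: eq_cintegral01. Qed.

Lemma seg_int_FTC (F : C -> C) g a b : on_segment a b (ccont g) ->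
  on_segment a b (fun z => cderiv F z (g z)) -> seg_int g a b = F b - F a.
Proof.
move=> cg dF; have pg := segment_path_continuous cg.
rewrite /seg_int -cintegral01Z//.
rewrite (@cintegral01_primitive _ _ (F \o segment_pt (a, b))).
- by rewrite /= segment_pt0 segment_pt1.
- exact: path_continuousZ.
move=> t t01 e e0.
have K0 : 0 < rnorm (b - a) + 1 by rewrite ltr_wpDl// rnorm_ge0.
have [d d0 hd] := dF t t01 _ (divr_gt0 e0 K0).
exists (d / (rnorm (b - a) + 1)); first by rewrite divr_gt0.
move=> u; rewrite ltr_pdivlMr// => ut.
have := hd (segment_pt (a, b) u); rewrite segment_pt_sub rnormM rnormc => h.
have : `|u - t| * rnorm (b - a) < d by have := normr_ge0 (u - t); nra.
have E : (b - a) * g (segment_pt (a, b) t) * (u - t)%:C =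
  g (segment_pt (a, b) t) * ((u - t)%:C * (b - a)) by ring.
move=> /h; rewrite /= E => /le_trans; apply.
rewrite mulrAC ler_pdivrMr//.
have := normr_ge0 (u - t); have := rnorm_ge0 (b - a); nra.
Qed.

Lemma seg_int_cst (c : C) a b : seg_int (fun=> c) a b = c * (b - a).
Proof.
rewrite (@seg_int_FTC (fun z => c * z)); first by rewrite mulrBr.
  by move=> t _; exact: ccont_cst.
move=> t _; have := cderivM (cderiv_cst c (segment_pt (a, b) t)) (cderiv_id _).
by rewrite mul0r add0r mulr1.
Qed.

End segments.

Section contours.
Variable R : realType.
Local Notation C := R[i].
Implicit Types (f g : C -> C) (z a b : C) (G : seq (C * C)).

Definition on_contour G (Q : C -> Prop) := forall z, contour_support G z -> Q z.

Definition contour_length G : R := \sum_(e <- G) rnorm (e.2 - e.1).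

Lemma contour_length_ge0 G : 0 <= contour_length G.
Proof. by apply: sumr_ge0 => e _; exact: rnorm_ge0. Qed.

Lemma on_contourP G Q : on_contour G Q <->
  forall e, e \in G -> on_segment e.1 e.2 Q.
Proof.
split=> [h [a b] eG t t01|h z [[a b] eG [t]]].
  by apply: h; exists (a, b) => //; exists t => //; rewrite in_itv.
by rewrite in_itv/= => t01 ->; exact: (h _ eG).
Qed.

Lemma on_contour_cons e G Q : on_contour (e :: G) Q <->
  on_segment e.1 e.2 Q /\ on_contour G Q.
Proof.
rewrite !on_contourP; split=> [h|[h1 h2] e'].
  by split=> [|e' e'G]; apply: h; rewrite ?mem_head// in_cons e'G orbT.
by rewrite in_cons => /predU1P[->//|/h2].
Qed.

Lemma contour_integral_cons e G g :
  contour_integral (e :: G) g = seg_int g e.1 e.2 + contour_integral G g.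
Proof. by rewrite /contour_integral big_cons; case: e. Qed.

Lemma contour_integral_nil g : contour_integral [::] g = 0.
Proof. by rewrite /contour_integral big_nil. Qed.

Lemma contour_integralE G g :
  contour_integral G g = \sum_(e <- G) seg_int g e.1 e.2.
Proof. by apply: eq_bigr => -[a b]. Qed.

Lemma contour_integral_cat G1 G2 g : contour_integral (G1 ++ G2) g =
  contour_integral G1 g + contour_integral G2 g.
Proof. exact: big_cat. Qed.

Lemma contour_integral_bound G g (M : R) : on_contour G (ccont g) ->
  on_contour G (fun z => rnorm (g z) <= M) ->
  rnorm (contour_integral G g) <= 2 * M * contour_length G.
Proof.
rewrite !on_contourP => cg gM; rewrite contour_integralE /contour_length.
rewrite mulr_sumr (le_trans (rnorm_sum _ _ _))// big_seq [leRHS]big_seq.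
by apply: ler_sum => e eG; apply: seg_int_bound; [exact: cg|exact: gM].
Qed.

Lemma eq_contour_integral G f g : on_contour G (fun z => f z = g z) ->
  contour_integral G f = contour_integral G g.
Proof.
rewrite on_contourP !contour_integralE => fg.
by rewrite big_seq [RHS]big_seq; apply: eq_bigr => e /fg; exact: eq_seg_int.
Qed.

Lemma contour_integralD G f g : on_contour G (ccont f) -> on_contour G (ccont g) ->
  contour_integral G (fun z => f z + g z) =
  contour_integral G f + contour_integral G g.
Proof.
rewrite !on_contourP => cf cg; rewrite !contour_integralE -big_split/=.
by rewrite big_seq [RHS]big_seq; apply: eq_bigr => e eG; rewrite seg_intD; auto.
Qed.

Lemma contour_integralZ G (c : C) g : on_contour G (ccont g) ->
  contour_integral G (fun z => c * g z) = c * contour_integral G g.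
Proof.
rewrite !on_contourP => cg; rewrite !contour_integralE mulr_sumr.
by rewrite big_seq [RHS]big_seq; apply: eq_bigr => e eG; rewrite seg_intZ; auto.
Qed.

Lemma contour_integral_sum G n (F : nat -> C -> C) :
  (forall k, on_contour G (ccont (F k))) ->
  contour_integral G (fun z => \sum_(k < n) F k z) =
  \sum_(k < n) contour_integral G (F k).
Proof.
move=> cF; have h : forall k, on_contour G (ccont (fun z => \sum_(i < k) F i z)) /\
    contour_integral G (fun z => \sum_(i < k) F i z) =
    \sum_(i < k) contour_integral G (F i).
  elim=> [|k [ihc ihE]].
    have E0 : (fun z : C => \sum_(i < 0) F i z) = fun=> 0.
      by apply/funext => z; rewrite big_ord0.
    rewrite E0 big_ord0; split; first by move=> z _; exact: ccont_cst.
    by rewrite contour_integralE big1// => e _; rewrite seg_int_cst mul0r.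
  have ES : (fun z : C => \sum_(i < k.+1) F i z) =
      fun z => \sum_(i < k) F i z + F k z.
    by apply/funext => z; rewrite big_ord_recr.
  rewrite ES big_ord_recr/= -ihE contour_integralD//; split => // z zG.
  by apply: ccontD; [exact: ihc|exact: cF].
by have [] := h n.
Qed.

Definition closed_contour G := perm_eq (unzip1 G) (unzip2 G).

Lemma closed_contour_telescope (V : zmodType) G (F : C -> V) : closed_contour G ->
  \sum_(e <- G) (F e.2 - F e.1) = 0.
Proof.
move=> cG; rewrite sumrB -(big_map snd xpredT F) -(big_map fst xpredT F).
by apply/eqP; rewrite subr_eq0; apply/eqP/perm_big; rewrite perm_sym.
Qed.

Lemma contour_integral_FTC G (F : C -> C) g : closed_contour G ->
  on_contour G (ccont g) -> on_contour G (fun z => cderiv F z (g z)) ->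
  contour_integral G g = 0.
Proof.
move=> cG; rewrite !on_contourP => cg dF.
rewrite -(closed_contour_telescope F cG) contour_integralE.
by rewrite big_seq [RHS]big_seq; apply: eq_bigr => e eG; apply: seg_int_FTC; auto.
Qed.

Definition rev_contour G := [seq (e.2, e.1) | e <- G].

Lemma on_contour_rev G Q : on_contour G Q -> on_contour (rev_contour G) Q.
Proof.
rewrite !on_contourP => h _ /mapP[e eG ->] t /andP[t0 t1].
have -> : segment_pt (e.2, e.1) t = segment_pt (e.1, e.2) (1 - t).
  by rewrite /segment_pt/= rmorphB/= rmorph1; ring.
by apply: h => //; apply/andP; split; lra.
Qed.

Lemma contour_integral_rev G g : on_contour G (ccont g) ->
  contour_integral (rev_contour G) g = - contour_integral G g.
Proof.
rewrite on_contourP => cg; rewrite !contour_integralE big_map -sumrN.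
by rewrite big_seq [RHS]big_seq; apply: eq_bigr => e eG /=; apply/seg_int_rev/cg.
Qed.

Lemma closed_contour_rev G : closed_contour G -> closed_contour (rev_contour G).
Proof.
rewrite /closed_contour /rev_contour /unzip1 /unzip2 -!map_comp perm_sym.
by congr (perm_eq _ _); apply: eq_map.
Qed.

Lemma closed_contour_cat G1 G2 : closed_contour G1 -> closed_contour G2 ->
  closed_contour (G1 ++ G2).
Proof. by rewrite /closed_contour /unzip1 /unzip2 !map_cat; exact: perm_cat. Qed.

Lemma on_contour_cat G1 G2 Q : on_contour G1 Q -> on_contour G2 Q ->
  on_contour (G1 ++ G2) Q.
Proof.
rewrite !on_contourP => h1 h2 e; rewrite mem_cat => /orP[]; [exact: h1|exact: h2].
Qed.

End contours.

(** * Bisection *)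

Section bisection.
Variable R : realType.

Let child (q q' : R * R * (R * R)) : Prop :=
  let m := (q.1.1 + q.1.2) / 2 in let n := (q.2.1 + q.2.2) / 2 in
  (q'.1 = (q.1.1, m) \/ q'.1 = (m, q.1.2)) /\
  (q'.2 = (q.2.1, n) \/ q'.2 = (n, q.2.2)).

Let half_converge (u v : nat -> R) : u 0%N <= v 0%N ->
  (forall k, (u k.+1 = u k /\ v k.+1 = (u k + v k) / 2) \/
             (u k.+1 = (u k + v k) / 2 /\ v k.+1 = v k)) ->
  exists x, forall k, [/\ u 0%N <= u k, u k <= x, x <= v k, v k <= v 0%N &
    v k - u k = (v 0%N - u 0%N) / 2 ^+ k].
Proof.
move=> uv0 step.
have width k : v k - u k = (v 0%N - u 0%N) / 2 ^+ k.
  elim: k => [|k ih]; first by rewrite expr0 divr1.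
  rewrite exprS invfM mulrCA -ih.
  by case: (step k) => -[-> ->]; field.
have uv k : u k <= v k.
  by rewrite -subr_ge0 width divr_ge0 ?exprn_ge0// subr_ge0.
have und k m : (k <= m)%N -> u k <= u m /\ v m <= v k.
  move=> /subnK <-; elim: (m - k)%N => [|i [ih1 ih2]]; first by rewrite add0n.
  by have := uv (i + k)%N; rewrite addSn; case: (step (i + k)%N) => -[-> ->]; lra.
have bu k m : u k <= v m.
  case: (leqP k m) => km; first by have [h _] := und _ _ km; have := uv m; lra.
  by have [_ h] := und _ _ (ltnW km); have := uv k; lra.
have hs : has_sup (range u).
  split; first by exists (u 0%N); exists 0%N.
  by exists (v 0%N) => _ [k _ <-]; exact: bu.
exists (sup (range u)) => k; split=> //.
- by have [] := und 0%N k (leq0n k).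
- by apply: ub_le_sup; [case: hs|exists k].
- by apply: ge_sup => [|_ [m _ <-]]; [case: hs|exact: bu].
- by have [] := und 0%N k (leq0n k).
Qed.

(** Otherwise a sequence of bad rectangles, each a quarter of the previous one,
    shrinks to a point.  The small rectangles around a point contain it: the proof
    of Goursat's theorem needs this, and it is also enough for the compactness
    arguments in the plane. *)
Lemma rect_bisection (P : R -> R -> R -> R -> Prop) (x0 x1 y0 y1 : R) :
  x0 <= x1 -> y0 <= y1 ->
  (forall a b c d, x0 <= a -> a <= b -> b <= x1 -> y0 <= c -> c <= d -> d <= y1 ->
    let m := (a + b) / 2 in let n := (c + d) / 2 in
    P a m c n -> P m b c n -> P a m n d -> P m b n d -> P a b c d) ->
  (forall x y, x0 <= x <= x1 -> y0 <= y <= y1 -> exists2 e, 0 < e &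
    forall a b c d, x0 <= a -> a <= x -> x <= b -> b <= x1 ->
      y0 <= c -> c <= y -> y <= d -> d <= y1 -> b - a < e -> d - c < e ->
      P a b c d) ->
  P x0 x1 y0 y1.
Proof.
move=> x01 y01 glue small; apply: contrapT => nP.
pose valid q := [/\ x0 <= q.1.1, q.1.1 <= q.1.2, q.1.2 <= x1 &
  [/\ y0 <= q.2.1, q.2.1 <= q.2.2 & q.2.2 <= y1]].
pose bad (q : R * R * (R * R)) := ~ P q.1.1 q.1.2 q.2.1 q.2.2.
have /choice[step hstep] (q : R * R * (R * R)) : exists q',
    valid q /\ bad q -> [/\ child q q', valid q' & bad q'].
  have [[vq bq]|nvb] := pselect (valid q /\ bad q); last by exists q.
  apply: contrapT => /forallNP h; apply: bq.
  case: q vq h => [[a b] [c d]] vq h.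
  have [/= a0 ab b1 [c0 cd d1]] := vq.
  have go q' : child ((a, b), (c, d)) q' -> valid q' ->
      P q'.1.1 q'.1.2 q'.2.1 q'.2.2.
    move=> hq vq'; apply: contrapT => bq'; apply: (h q') => _.
    by split.
  by apply: glue => //; [apply: (go ((a, (a + b) / 2), (c, (c + d) / 2)))
    |apply: (go (((a + b) / 2, b), (c, (c + d) / 2)))
    |apply: (go ((a, (a + b) / 2), ((c + d) / 2, d)))
    |apply: (go (((a + b) / 2, b), ((c + d) / 2, d)))];
    rewrite /child /valid /=; (try (split; [tauto|tauto]));
    (split; [lra|lra|lra|split; lra]).
pose q n := iter n step ((x0, x1), (y0, y1)).
have hq n : valid (q n) /\ bad (q n).
  by elim: n => [|n /hstep[]].
have qS n : child (q n) (q n.+1) by have [] := hstep _ (hq n).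
have [x hx] : exists x, forall k, [/\ x0 <= (q k).1.1, (q k).1.1 <= x,
    x <= (q k).1.2, (q k).1.2 <= x1 &
    (q k).1.2 - (q k).1.1 = (x1 - x0) / 2 ^+ k].
  apply: (@half_converge (fun k => (q k).1.1) (fun k => (q k).1.2)) => // k.
  by have [[]-> _] := qS k; [left|right].
have [y hy] : exists y, forall k, [/\ y0 <= (q k).2.1, (q k).2.1 <= y,
    y <= (q k).2.2, (q k).2.2 <= y1 &
    (q k).2.2 - (q k).2.1 = (y1 - y0) / 2 ^+ k].
  apply: (@half_converge (fun k => (q k).2.1) (fun k => (q k).2.2)) => // k.
  by have [_ []->] := qS k; [left|right].
have xr : x0 <= x <= x1 by have [? ? ? ? _] := hx 0%N; apply/andP; split; lra.
have yr : y0 <= y <= y1 by have [? ? ? ? _] := hy 0%N; apply/andP; split; lra.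
have [e e0 he] := small x y xr yr.
have [k hk] : exists k : nat, (x1 - x0 + (y1 - y0) + 1) / 2 ^+ k < e.
  have c0 : (fun k => 2^-1 ^+ k) @ \oo --> (0 : R).
    by apply: cvg_expr; rewrite ger0_norm ?invr_ge0// invf_lt1 ?ltr1n.
  have W0 : 0 < x1 - x0 + (y1 - y0) + 1 by lra.
  have /cvgrPdist_lt/(_ _ (divr_gt0 e0 W0))[k _ /(_ k (leqnn k))] := c0.
  rewrite /= sub0r normrN ger0_norm ?exprn_ge0 ?invr_ge0// ltr_pdivlMr// => h.
  by exists k; rewrite -exprVn mulrC.
have p2 : 0 < (2 ^+ k)^-1 :> R by rewrite invr_gt0 exprn_gt0.
have [_ bk] := hq k; apply: bk.
have [h1 h2 h3 h4 h5] := hx k; have [k1 k2 k3 k4 k5] := hy k.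
apply: he => //; rewrite ?h5 ?k5; apply: le_lt_trans hk;
  by rewrite ler_pM2r//; lra.
Qed.

Lemma itv_bisection (P : R -> R -> Prop) (x0 x1 : R) : x0 <= x1 ->
  (forall a b, x0 <= a -> a <= b -> b <= x1 ->
    P a ((a + b) / 2) -> P ((a + b) / 2) b -> P a b) ->
  (forall x, x0 <= x <= x1 -> exists2 e, 0 < e &
    forall a b, x0 <= a -> a <= x -> x <= b -> b <= x1 -> b - a < e -> P a b) ->
  P x0 x1.
Proof.
move=> x01 glue small.
apply: (@rect_bisection (fun a b _ _ => P a b) x0 x1 0 0) => //.
  by move=> a b c d a0 ab b1 _ _ _ m n h1 h2 _ _; exact: glue.
move=> x y xr _; have [e e0 he] := small x xr; exists e => // a b c d.
by move=> h1 h2 h3 h4 _ _ _ _ h5 _; exact: he.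
Qed.

End bisection.

(** * Goursat's theorem on rectangles *)

Section goursat.
Variable R : realType.
Local Notation C := R[i].
Implicit Types (f g : C -> C) (z a b : C) (x y : R).

Definition in_rect x0 x1 y0 y1 z :=
  (x0 <= Re z <= x1) && (y0 <= Im z <= y1).

Definition rect_int g x0 x1 y0 y1 : C :=
  seg_int g (x0 +i* y0) (x1 +i* y0) + seg_int g (x1 +i* y0) (x1 +i* y1) +
  seg_int g (x1 +i* y1) (x0 +i* y1) + seg_int g (x0 +i* y1) (x0 +i* y0).

Lemma segment_ptE a b t : segment_pt (a, b) t =
  (Re a + t * (Re b - Re a)) +i* (Im a + t * (Im b - Im a)).
Proof.
by case: a b => [a1 a2] [b1 b2]; rewrite /segment_pt/=; simpc; apply/eqP;
  rewrite eq_complex/=; apply/andP; split; apply/eqP; ring.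
Qed.

Lemma rect_convex x0 x1 y0 y1 a b (Q : C -> Prop) :
  in_rect x0 x1 y0 y1 a -> in_rect x0 x1 y0 y1 b ->
  (forall z, in_rect x0 x1 y0 y1 z -> Q z) -> on_segment a b Q.
Proof.
move=> /andP[/andP[a1 a2] /andP[a3 a4]] /andP[/andP[b1 b2] /andP[b3 b4]] h t.
move=> /andP[t0 t1]; apply: h; rewrite segment_ptE /in_rect/=.
by apply/andP; split; apply/andP; split; nra.
Qed.

Lemma between_param x0 x x1 : x0 <= x -> x <= x1 ->
  exists2 t, 0 <= t <= 1 & x = x0 + t * (x1 - x0).
Proof.
move=> h0 h1; have [E|N] := eqVneq x0 x1.
  by exists 0; [rewrite lexx ler01|lra].
have p : 0 < x1 - x0 by rewrite subr_gt0 lt_neqAle N; lra.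
exists ((x - x0) / (x1 - x0)); last by field; rewrite gt_eqF.
rewrite divr_ge0 ?subr_ge0//; last lra.
by rewrite ler_pdivrMr// mul1r; lra.
Qed.

Lemma seg_int_split_both g a b p : on_segment a b (ccont g) ->
  (exists2 t, 0 <= t <= 1 & p = segment_pt (a, b) t) ->
  seg_int g a b = seg_int g a p + seg_int g p b /\
  seg_int g b a = seg_int g b p + seg_int g p a.
Proof.
move=> cg [t t01 ->]; have E := seg_int_split t01 cg; split=> //.
have z01 : 0 <= (0 : R) <= 1 by rewrite lexx ler01.
have o01 : 0 <= (1 : R) <= 1 by rewrite lexx ler01.
have := on_segment_sub z01 t01 cg; have := on_segment_sub t01 o01 cg.
rewrite segment_pt0 segment_pt1 => c2 c1.
by rewrite (seg_int_rev cg) E (seg_int_rev c1) (seg_int_rev c2) opprD addrC.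
Qed.

Lemma seg_int_hsplit g x0 x x1 y : x0 <= x -> x <= x1 ->
  (forall u, x0 <= u <= x1 -> ccont g (u +i* y)) ->
  seg_int g (x0 +i* y) (x1 +i* y) =
    seg_int g (x0 +i* y) (x +i* y) + seg_int g (x +i* y) (x1 +i* y) /\
  seg_int g (x1 +i* y) (x0 +i* y) =
    seg_int g (x1 +i* y) (x +i* y) + seg_int g (x +i* y) (x0 +i* y).
Proof.
move=> h0 h1 cg; have [t t01 E] := between_param h0 h1.
apply: seg_int_split_both.
  move=> u /andP[u0 u1]; rewrite segment_ptE/= subrr mulr0 addr0; apply: cg.
  by apply/andP; split; nra.
by exists t => //; rewrite segment_ptE/= subrr mulr0 addr0 -E.
Qed.

Lemma seg_int_vsplit g x y0 y y1 : y0 <= y -> y <= y1 ->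
  (forall u, y0 <= u <= y1 -> ccont g (x +i* u)) ->
  seg_int g (x +i* y0) (x +i* y1) =
    seg_int g (x +i* y0) (x +i* y) + seg_int g (x +i* y) (x +i* y1) /\
  seg_int g (x +i* y1) (x +i* y0) =
    seg_int g (x +i* y1) (x +i* y) + seg_int g (x +i* y) (x +i* y0).
Proof.
move=> h0 h1 cg; have [t t01 E] := between_param h0 h1.
apply: seg_int_split_both.
  move=> u /andP[u0 u1]; rewrite segment_ptE/= subrr mulr0 addr0; apply: cg.
  by apply/andP; split; nra.
by exists t => //; rewrite segment_ptE/= subrr mulr0 addr0 -E.
Qed.

(** Only the edges of the three rectangles have to avoid singularities of g: the
    proof of Cauchy's formula cuts around a pole. *)
Lemma rect_int_vcut g x0 x x1 y0 y1 : x0 <= x -> x <= x1 -> y0 <= y1 ->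
  (forall z, in_rect x0 x1 y0 y1 z -> [\/ Re z = x, Im z = y0 | Im z = y1] ->
    ccont g z) ->
  rect_int g x0 x1 y0 y1 = rect_int g x0 x y0 y1 + rect_int g x x1 y0 y1.
Proof.
move=> h0 h1 h2 cg; rewrite /rect_int.
have [|-> _] := @seg_int_hsplit g x0 x x1 y0 h0 h1.
  move=> u /andP[u0 u1]; apply: cg; last by constructor 2.
  by rewrite /in_rect/= u0 u1 lexx.
have [|_ ->] := @seg_int_hsplit g x0 x x1 y1 h0 h1.
  move=> u /andP[u0 u1]; apply: cg; last by constructor 3.
  by rewrite /in_rect/= u0 u1 lexx h2.
have -> : seg_int g (x +i* y1) (x +i* y0) = - seg_int g (x +i* y0) (x +i* y1).
  apply: seg_int_rev; apply: (@rect_convex x x y0 y1).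
  - by rewrite /in_rect/= !lexx.
  - by rewrite /in_rect/= !lexx h2.
  move=> z /andP[/andP[zx xz] zy]; apply: cg; last by constructor 1; lra.
  by rewrite /in_rect zy andbT; lra.
ring.
Qed.

Lemma rect_int_hcut g x0 x1 y0 y y1 : x0 <= x1 -> y0 <= y -> y <= y1 ->
  (forall z, in_rect x0 x1 y0 y1 z -> [\/ Im z = y, Re z = x0 | Re z = x1] ->
    ccont g z) ->
  rect_int g x0 x1 y0 y1 = rect_int g x0 x1 y0 y + rect_int g x0 x1 y y1.
Proof.
move=> h2 h0 h1 cg; rewrite /rect_int.
have [|-> _] := @seg_int_vsplit g x1 y0 y y1 h0 h1.
  move=> u /andP[u0 u1]; apply: cg; last by constructor 3.
  by rewrite /in_rect/= u0 u1 lexx h2.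
have [|_ ->] := @seg_int_vsplit g x0 y0 y y1 h0 h1.
  move=> u /andP[u0 u1]; apply: cg; last by constructor 2.
  by rewrite /in_rect/= u0 u1 lexx h2.
have -> : seg_int g (x1 +i* y) (x0 +i* y) = - seg_int g (x0 +i* y) (x1 +i* y).
  apply: seg_int_rev; apply: (@rect_convex x0 x1 y y).
  - by rewrite /in_rect/= !lexx h2.
  - by rewrite /in_rect/= !lexx h2.
  move=> z /andP[zx /andP[zy yz]]; apply: cg; last by constructor 1; lra.
  by rewrite /in_rect zx/=; lra.
ring.
Qed.

Definition rect_contour x0 x1 y0 y1 : seq (C * C) :=
  [:: (x0 +i* y0, x1 +i* y0); (x1 +i* y0, x1 +i* y1);
      (x1 +i* y1, x0 +i* y1); (x0 +i* y1, x0 +i* y0)].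

Lemma rect_intE g x0 x1 y0 y1 :
  rect_int g x0 x1 y0 y1 = contour_integral (rect_contour x0 x1 y0 y1) g.
Proof.
by rewrite contour_integralE !big_cons big_nil/= addr0 /rect_int !addrA.
Qed.

Lemma on_rect_contour x0 x1 y0 y1 (Q : C -> Prop) : x0 <= x1 -> y0 <= y1 ->
  (forall z, in_rect x0 x1 y0 y1 z ->
    (Re z == x0) || (Re z == x1) || ((Im z == y0) || (Im z == y1)) -> Q z) ->
  on_contour (rect_contour x0 x1 y0 y1) Q.
Proof.
move=> hx hy hQ; apply/on_contourP => e.
rewrite !inE => /or4P[]/eqP-> t /andP[t0 t1]; rewrite segment_ptE/=; apply: hQ;
  rewrite /in_rect/= ?(subrr, mulr0, addr0, eqxx, orbT)//;
  by apply/andP; split; apply/andP; split; nra.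
Qed.

Lemma rect_contour_length x0 x1 y0 y1 : x0 <= x1 -> y0 <= y1 ->
  contour_length (rect_contour x0 x1 y0 y1) = 2 * ((x1 - x0) + (y1 - y0)).
Proof.
move=> hx hy.
have hlen (u v y : R) : rnorm ((u +i* y) - (v +i* y)) = `|u - v|.
  by rewrite -rnormc; congr rnorm; simpc.
have vlen (u v x : R) : rnorm ((x +i* u) - (x +i* v)) = `|u - v|.
  rewrite (_ : _ - _ = 'i * (u - v)%:C); last by simpc.
  by rewrite rnormM rnormc /rnorm normc_def/= expr0n expr1n add0r sqrtr1 mul1r.
rewrite /contour_length !big_cons big_nil/= !hlen !vlen.
rewrite [`|x0 - _|]distrC [`|y0 - _|]distrC !ger0_norm ?subr_ge0//; ring.
Qed.

Lemma rect_int_bound g x0 x1 y0 y1 (M : R) : x0 <= x1 -> y0 <= y1 ->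
  (forall z, in_rect x0 x1 y0 y1 z -> ccont g z) ->
  (forall z, in_rect x0 x1 y0 y1 z -> rnorm (g z) <= M) ->
  rnorm (rect_int g x0 x1 y0 y1) <= 4 * M * ((x1 - x0) + (y1 - y0)).
Proof.
move=> hx hy cg gM; rewrite rect_intE.
rewrite (_ : 4 * M * _ = 2 * M * contour_length (rect_contour x0 x1 y0 y1)).
  by apply: contour_integral_bound; apply: on_rect_contour => // z hz _;
    [exact: cg|exact: gM].
by rewrite rect_contour_length//; ring.
Qed.

Lemma rect_intD f g x0 x1 y0 y1 : x0 <= x1 -> y0 <= y1 ->
  (forall z, in_rect x0 x1 y0 y1 z -> ccont f z) ->
  (forall z, in_rect x0 x1 y0 y1 z -> ccont g z) ->
  rect_int (fun z => f z + g z) x0 x1 y0 y1 =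
  rect_int f x0 x1 y0 y1 + rect_int g x0 x1 y0 y1.
Proof.
move=> hx hy cf cg; rewrite /rect_int !seg_intD; first ring;
  by apply: rect_convex; try exact: cf; try exact: cg; rewrite /in_rect/= !lexx hx hy.
Qed.

Lemma rect_int_affine (p q : C) x0 x1 y0 y1 :
  rect_int (fun z => p + q * z) x0 x1 y0 y1 = 0.
Proof.
pose F z := p * z + q / 2 * (z * z).
have dF z : cderiv F z (p + q * z).
  have := cderivD (cderivM (cderiv_cst p z) (cderiv_id z))
    (cderivM (cderiv_cst (q / 2) z) (cderivM (cderiv_id z) (cderiv_id z))).
  rewrite !mul0r !mulr1 !mul1r !add0r.
  have -> // : p + q / 2 * (z + z) = p + q * z by field.
have cl z : ccont (fun z => p + q * z) z.
  apply: cdiff_ccont; exists (0 + (0 * z + q * 1)).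
  by apply: cderivD; [exact: cderiv_cst|apply: cderivM; [exact: cderiv_cst|exact: cderiv_id]].
rewrite /rect_int !(@seg_int_FTC _ F); try (move=> t _; by [exact: cl|exact: dF]).
ring.
Qed.

(** By bisection, for the estimate |integral| <= 4 k (width + height) ^ 2: it is
    stable under cutting into four, and it holds for every k > 0 on small
    rectangles around a point, because affine functions integrate to 0. *)
Theorem goursat g x0 x1 y0 y1 : x0 <= x1 -> y0 <= y1 ->
  (forall z, in_rect x0 x1 y0 y1 z -> cdiff g z) ->
  rect_int g x0 x1 y0 y1 = 0.
Proof.
move=> hx hy dg.
have cg z (hz : in_rect x0 x1 y0 y1 z) := cdiff_ccont (dg z hz).
apply/rnorm_eq0/eqP; rewrite eq_le rnorm_ge0 andbT.
pose W := (x1 - x0) + (y1 - y0).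
apply/ler_addgt0Pr => e e0; rewrite add0r.
have K0 : 0 < 4 * W ^+ 2 + 1 by have := sqr_ge0 W; lra.
suff H : rnorm (rect_int g x0 x1 y0 y1) <= 4 * (e / (4 * W ^+ 2 + 1)) * W ^+ 2.
  rewrite (le_trans H)// mulrAC mulrA ler_pdivrMr//; nra.
have e1 : 0 < e / (4 * W ^+ 2 + 1) by rewrite divr_gt0.
move: (e / _) e1 => k k0.
rewrite /W.
pose Pr (a b c d : R) : Prop :=
  rnorm (rect_int g a b c d) <= 4 * k * ((b - a) + (d - c)) ^+ 2.
change (Pr x0 x1 y0 y1); apply: (@rect_bisection R Pr x0 x1 y0 y1) => //.
- move=> a b c d a0 ab b1 c0 cd d1 m n.
  have am : a <= m by rewrite /m; lra.
  have mb : m <= b by rewrite /m; lra.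
  have cn : c <= n by rewrite /n; lra.
  have nd : n <= d by rewrite /n; lra.
  have sub p q r s : a <= p -> q <= b -> c <= r -> s <= d ->
      forall z, in_rect p q r s z -> ccont g z.
    move=> ? ? ? ? z /andP[/andP[? ?] /andP[? ?]]; apply: cg; rewrite /in_rect; lra.
  rewrite /Pr (rect_int_vcut am mb cd (fun z hz _ => sub _ _ _ _ _ _ _ _ z hz))//.
  rewrite (rect_int_hcut am cn nd (fun z hz _ => sub _ _ _ _ _ _ _ _ z hz))//.
  rewrite (rect_int_hcut mb cn nd (fun z hz _ => sub _ _ _ _ _ _ _ _ z hz))//.
  rewrite /m /n; move: (rect_int g _ _ _ _) (rect_int g _ _ _ _).
  move=> p1 p2; move: (rect_int g _ _ _ _) (rect_int g _ _ _ _) => p3 p4.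
  have t1 := rnormD (p2 + p4) (p1 + p3); have t2 := rnormD p2 p4.
  have t3 := rnormD p1 p3; move=> *; lra.
- move=> x y xr yr; pose z0 := x +i* y.
  have z0r : in_rect x0 x1 y0 y1 z0 by rewrite /in_rect/= xr yr.
  have [l hl] := dg _ z0r; have [d d0 hd] := hl _ k0.
  exists (d / 2); first by rewrite divr_gt0.
  move=> a b c d' a0 ax xb b1 c0 cy yd d1 ab cd.
  have cgr z : in_rect a b c d' z -> ccont g z.
    move=> /andP[/andP[? ?] /andP[? ?]]; apply: cg; rewrite /in_rect; lra.
  pose A z := (g z0 - l * z0) + l * z.
  pose B z := (l * z0 - g z0) + (- l) * z.
  have cB z : ccont B z.
    apply: cdiff_ccont; exists (0 + (0 * z + (- l) * 1)).
    by apply: cderivD; [exact: cderiv_cst|apply: cderivM; [exact: cderiv_cst|exact: cderiv_id]].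
  have abl : a <= b by lra. have cdl : c <= d' by lra.
  rewrite /Pr; have -> : rect_int g a b c d' = rect_int (fun z => g z + B z) a b c d'.
    by rewrite rect_intD// rect_int_affine addr0.
  rewrite /Pr (_ : 4 * k * _ ^+ 2 = 4 * (k * (b - a + (d' - c))) * (b - a + (d' - c)));
    last ring.
  apply: rect_int_bound => //.
    by move=> z hz; apply: ccontD; [exact: cgr|exact: cB].
  move=> z /andP[/andP[za zb] /andP[zc zd]].
  have zz : rnorm (z - z0) <= (b - a) + (d' - c).
    rewrite (le_trans (rnorm_le_ReIm _))// lerD//.
      case: z za zb {zc zd} => p q /= pa pb; rewrite ler_norml; lra.
    case: z zc zd {za zb} => p q /= pa pb; rewrite ler_norml; lra.
  have zd' : rnorm (z - z0) < d by lra.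
  have := hd _ zd'; rewrite (_ : g z + B z = g z - g z0 - l * (z - z0)).
    by move=> /le_trans; apply; rewrite ler_wpM2l// ltW.
  by rewrite /B; ring.
Qed.

End goursat.

(** * Cauchy's formula on rectangles *)

Section cauchy_rectangle.
Variable R : realType.
Local Notation C := R[i].
Implicit Types (f g : C -> C) (z w : C).

(* the integrand of dz / (z - c) along the side of a square seen from its
   centre c: it does not depend on the side *)
Let side (t : R) : C := ('i - 1) * (1 + t%:C * ('i - 1))^-1.

Let sideE t : side t = ((2 * t - 1) / (2 * t ^+ 2 - 2 * t + 1)) +i*
   ((2 * t ^+ 2 - 2 * t + 1)^-1).
Proof.
have d0 : 2 * t ^+ 2 - 2 * t + 1 != 0 :> R.
  by rewrite gt_eqF//; have := sqr_ge0 t; have := sqr_ge0 (t - 1); nra.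
have n0 : 1 + t%:C * ('i - 1) != 0 :> C.
  rewrite /GRing.mul/=; apply/eqP => -[h1 h2]; move/eqP: d0; apply.
  by move: h1 h2; lra.
rewrite /side; apply: (mulIf n0); rewrite mulfVK//.
apply/eqP; rewrite eq_complex/=; apply/andP; split; apply/eqP; field.
all: by rewrite expr2 in d0 *.
Qed.

Let d_pos (t : R) : 0 < 2 * t ^+ 2 - 2 * t + 1.
Proof. have := sqr_ge0 t; have := sqr_ge0 (t - 1); nra. Qed.

Let is_derive_quad (t : R) :
  is_derive t 1 (fun u : R => 2 * u ^+ 2 - 2 * u + 1) (4 * t - 2).
Proof.
apply: is_derive_eps => e e0; exists (e / 2); first by rewrite divr_gt0.
move=> u ut; rewrite (_ : _ - _ - _ = 2 * (u - t) * (u - t)); last by ring.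
rewrite normrM ler_wpM2r// normrM ger0_norm//; lra.
Qed.

Let side_primitive : path_primitive side
  (fun u => (2^-1 * ln (2 * u ^+ 2 - 2 * u + 1)) +i* atan (2 * u - 1)).
Proof.
apply: path_primitive_of_ReIm => t t01; rewrite sideE/=.
  have h1 := @is_derive1_comp R (@ln R) _ t _ _ (is_derive1_ln (d_pos t)) (is_derive_quad t).
  have h2 := @is_deriveZ _ _ _ _ 2^-1 t 1 _ h1.
  apply: (is_derive_eq h2).
  by rewrite /GRing.scale/=; field; rewrite gt_eqF// d_pos.
have hl : is_derive t 1 (fun u : R => 2 * u - 1) 2.
  apply: is_derive_eps => e e0; exists 1 => // u _.
  have -> : 2 * u - 1 - (2 * t - 1) - 2 * (u - t) = 0 by ring.
  by rewrite normr0 mulr_ge0// ltW.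
have h1 := @is_derive1_comp R (@atan R) _ t _ _ (is_derive1_atan _) hl.
apply: (is_derive_eq h1).
have := d_pos t; have := sqr_ge0 (2 * t - 1); move=> *.
by field; apply/andP; split; rewrite gt_eqF//; nra.
Qed.

Let side_continuous : path_continuous side.
Proof.
apply: (@segment_path_continuous R (fun w => ('i - 1) * w^-1) 1 'i) => t t01.
have n0 : segment_pt (1, 'i) t != 0.
  apply/eqP => E; have := sideE t; rewrite /side -[1 + _]/(segment_pt (1, 'i) t).
  by rewrite E invr0 mulr0 => -[_ /esym/eqP]; rewrite invr_eq0 gt_eqF// d_pos.
apply: cdiff_ccont; apply: (@cdiffM _ (fun=> 'i - 1)).
  by eexists; exact: cderiv_cst.
by apply: (@cdiffV _ id) => //; eexists; exact: cderiv_id.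
Qed.

(** The sides of a square are carried to one another by a rotation about its
    centre, so each contributes a quarter of 2 pi i. *)
Lemma square_side_int z (u : C) : u != 0 ->
  seg_int (fun w => (w - z)^-1) (z + u) (z + 'i * u) = (pi / 2)*i.
Proof.
move=> u0; rewrite /seg_int.
have -> : (fun w => (w - z)^-1) \o segment_pt (z + u, z + 'i * u) =
    fun t => (u * ('i - 1))^-1 * side t.
  apply/funext => t; rewrite /side /segment_pt/=.
  have -> : z + u + t%:C * (z + 'i * u - (z + u)) - z = u * (1 + t%:C * ('i - 1)).
    by ring.
  have i1 : 'i - 1 != 0 :> C by rewrite eq_complex/= subr0 oner_eq0 andbF.
  by rewrite !invfM -!mulrA mulKf.
rewrite cintegral01Z// (cintegral01_primitive side_continuous side_primitive).
have i1 : 'i - 1 != 0 :> C by rewrite eq_complex/= subr0 oner_eq0 andbF.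
have -> : z + 'i * u - (z + u) = u * ('i - 1) by ring.
rewrite mulVKf ?mulf_neq0//.
have -> : 2 * 1 ^+ 2 - 2 * 1 + 1 = 1 :> R by ring.
have -> : 2 * 0 ^+ 2 - 2 * 0 + 1 = 1 :> R by ring.
have -> : 2 * 1 - 1 = 1 :> R by ring.
have -> : 2 * 0 - 1 = -1 :> R by ring.
by rewrite ln1 atanN atan1; simpc; congr (_ +i* _); field.
Qed.

Lemma square_int_inv z (r : R) : 0 < r ->
  rect_int (fun w => (w - z)^-1) (Re z - r) (Re z + r) (Im z - r) (Im z + r) =
  two_pi_i.
Proof.
move=> r0; pose u : C := (- r) +i* (- r).
have uN : u != 0 by rewrite eq_complex/= oppr_eq0 gt_eqF.
have iN : 'i != 0 :> C by rewrite eq_complex/= oner_eq0 andbF.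
have u1 : 'i * u != 0 by rewrite mulf_neq0.
have u2 : 'i * ('i * u) != 0 by rewrite mulf_neq0.
have u3 : 'i * ('i * ('i * u)) != 0 by rewrite mulf_neq0.
have c0 : z + u = (Re z - r) +i* (Im z - r) by case: z.
have c1 : z + 'i * u = (Re z + r) +i* (Im z - r).
  by case: z {c0} => a b; rewrite /u/=; simpc; congr (_ +i* _); ring.
have c2 : z + 'i * ('i * u) = (Re z + r) +i* (Im z + r).
  by case: z {c0 c1} => a b; rewrite /u/=; simpc; congr (_ +i* _); ring.
have c3 : z + 'i * ('i * ('i * u)) = (Re z - r) +i* (Im z + r).
  by case: z {c0 c1 c2} => a b; rewrite /u/=; simpc; congr (_ +i* _); ring.
have c4 : 'i * ('i * ('i * ('i * u))) = u.
  by rewrite /u; simpc; congr (_ +i* _); ring.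
have := square_side_int z u3; have := square_side_int z u2.
have := square_side_int z u1; have := square_side_int z uN.
rewrite c4 c0 c1 c2 c3 /rect_int => -> -> -> ->.
by rewrite /two_pi_i; simpc; congr (_ +i* _); field.
Qed.

(** By Goursat's theorem the integral does not change when the rectangle is
    replaced by a small square around z, where f is almost constant. *)
Theorem cauchy_rectangle f x0 x1 y0 y1 z :
  x0 < Re z -> Re z < x1 -> y0 < Im z -> Im z < y1 ->
  (forall w, in_rect x0 x1 y0 y1 w -> cdiff f w) ->
  rect_int (fun w => f w * (w - z)^-1) x0 x1 y0 y1 = two_pi_i * f z.
Proof.
move=> zx0 zx1 zy0 zy1 df.
pose h w := f w * (w - z)^-1.
have dh w : in_rect x0 x1 y0 y1 w -> w != z -> cdiff h w.
  by move=> wr wz; apply: cdiffM; [exact: df|exact: cdiff_inv_sub].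
have zN (w : C) : Re w != Re z \/ Im w != Im z -> w != z.
  by case: w z {zx0 zx1 zy0 zy1 h dh} => [a b] [c d]/= h; rewrite eq_complex/= negb_and; apply/orP.
have shrink r : 0 < r -> x0 <= Re z - r -> Re z + r <= x1 -> y0 <= Im z - r ->
    Im z + r <= y1 -> rect_int h x0 x1 y0 y1 =
    rect_int h (Re z - r) (Re z + r) (Im z - r) (Im z + r).
  move=> r0 r1 r2 r3 r4.
  have ch w : in_rect x0 x1 y0 y1 w -> w != z -> ccont h w.
    by move=> hw wz; exact/cdiff_ccont/dh.
  rewrite (@rect_int_vcut _ h x0 (Re z - r) x1); [|lra|lra|lra|]; last first.
    move=> w wr hw; apply: ch => //; apply: zN.
    by case: hw => ->; [left|right|right]; apply/eqP; lra.
  rewrite (@goursat _ h x0 (Re z - r)) ?add0r; [|lra|lra|]; last first.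
    move=> w /andP[/andP[w1 w2] w3]; apply: dh; first by rewrite /in_rect w3; lra.
    by apply: zN; left; apply/eqP; lra.
  rewrite (@rect_int_vcut _ h (Re z - r) (Re z + r) x1); [|lra|lra|lra|]; last first.
    move=> w /andP[/andP[w1 w2] w3] hw; apply: ch; first by rewrite /in_rect w3; lra.
    by apply: zN; case: hw => ->; [left|right|right]; apply/eqP; lra.
  rewrite (@goursat _ h (Re z + r) x1) ?addr0; [|lra|lra|]; last first.
    move=> w /andP[/andP[w1 w2] w3]; apply: dh; first by rewrite /in_rect w3; lra.
    by apply: zN; left; apply/eqP; lra.
  rewrite (@rect_int_hcut _ h _ _ y0 (Im z - r) y1); [|lra|lra|lra|]; last first.
    move=> w /andP[/andP[w1 w2] w3] hw; apply: ch; first by rewrite /in_rect w3; lra.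
    by apply: zN; case: hw => ->; [right|left|left]; apply/eqP; lra.
  rewrite (@goursat _ h _ _ y0 (Im z - r)) ?add0r; [|lra|lra|]; last first.
    move=> w /andP[/andP[w1 w2] w3]; apply: dh; first by rewrite /in_rect; lra.
    by apply: zN; right; apply/eqP; lra.
  rewrite (@rect_int_hcut _ h _ _ (Im z - r) (Im z + r) y1); [|lra|lra|lra|]; last first.
    move=> w /andP[/andP[w1 w2] w3] hw; apply: ch; first by rewrite /in_rect; lra.
    by apply: zN; case: hw => ->; [right|left|left]; apply/eqP; lra.
  rewrite (@goursat _ h _ _ (Im z + r) y1) ?addr0; [|lra|lra|]; last first.
    move=> w /andP[/andP[w1 w2] w3]; apply: dh; first by rewrite /in_rect; lra.
    by apply: zN; right; apply/eqP; lra.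
  by [].
have zr : in_rect x0 x1 y0 y1 z by rewrite /in_rect; lra.
apply/eqP; rewrite -subr_eq0; apply/eqP/rnorm_eq0/eqP.
rewrite eq_le rnorm_ge0 andbT; apply/ler_addgt0Pr => e e0; rewrite add0r.
have e1 : 0 < e / 16 by rewrite divr_gt0.
have [d d0 hd] := cdiff_ccont (df z zr) e1.
pose r := Num.min (d / 3) (Num.min (Num.min (Re z - x0) (x1 - Re z))
  (Num.min (Im z - y0) (y1 - Im z))).
have r0 : 0 < r by rewrite !lt_min divr_gt0//=; lra.
have : r <= r by []; rewrite {2}/r !le_min => /andP[r1 /andP[/andP[r2 r3] /andP[r4 r5]]].
rewrite (shrink r); [|lra|lra|lra|lra|lra].
have hx : Re z - r <= Re z + r by lra. have hy : Im z - r <= Im z + r by lra.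
rewrite mulrC -(@square_int_inv z r)// !rect_intE.
set G := rect_contour _ _ _ _.
have edge w : in_rect (Re z - r) (Re z + r) (Im z - r) (Im z + r) w ->
    (Re w == Re z - r) || (Re w == Re z + r) ||
    ((Im w == Im z - r) || (Im w == Im z + r)) ->
    [/\ in_rect x0 x1 y0 y1 w, rnorm (w - z) < d & r <= rnorm (w - z)].
  move=> /andP[/andP[w1 w2] /andP[w3 w4]] he; split; first by rewrite /in_rect; lra.
    rewrite (le_lt_trans (rnorm_le_ReIm _))//.
    have -> : Re (w - z) = Re w - Re z by case: (w) (z) => [? ?] [? ?].
    have -> : Im (w - z) = Im w - Im z by case: (w) (z) => [? ?] [? ?].
    have : `|Re w - Re z| <= r by rewrite ler_norml; lra.
    have : `|Im w - Im z| <= r by rewrite ler_norml; lra.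
    by lra.
  have i1 := absRe_le_rnorm (w - z); have i2 := absIm_le_rnorm (w - z).
  have j1 : Re (w - z) = Re w - Re z by case: (w) (z) => [? ?] [? ?].
  have j2 : Im (w - z) = Im w - Im z by case: (w) (z) => [? ?] [? ?].
  rewrite j1 in i1; rewrite j2 in i2.
  have k1 := ler_norm (Re w - Re z); have k2 := ler_norm (Im w - Im z).
  have k3 := ler_norm (- (Re w - Re z)); have k4 := ler_norm (- (Im w - Im z)).
  rewrite normrN in k3; rewrite normrN in k4.
  by case/orP : he => /orP[]/eqP E; rewrite E in i1 i2 k1 k2 k3 k4; lra.
have wz w : r <= rnorm (w - z) -> w != z.
  by move=> h1; apply: contraTneq h1 => ->; rewrite subrr rnorm0 leNgt r0.
have ci : on_contour G (ccont (fun w => (w - z)^-1)).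
  apply: on_rect_contour => // w wr wb; have [h1 h2 h3] := edge w wr wb.
  by apply/cdiff_ccont/cdiff_inv_sub/wz.
have chG : on_contour G (ccont h).
  apply: on_rect_contour => // w wr wb; have [h1 h2 h3] := edge w wr wb.
  by apply/cdiff_ccont/dh => //; exact: wz.
rewrite -mulNr -contour_integralZ//.
rewrite -contour_integralD//; last first.
  by move=> w wG; apply/ccontZ/ci.
apply: (@le_trans _ _ (2 * (e / 16 / r) * contour_length G)).
  apply: contour_integral_bound.
    by move=> w wG; apply: ccontD; [exact: chG|apply/ccontZ/ci].
  apply: on_rect_contour => // w wr wb; have [h1 h2 h3] := edge w wr wb.
  rewrite /h mulNr -mulrBl rnormM rnormV ler_pM ?rnorm_ge0 ?invr_ge0 ?rnorm_ge0//.
    exact/ltW/hd.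
  by rewrite lef_pV2// posrE// (lt_le_trans r0).
rewrite rect_contour_length//.
rewrite (_ : 2 * _ * _ = e); first by [].
by field; rewrite gt_eqF.
Qed.

End cauchy_rectangle.

(** * Uniformity on contours and on compact sets *)

Section contour_bounds.
Variable R : realType.
Local Notation C := R[i].
Implicit Types (f g : C -> C) (z w : C) (G : seq (C * C)).

Definition locally_bounded (phi : C -> R) z := exists2 e : R, 0 < e &
  exists M, forall w, rnorm (w - z) < e -> phi w <= M.

Lemma ccont_locally_bounded g z : ccont g z ->
  locally_bounded (fun w => rnorm (g w)) z.
Proof.
move=> /(_ 1 ltr01)[d d0 hd]; exists d => //; exists (rnorm (g z) + 1) => w /hd.
by have := rnorm_lowerB (g w) (g z); lra.
Qed.

Section uniform.
Variable Q : R -> C -> Prop.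
Hypothesis Q_mono : forall M M' z, M <= M' -> Q M z -> Q M' z.

Definition locally_uniform z := exists2 e : R, 0 < e &
  exists M, forall w, rnorm (w - z) < e -> Q M w.

Lemma on_segment_uniform (a b : C) : on_segment a b locally_uniform ->
  exists M, on_segment a b (Q M).
Proof.
move=> lb; have [M hM] : exists M, forall t, 0 <= t <= 1 ->
    Q M (segment_pt (a, b) t).
  apply: (@itv_bisection R (fun u v => exists M, forall t, u <= t <= v ->
    Q M (segment_pt (a, b) t)) 0 1) => //.
  - move=> u v _ _ _ [M1 h1] [M2 h2]; exists (Num.max M1 M2) => t /andP[ut tv].
    have [tm|mt] := leP t ((u + v) / 2).
      by apply: (@Q_mono M1); rewrite ?le_max ?lexx//; apply: h1; rewrite ut.
    apply: (@Q_mono M2); rewrite ?le_max ?lexx ?orbT//; apply: h2.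
    by rewrite tv ltW.
  - move=> x x01; have [e e0 [M hM]] := lb x x01.
    have K0 : 0 < rnorm (b - a) + 1 by rewrite ltr_wpDl// rnorm_ge0.
    exists (e / (rnorm (b - a) + 1)); first by rewrite divr_gt0.
    move=> u v u0 ux xv v1; rewrite ltr_pdivlMr// => uv; exists M => t /andP[ut tv].
    apply: hM; rewrite segment_pt_sub rnormM rnormc.
    have h1 : `|t - x| <= v - u by rewrite ler_norml; lra.
    have := rnorm_ge0 (b - a); have := normr_ge0 (t - x); nra.
by exists M.
Qed.

(** The support of a contour is compact, so that local uniformity is global. *)
Lemma on_contour_uniform G : on_contour G locally_uniform ->
  exists2 M, 0 < M & on_contour G (Q M).
Proof.
elim: G => [|e G ih] => [_|/on_contour_cons[/on_segment_uniform[M1 h1]]].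
  by exists 1 => // z [e]; rewrite in_nil.
move=> /ih[M2 M20 h2]; exists (Num.max M1 M2); first by rewrite lt_max M20 orbT.
apply/on_contour_cons; split => [t t01|z zG].
  by apply: (@Q_mono M1); [rewrite le_max lexx|exact: h1].
by apply: (@Q_mono M2); [rewrite le_max lexx orbT|exact: h2].
Qed.

Lemma compact_uniform (K : set C) (L : R) : 0 < L ->
  (forall z, K z -> rnorm z <= L) ->
  (forall z, ~ K z -> exists2 e, 0 < e & forall w, rnorm (w - z) < e -> ~ K w) ->
  (forall z, K z -> locally_uniform z) ->
  exists2 M, 0 < M & forall z, K z -> Q M z.
Proof.
move=> L0 KL Kc lu.
pose P (a b c d : R) : Prop := exists2 M, 0 < M &
  forall z, K z -> in_rect a b c d z -> Q M z.
suff [M M0 hM] : P (- L) L (- L) L.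
  exists M => // z Kz; apply: hM => //; rewrite /in_rect -!ler_norml.
  by rewrite (le_trans (absRe_le_rnorm z)) ?KL// (le_trans (absIm_le_rnorm z)) ?KL.
apply: (@rect_bisection R P); [lra|lra| |].
- move=> a b c d _ _ _ _ _ _ m n [M1 p1 h1] [M2 p2 h2] [M3 p3 h3] [M4 p4 h4].
  exists (M1 + M2 + M3 + M4); first by rewrite !addr_gt0.
  move=> z Kz /andP[/andP[z1 z2] /andP[z3 z4]].
  have [zm|zm] := leP (Re z) m; have [zn|zn] := leP (Im z) n.
  + apply: (@Q_mono M1); [lra|apply: h1 => //]; rewrite /in_rect; lra.
  + apply: (@Q_mono M3); [lra|apply: h3 => //]; rewrite /in_rect; lra.
  + apply: (@Q_mono M2); [lra|apply: h2 => //]; rewrite /in_rect; lra.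
  + apply: (@Q_mono M4); [lra|apply: h4 => //]; rewrite /in_rect; lra.
move=> x y _ _; pose z0 : C := x +i* y.
have near e (e0 : 0 < e) a b c d z : a <= x -> x <= b -> c <= y -> y <= d ->
    b - a < e / 2 -> d - c < e / 2 -> in_rect a b c d z -> rnorm (z - z0) < e.
  move=> h1 h2 h3 h4 h5 h6 /andP[/andP[z1 z2] /andP[z3 z4]].
  apply: (le_lt_trans (rnorm_le_ReIm _)).
  have -> : Re (z - z0) = Re z - x by rewrite /z0; case: (z).
  have -> : Im (z - z0) = Im z - y by rewrite /z0; case: (z).
  have : `|Re z - x| <= b - a by rewrite ler_norml; lra.
  have : `|Im z - y| <= d - c by rewrite ler_norml; lra.
  lra.
have [Kz|nKz] := pselect (K z0).
  have [e e0 [M hM]] := lu _ Kz; exists (e / 2); first by rewrite divr_gt0.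
  move=> a b c d _ h1 h2 _ _ h3 h4 _ h5 h6.
  exists (Num.max M 1); first by rewrite lt_max ltr01 orbT.
  move=> z _ zr; apply: (@Q_mono M); first by rewrite le_max lexx.
  exact/hM/(near e e0 a b c d).
have [e e0 he] := Kc _ nKz; exists (e / 2); first by rewrite divr_gt0.
move=> a b c d _ h1 h2 _ _ h3 h4 _ h5 h6; exists 1 => // z Kz zr.
by case: (he z) => //; exact: (near e e0 a b c d).
Qed.

End uniform.

Definition open_at (O : set C) z := exists2 e : R, 0 < e &
  forall w, rnorm (w - z) < e -> O w.

Let room (O : set C) (M : R) z := 0 < M /\ forall w, rnorm (w - z) < M^-1 -> O w.

Let room_mono O M M' z : M <= M' -> room O M z -> room O M' z.
Proof.
move=> MM [M0 h]; have M'0 := lt_le_trans M0 MM; split=> // w wz; apply: h.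
by apply: lt_le_trans wz _; rewrite lef_pV2.
Qed.

Let open_at_room (O : set C) z : open_at O z -> locally_uniform (room O) z.
Proof.
move=> [e e0 he]; exists (e / 2); first by rewrite divr_gt0.
have e2 : 0 < e / 2 by rewrite divr_gt0.
exists (e / 2)^-1 => w wz; split=> [|v]; first by rewrite invr_gt0.
rewrite invrK => vw; apply: he.
by have := rnormDist w v z; lra.
Qed.

Lemma on_contour_room G (O : set C) : on_contour G (open_at O) ->
  exists2 d, 0 < d & on_contour G (fun z => forall w, rnorm (w - z) < d -> O w).
Proof.
move=> h; have [|M M0 hM] := @on_contour_uniform (room O) (@room_mono O) G.
  by move=> z /h; exact: open_at_room.
by exists M^-1; [rewrite invr_gt0|move=> z /hM[]].
Qed.

Lemma compact_room (K O : set C) (L : R) : 0 < L ->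
  (forall z, K z -> rnorm z <= L) -> (forall z, ~ K z -> open_at (~` K) z) ->
  (forall z, K z -> open_at O z) ->
  exists2 d, 0 < d & forall z w, K z -> rnorm (w - z) < d -> O w.
Proof.
move=> L0 KL Kc KO.
have [|M M0 hM] := @compact_uniform (room O) (@room_mono O) K L L0 KL Kc.
  by move=> z /KO; exact: open_at_room.
by exists M^-1; [rewrite invr_gt0|move=> z w /hM[_]; apply].
Qed.

Lemma on_contour_bounded (phi : C -> R) G : on_contour G (locally_bounded phi) ->
  exists2 M, 0 < M & on_contour G (fun z => phi z <= M).
Proof.
by apply: on_contour_uniform => M M' z MM h; exact: le_trans MM.
Qed.

Lemma ccont_inv_sub z w : w != z -> ccont (fun v => (v - z)^-1) w.
Proof. by move=> wz; apply/cdiff_ccont/cdiff_inv_sub. Qed.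

Lemma on_contour_dist G z : ~ contour_support G z ->
  exists2 d, 0 < d & on_contour G (fun w => d <= rnorm (w - z)).
Proof.
move=> zG; have wz w : contour_support G w -> w != z.
  by move=> wG; apply/eqP => wz; apply: zG; rewrite -wz.
have [|M M0 hM] := @on_contour_bounded (fun w => rnorm ((w - z)^-1)) G.
  by move=> w /wz wz'; apply/ccont_locally_bounded/ccont_inv_sub.
exists M^-1; first by rewrite invr_gt0.
move=> w wG; have := hM w wG; rewrite rnormV => h.
have p : 0 < rnorm (w - z) by rewrite rnorm_gt0// subr_eq0 wz.
by rewrite -[leRHS]invrK lef_pV2// posrE invr_gt0.
Qed.

Lemma ccont_contour_bounded G g : on_contour G (ccont g) ->
  exists2 M, 0 < M & on_contour G (fun z => rnorm (g z) <= M).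
Proof.
by move=> cg; apply: on_contour_bounded => z /cg; exact: ccont_locally_bounded.
Qed.

Lemma ccont_cauchy_kernel G f z : on_contour G (ccont f) ->
  ~ contour_support G z -> on_contour G (ccont (fun w => f w * (w - z)^-1)).
Proof.
move=> cf zG w wG; apply: ccontM; first exact: cf.
by apply: ccont_inv_sub; apply/eqP => wz; apply: zG; rewrite -wz.
Qed.

(** This extends Cauchy's formula from the interiors of grid squares to the points
    on the grid lines. *)
Lemma cauchy_transform_ccont G f z : on_contour G (ccont f) ->
  ~ contour_support G z ->
  ccont (fun v => contour_integral G (fun w => f w * (w - v)^-1)) z.
Proof.
move=> cf zG; have [d d0 hd] := on_contour_dist zG.
have [M M0 hM] := ccont_contour_bounded cf.
have l0 := contour_length_ge0 G.
move=> e e0; pose K := 2 * (M * (2 / d ^+ 2)) * contour_length G + 1.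
have Kp : 0 < K.
  by rewrite /K ltr_wpDl// !mulr_ge0 ?invr_ge0 ?exprn_ge0// ltW.
exists (Num.min (d / 2) (e / K)); first by rewrite lt_min !divr_gt0.
move=> v; rewrite lt_min => /andP[v1 v2].
have far w : contour_support G w -> d / 2 <= rnorm (w - v).
  move=> /hd h; have := rnormDist v w z; lra.
have vG : ~ contour_support G v.
  by move=> /far; rewrite subrr rnorm0 leNgt divr_gt0.
have -> : contour_integral G (fun w => f w * (w - v)^-1) -
    contour_integral G (fun w => f w * (w - z)^-1) =
    contour_integral G (fun w => f w * (w - v)^-1 + (- 1) * (f w * (w - z)^-1)).
  rewrite contour_integralD; [|exact: ccont_cauchy_kernel|].
    by rewrite contour_integralZ ?mulN1r//; exact: ccont_cauchy_kernel.
  by move=> w wG; apply: ccontZ; exact: ccont_cauchy_kernel wG.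
apply: (@le_lt_trans _ _ (2 * (M * (2 / d ^+ 2 * rnorm (v - z))) *
    contour_length G)).
  apply: contour_integral_bound => w wG.
    apply: ccontD; first exact: ccont_cauchy_kernel wG.
    by apply: ccontZ; exact: ccont_cauchy_kernel wG.
  have h1 := far w wG; have h2 := hd w wG.
  have p1 : 0 < rnorm (w - v) by apply: lt_le_trans h1; rewrite divr_gt0.
  have p2 : 0 < rnorm (w - z) by apply: lt_le_trans h2.
  have n1 : w - v != 0 by apply: contraTneq p1 => ->; rewrite rnorm0 ltxx.
  have n2 : w - z != 0 by apply: contraTneq p2 => ->; rewrite rnorm0 ltxx.
  have -> : f w * (w - v)^-1 + -1 * (f w * (w - z)^-1) =
      f w * ((v - z) * ((w - v)^-1 * (w - z)^-1)) by field; apply/andP.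
  rewrite !rnormM !rnormV ler_pM ?mulr_ge0 ?invr_ge0 ?rnorm_ge0//; first exact: hM.
  rewrite mulrC ler_wpM2r ?rnorm_ge0//.
  have -> : 2 / d ^+ 2 = (d / 2)^-1 * d^-1 by field; rewrite gt_eqF.
  by rewrite ler_pM ?invr_ge0 ?rnorm_ge0// lef_pV2// posrE divr_gt0.
move: v2; rewrite ltr_pdivlMr// /K; have := rnorm_ge0 (v - z).
move: (2 / d ^+ 2) => q; move: (rnorm (v - z)) => r r0.
have -> : 2 * (M * (q * r)) * contour_length G =
  r * (2 * (M * q) * contour_length G) by ring.
by rewrite mulrDr mulr1; lra.
Qed.

End contour_bounds.

(** * Boundaries of unions of grid squares *)

Section grid_sum.
Variables (T : Type) (n : nat) (p : nat -> nat -> T) (m : nat -> nat -> bool).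
Hypotheses (m0l : forall j, m 0%N j = false) (mnl : forall j, m n j = false).
Hypotheses (m0r : forall i, m i 0%N = false) (mnr : forall i, m i n = false).

Let hedge i j := (p i j, p i.+1 j).
Let vedge i j := (p i j, p i j.+1).
Let flip (e : T * T) := (e.2, e.1).

Definition boundary_edge (b1 b2 : bool) (e : T * T) : seq (T * T) :=
  if b1 && ~~ b2 then [:: e] else if ~~ b1 && b2 then [:: (e.2, e.1)] else [::].

Definition grid_boundary : seq (T * T) :=
  flatten [seq flatten [seq
     boundary_edge (m i j.+1) (m i j) (hedge i j.+1) ++
     boundary_edge (m i j) (m i.+1 j) (vedge i.+1 j) | j <- iota 0 n] | i <- iota 0 n].

Variables (V : zmodType) (w : T * T -> V).

Let sum_boundary_edge b1 b2 e :
  (b1 != b2 -> w (flip e) = - w e) ->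
  \sum_(x <- boundary_edge b1 b2 e) w x =
  (if b1 then w e else 0) - (if b2 then w e else 0).
Proof.
by case: b1 b2 => [] [] h; rewrite /boundary_edge/= ?big_seq1 ?big_nil
  ?subrr ?subr0 ?sub0r//; apply: h.
Qed.

(** In the sum over the boundaries of all the marked squares, an edge between two
    marked squares is run through twice, in opposite directions.  With w an
    integral this yields Cauchy's formula, and with w a difference of indicator
    functions of the end points it shows that the boundary is a closed contour. *)
Lemma sum_grid_boundary :
  (forall i j, (i < n)%N -> (j < n)%N -> m i j != m i j.+1 ->
    w (flip (hedge i j.+1)) = - w (hedge i j.+1)) ->
  (forall i j, (i < n)%N -> (j < n)%N -> m i j != m i.+1 j ->
    w (flip (vedge i.+1 j)) = - w (vedge i.+1 j)) ->
  \sum_(e <- grid_boundary) w e =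
  \sum_(i < n) \sum_(j < n) if m i j then
    w (hedge i j) + w (vedge i.+1 j) - w (hedge i j.+1) - w (vedge i j) else 0.
Proof.
move=> hh hv; rewrite /grid_boundary big_flatten/= big_map.
have iotaE : iota 0 n = index_iota 0 n by rewrite /index_iota subn0.
rewrite iotaE big_mkord.
pose mu i j (x : V) := if m i j then x else 0.
transitivity (\sum_(i < n) \sum_(j < n)
   (mu i j.+1 (w (hedge i j.+1)) - mu i j (w (hedge i j.+1)) +
    (mu i j (w (vedge i.+1 j)) - mu i.+1 j (w (vedge i.+1 j))))).
  apply: eq_bigr => i _; rewrite big_flatten/= big_map.
  rewrite big_mkord; apply: eq_bigr => j _.
  rewrite big_cat/= !sum_boundary_edge//.
    by move=> h; apply: hv.
  by rewrite eq_sym => h; apply: hh.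
pose sm (F : nat -> nat -> V) := \sum_(i < n) \sum_(j < n) F i j.
transitivity (sm (fun i j => mu i j.+1 (w (hedge i j.+1))) -
    sm (fun i j => mu i j (w (hedge i j.+1))) +
    (sm (fun i j => mu i j (w (vedge i.+1 j))) -
     sm (fun i j => mu i.+1 j (w (vedge i.+1 j))))).
  rewrite /sm -!sumrB -big_split/=; apply: eq_bigr => i _.
  by rewrite -!sumrB -big_split.
have shift_h (i : 'I_n) : \sum_(j < n) mu i j.+1 (w (hedge i j.+1)) =
    \sum_(j < n) mu i j (w (hedge i j)).
  apply/eqP; rewrite -subr_eq0 -sumrB.
  rewrite -(big_mkord xpredT (fun j => mu i j.+1 (w (hedge i j.+1)) - mu i j (w (hedge i j)))).
  by rewrite (telescope_sumr (fun j => mu i j (w (hedge i j))))// /mu mnr m0r subrr.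
have shift_v : \sum_(i < n) \sum_(j < n) mu i.+1 j (w (vedge i.+1 j)) =
    \sum_(i < n) \sum_(j < n) mu i j (w (vedge i j)).
  rewrite exchange_big [RHS]exchange_big/=; apply: eq_bigr => j _.
  apply/eqP; rewrite -subr_eq0 -sumrB.
  rewrite -(big_mkord xpredT (fun i => mu i.+1 j (w (vedge i.+1 j)) - mu i j (w (vedge i j)))).
  by rewrite (telescope_sumr (fun i => mu i j (w (vedge i j))))// /mu mnl m0l subrr.
rewrite {4}/sm shift_v {1}/sm (eq_bigr _ (fun i _ => shift_h i)) /sm.
rewrite -!sumrB -big_split/=; apply: eq_bigr => i _.
rewrite -!sumrB -big_split/=; apply: eq_bigr => j _.
rewrite /mu; case: (m i j); last by rewrite !oppr0 !addr0.
by rewrite !addrA [LHS](ACl (1*3*2*4)%AC).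
Qed.

End grid_sum.

Lemma mem_boundary_edge (T : eqType) b1 b2 (e x : T * T) :
  x \in boundary_edge b1 b2 e -> b1 != b2 /\ (x = e \/ x = (e.2, e.1)).
Proof.
case: b1 b2 => [] []; rewrite /boundary_edge/= ?in_nil// inE => /eqP->.
  by split => //; left.
by split => //; right.
Qed.

Lemma grid_boundaryP (T : eqType) n (p : nat -> nat -> T) m e :
  e \in grid_boundary n p m -> exists i j, [/\ (i < n)%N, (j < n)%N &
  (m i j != m i j.+1 /\
     (e = (p i j.+1, p i.+1 j.+1) \/ e = (p i.+1 j.+1, p i j.+1))) \/
  (m i j != m i.+1 j /\
     (e = (p i.+1 j, p i.+1 j.+1) \/ e = (p i.+1 j.+1, p i.+1 j)))].
Proof.
move=> /flattenP[s /mapP[i + ->]]; rewrite mem_iota add0n => /andP[_ il].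
move=> /flattenP[s' /mapP[j + ->]]; rewrite mem_iota add0n => /andP[_ jl].
rewrite mem_cat => /orP[] /mem_boundary_edge[h1 h2]; exists i, j; split => //.
  by left; rewrite eq_sym.
by right.
Qed.

Lemma closed_contour_count (R : realType) (G : seq (R[i] * R[i])) :
  (forall x, \sum_(e <- G) ((e.2 == x)%:R - (e.1 == x)%:R) = 0 :> int) ->
  closed_contour G.
Proof.
move=> h; apply/allP => x _; apply/eqP/esym/eqP => /=.
have cnt (s : seq (R[i])) : (count_mem x s)%:R = \sum_(y <- s) (y == x)%:R :> int.
  elim: s => [|y s ih]; first by rewrite big_nil.
  by rewrite big_cons -ih /= natrD.
have := h x; rewrite sumrB -(big_map snd xpredT (fun y => (y == x)%:R)).
rewrite -(big_map fst xpredT (fun y => (y == x)%:R)) -!cnt => /eqP.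
by rewrite subr_eq0 eqr_nat.
Qed.

(** * Contours surrounding compact sets *)

Section grid_contour.
Variable R : realType.
Local Notation C := R[i].
Variables (K O : set C) (L d : R).
Hypotheses (L0 : 0 < L) (d0 : 0 < d).
Hypothesis (KL : forall z, K z -> `|Re z| < L /\ `|Im z| < L).
Hypothesis (KO : forall z w, K z -> rnorm (w - z) < d -> O w).

(* n squares of side s in each direction fill the square of half-side 2 L; the
   squares along its border do not meet K, since s < L, and a square that meets
   K lies in O, since its diameter is at most 2 s < d *)
Let n : nat := (Num.truncn (8 * L / d + 4)).+1.
Let s : R := 4 * L / n%:R.

Let n_gt : 8 * L / d + 4 < n%:R.
Proof. by rewrite /n truncnS_gt. Qed.

Let n0 : 0 < n%:R :> R. Proof. by rewrite ltr0n. Qed.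
Let s0 : 0 < s. Proof. by rewrite divr_gt0// mulr_gt0. Qed.
Let sn : s * n%:R = 4 * L. Proof. by rewrite /s divfK// gt_eqF. Qed.

Let sL : s < L.
Proof.
rewrite /s ltr_pdivrMr// mulrC ltr_pM2l//.
by apply: le_lt_trans n_gt; rewrite lerDr divr_ge0 ?mulr_ge0// ltW.
Qed.

Let sd : 2 * s < d.
Proof.
have h : 8 * L / d < n%:R by apply: le_lt_trans n_gt; rewrite lerDl.
have : 2 * (4 * L) < d * n%:R.
  by move: h; rewrite ltr_pdivrMr// [d * _]mulrC; lra.
rewrite -sn mulrA ltr_pM2r//.
Qed.

Let X (k : nat) : R := - (2 * L) + s * k%:R.
Let p i j : C := X i +i* X j.
Let sq i j z : bool := in_rect (X i) (X i.+1) (X j) (X j.+1) z.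
Let m i j : bool := `[< exists z, K z /\ sq i j z >].

Let XS k : X k.+1 = X k + s.
Proof. by rewrite /X -natr1; ring. Qed.

Let X_le k : X k <= X k.+1. Proof. by rewrite XS lerDl ltW. Qed.

Let X_mono i j : (i <= j)%N -> X i <= X j.
Proof. by move=> ij; rewrite lerD2l ler_pM2l// ler_nat. Qed.

Let X0 : X 0 = - (2 * L). Proof. by rewrite /X mulr0 addr0. Qed.
Let Xn : X n = 2 * L. Proof. by rewrite /X sn; ring. Qed.

Let m0l j : m 0%N j = false.
Proof.
apply/asboolP => -[z [/KL[zL _]] /andP[/andP[_ h] _]].
by move: h zL; rewrite XS X0 => h; rewrite ltr_norml => /andP[]; have := sL; lra.
Qed.

Let m0r i : m i 0%N = false.
Proof.
apply/asboolP => -[z [/KL[_ zL]] /andP[_ /andP[_ h]]].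
by move: h zL; rewrite XS X0 => h; rewrite ltr_norml => /andP[]; have := sL; lra.
Qed.

Let mnl j : m n j = false.
Proof.
apply/asboolP => -[z [/KL[zL _]] /andP[/andP[h _] _]].
by move: h zL; rewrite Xn => h; rewrite ltr_norml => /andP[]; have := sL; lra.
Qed.

Let mnr i : m i n = false.
Proof.
apply/asboolP => -[z [/KL[_ zL]] /andP[_ /andP[h _]]].
by move: h zL; rewrite Xn => h; rewrite ltr_norml => /andP[]; have := sL; lra.
Qed.

Let marked_O i j z : m i j -> sq i j z -> O z.
Proof.
move=> /asboolP[k [Kk /andP[/andP[k1 k2] /andP[k3 k4]]]].
move=> /andP[/andP[z1 z2] /andP[z3 z4]]; apply: (KO Kk).
rewrite !XS in k2 k4 z2 z4.
apply: (le_lt_trans (rnorm_le_ReIm _)); apply: le_lt_trans sd.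
have -> : Re (z - k) = Re z - Re k by case: (z) (k) => [? ?] [? ?].
have -> : Im (z - k) = Im z - Im k by case: (z) (k) => [? ?] [? ?].
have : `|Re z - Re k| <= s by rewrite ler_norml; lra.
have : `|Im z - Im k| <= s by rewrite ler_norml; lra.
lra.
Qed.

Let unmarked_K i j z : ~~ m i j -> sq i j z -> ~ K z.
Proof. by move=> /asboolP h hz Kz; apply: h; exists z. Qed.

Let G := grid_boundary n p m.

(* an edge of G separates a marked square from an unmarked one, hence lies in
   both *)
Let G_edge e : e \in G -> on_segment e.1 e.2 (fun z => exists i j i' j',
  [/\ m i j, ~~ m i' j', sq i j z & sq i' j' z]).
Proof.
have both i j i' j' z : m i j != m i' j' -> sq i j z -> sq i' j' z ->
    exists i j i' j', [/\ m i j, ~~ m i' j', sq i j z & sq i' j' z].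
  case E1: (m i j); case E2: (m i' j') => // _ z1 z2.
    by exists i, j, i', j'; rewrite E1 E2.
  by exists i', j', i, j; rewrite E1 E2.
move=> /grid_boundaryP[i [j [_ _ [[mm ee]|[mm ee]]]]].
- apply: (@rect_convex R (X i) (X i.+1) (X j.+1) (X j.+1)).
  + by case: ee => ->; rewrite /in_rect/= !lexx X_le.
  + by case: ee => ->; rewrite /in_rect/= !lexx X_le.
  move=> z /andP[z1 /andP[z2 z3]]; apply: (both _ _ _ _ _ mm).
    by rewrite /sq /in_rect z1 z3 (le_trans (X_le j)).
  by rewrite /sq /in_rect z1 z2 (le_trans z3 (X_le _)).
- apply: (@rect_convex R (X i.+1) (X i.+1) (X j) (X j.+1)).
  + by case: ee => ->; rewrite /in_rect/= !lexx X_le.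
  + by case: ee => ->; rewrite /in_rect/= !lexx X_le.
  move=> z /andP[/andP[z2 z3] z1]; apply: (both _ _ _ _ _ mm).
    by rewrite /sq /in_rect z1 z3 (le_trans (X_le i)).
  by rewrite /sq /in_rect z1 z2 (le_trans z3 (X_le _)).
Qed.

Let G_support : on_contour G (fun z => O z /\ ~ K z).
Proof.
apply/on_contourP => e eG t t01.
have [i [j [i' [j' [h1 h2 h3 h4]]]]] := G_edge eG t01.
by split; [exact: marked_O h1 h3|exact: unmarked_K h2 h4].
Qed.

Let G_closed : closed_contour G.
Proof.
apply: closed_contour_count => x.
rewrite (@sum_grid_boundary _ n p m m0l mnl m0r mnr _
  (fun e : C * C => (e.2 == x)%:R - (e.1 == x)%:R)); last first.
- by move=> i j _ _ _ /=; rewrite opprB.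
- by move=> i j _ _ _ /=; rewrite opprB.
rewrite big1// => i _; rewrite big1// => j _; case: ifP => // _ /=.
ring.
Qed.

Let G_int g :
  (forall i j z, m i j -> sq i j z -> (Re z = X i) \/ (Re z = X i.+1) \/
    (Im z = X j) \/ (Im z = X j.+1) -> ccont g z) ->
  contour_integral G g = \sum_(i < n) \sum_(j < n)
    if m i j then rect_int g (X i) (X i.+1) (X j) (X j.+1) else 0.
Proof.
move=> cg.
have hseg i j : (m i j -> on_segment (p i j) (p i.+1 j) (ccont g)) /\
    (m i j -> on_segment (p i j.+1) (p i.+1 j.+1) (ccont g)).
  split=> mij.
    apply: (@rect_convex R (X i) (X i.+1) (X j) (X j)); rewrite /in_rect/= ?lexx ?X_le//.
    move=> z /andP[z1 /andP[z2 z3]]; apply: (cg i j) => //.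
      by rewrite /sq /in_rect z1 z2 (le_trans z3 (X_le _)).
    by right; right; left; apply/eqP; rewrite eq_le z2 z3.
  apply: (@rect_convex R (X i) (X i.+1) (X j.+1) (X j.+1)); rewrite /in_rect/= ?lexx ?X_le//.
  move=> z /andP[z1 /andP[z2 z3]]; apply: (cg i j) => //.
    by rewrite /sq /in_rect z1 z3 (le_trans (X_le j)).
  by right; right; right; apply/eqP; rewrite eq_le z2 z3.
have vseg i j : (m i j -> on_segment (p i j) (p i j.+1) (ccont g)) /\
    (m i j -> on_segment (p i.+1 j) (p i.+1 j.+1) (ccont g)).
  split=> mij.
    apply: (@rect_convex R (X i) (X i) (X j) (X j.+1)); rewrite /in_rect/= ?lexx ?X_le//.
    move=> z /andP[/andP[z2 z3] z1]; apply: (cg i j) => //.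
      by rewrite /sq /in_rect z1 z2 (le_trans z3 (X_le _)).
    by left; apply/eqP; rewrite eq_le z2 z3.
  apply: (@rect_convex R (X i.+1) (X i.+1) (X j) (X j.+1)); rewrite /in_rect/= ?lexx ?X_le//.
  move=> z /andP[/andP[z2 z3] z1]; apply: (cg i j) => //.
    by rewrite /sq /in_rect z1 z3 (le_trans (X_le i)).
  by right; left; apply/eqP; rewrite eq_le z2 z3.
rewrite contour_integralE (@sum_grid_boundary _ n p m m0l mnl m0r mnr _
  (fun e : C * C => seg_int g e.1 e.2)).
- apply: eq_bigr => i _; apply: eq_bigr => j _; case: ifP => // mij /=.
  rewrite /rect_int -/(p i j) -/(p i.+1 j) -/(p i.+1 j.+1) -/(p i j.+1).
  rewrite (seg_int_rev ((hseg i j).2 mij)) (seg_int_rev ((vseg i j).1 mij)).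
  by [].
- move=> i j _ _ mm /=; apply: seg_int_rev.
  case E: (m i j) mm => /=; first by move=> _; apply: (hseg i j).2.
  by rewrite eq_sym => /eqP/eqP h; apply: (hseg i j.+1).1; case: (m i j.+1) h.
- move=> i j _ _ mm /=; apply: seg_int_rev.
  case E: (m i j) mm => /=; first by move=> _; apply: (vseg i j).2.
  by move=> h; apply: (vseg i.+1 j).1; case: (m i.+1 j) h.
Qed.

Let G_cauchy_interior f (i0 j0 : 'I_n) z : (forall w, O w -> cdiff f w) ->
  m i0 j0 -> X i0 < Re z < X i0.+1 -> X j0 < Im z < X j0.+1 ->
  contour_integral G (fun w => f w * (w - z)^-1) = two_pi_i * f z.
Proof.
move=> df m0 /andP[x1 x2] /andP[y1 y2].
have apart (k l : nat) (x : R) : X l < x -> x < X l.+1 -> X k <= x -> x <= X k.+1 -> k = l.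
  move=> h1 h2 h3 h4; apply/eqP; rewrite eqn_leq; apply/andP; split.
    rewrite leqNgt; apply/negP => /X_mono h; lra.
  rewrite leqNgt; apply/negP => /X_mono h; lra.
have not_grid k l (x : R) : X l < x -> x < X l.+1 -> x <> X k.
  move=> h1 h2 E; case: (leqP k l) => [/X_mono|/X_mono]; lra.
rewrite G_int; last first.
  move=> i j w mij wij hw; apply: ccontM.
    by apply/cdiff_ccont/df/(marked_O mij).
  apply: ccont_inv_sub; apply/eqP => wz; rewrite wz in hw.
  by case: hw => [|[|[|]]]; apply: not_grid; eassumption.
rewrite (bigD1 i0)//= (bigD1 j0)//= m0 [X in _ + X + _]big1 ?addr0; last first.
  move=> j jj0; case: ifP => // mij; apply: goursat => // w wij.
  apply: cdiffM; first by apply/df/(marked_O mij).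
  apply: cdiff_inv_sub; apply: contraNneq jj0 => wz; apply/eqP/val_inj => /=.
  move: wij => /andP[_ /andP[w1 w2]]; rewrite wz in w1 w2.
  exact: apart w1 w2.
rewrite [X in _ + X]big1 ?addr0; last first.
  move=> i ii0; rewrite big1// => j _; case: ifP => // mij; apply: goursat => // w wij.
  apply: cdiffM; first by apply/df/(marked_O mij).
  apply: cdiff_inv_sub; apply: contraNneq ii0 => wz; apply/eqP/val_inj => /=.
  move: wij => /andP[/andP[w1 w2] _]; rewrite wz in w1 w2.
  exact: apart w1 w2.
apply: cauchy_rectangle => // w wij; exact/df/(marked_O m0).
Qed.

Let locate (x : R) : `|x| < L -> exists i : 'I_n, X i <= x <= X i.+1.
Proof.
rewrite ltr_norml => /andP[x1 x2].
have h0 : 0 <= (x + 2 * L) / s by rewrite divr_ge0 ?(ltW s0)//; lra.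
have /andP[h1 h2] := truncn_itv h0.
set i := Num.truncn _ in h1 h2.
have i_lt : (i < n)%N.
  rewrite -(ltr_nat R) (le_lt_trans h1)// ltr_pdivrMr// [_ * s]mulrC sn; lra.
exists (Ordinal i_lt) => /=; rewrite XS /X.
move: h1 h2; rewrite ler_pdivlMr// ltr_pdivrMr// -natr1; lra.
Qed.

Let G_cauchy f z : (forall w, O w -> cdiff f w) -> K z ->
  contour_integral G (fun w => f w * (w - z)^-1) = two_pi_i * f z.
Proof.
move=> df Kz; have [zL1 zL2] := KL Kz.
have [i zi] := locate zL1; have [j zj] := locate zL2.
have zsq : sq i j z by rewrite /sq /in_rect zi zj.
have mij : m i j by apply/asboolP; exists z.
have Oz := marked_O mij zsq.
have cf : on_contour G (ccont f).
  by move=> w /G_support[Ow _]; exact/cdiff_ccont/df.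
have zG : ~ contour_support G z by move=> /G_support[].
pose D v := contour_integral G (fun w => f w * (w - v)^-1) + - two_pi_i * f v.
have cD : ccont D z.
  apply: ccontD; first exact: cauchy_transform_ccont.
  by apply: ccontZ; exact/cdiff_ccont/df.
have Dz : D z = 0.
  apply/rnorm_eq0/eqP; rewrite eq_le rnorm_ge0 andbT.
  apply/ler_addgt0Pr => e e0; rewrite add0r.
  have [r r0 hr] := cD e e0.
  (* a point of the open square close to z, on the way to its centre *)
  pose c : C := (X i + s / 2) +i* (X j + s / 2).
  have cz0 : 0 < rnorm (c - z) + 1 by rewrite ltr_wpDl// rnorm_ge0.
  pose t := Num.min (1 / 2) (r / 2 / (rnorm (c - z) + 1)).
  have t0 : 0 < t by rewrite lt_min !divr_gt0.
  have t1 : t <= 1 / 2 by rewrite ge_min lexx.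
  have t2 : t * (rnorm (c - z) + 1) <= r / 2.
    by rewrite -ler_pdivlMr// ge_min lexx orbT.
  pose v := segment_pt (z, c) t.
  have vz : rnorm (v - z) < r.
    rewrite -[X in v - X](segment_pt0 z c) segment_pt_sub subr0 rnormM rnormc.
    rewrite gtr0_norm//; have := rnorm_ge0 (c - z); nra.
  have Dv : D v = 0.
    move: zi zj => /andP[zi1 zi2] /andP[zj1 zj2]; rewrite XS in zi2; rewrite XS in zj2.
    rewrite /D (@G_cauchy_interior f i j)// ?mulNr ?subrr//.
      rewrite /v /c segment_ptE/= XS; have ts : 0 < t * s by rewrite mulr_gt0.
      have q1 : 0 <= (1 - t) * (Re z - X i) by rewrite mulr_ge0; lra.
      have q2 : 0 <= (1 - t) * (X i + s - Re z) by rewrite mulr_ge0; lra.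
      apply/andP; split; lra.
    rewrite /v /c segment_ptE/= XS; have ts : 0 < t * s by rewrite mulr_gt0.
    have q1 : 0 <= (1 - t) * (Im z - X j) by rewrite mulr_ge0; lra.
    have q2 : 0 <= (1 - t) * (X j + s - Im z) by rewrite mulr_ge0; lra.
    apply/andP; split; lra.
  have := hr v vz; rewrite Dv sub0r rnormN; exact: ltW.
by move: Dz; rewrite /D mulNr => /eqP; rewrite subr_eq0 => /eqP.
Qed.

Let G_goursat f : (forall w, O w -> cdiff f w) -> contour_integral G f = 0.
Proof.
move=> df; rewrite G_int; last first.
  by move=> i j w mij wij _; apply/cdiff_ccont/df/(marked_O mij).
rewrite big1// => i _; rewrite big1// => j _; case: ifP => // mij.
by apply: goursat => // w wij; apply/df/(marked_O mij).
Qed.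

(** The contour is the boundary of the union of the squares of a fine grid that
    meet K.  At an interior point of such a square Cauchy's formula is the sum of
    the formula for this square and of Goursat's theorem for the others. *)
Theorem grid_contour : exists G, [/\ closed_contour G,
  on_contour G (fun z => O z /\ ~ K z),
  forall f z, (forall w, O w -> cdiff f w) -> K z ->
    contour_integral G (fun w => f w * (w - z)^-1) = two_pi_i * f z &
  forall f, (forall w, O w -> cdiff f w) -> contour_integral G f = 0].
Proof. by exists G. Qed.

End grid_contour.

(** * The index, and approximation of Cauchy integrals *)

Section index.
Variable R : realType.
Local Notation C := R[i].
Implicit Types (f g : C -> C) (a b z w : C) (G : seq (C * C)).

Definition index_int G a : C := contour_integral G (fun w => (w - a)^-1).

Lemma winding_numberE G a : winding_number G a = two_pi_i^-1 * index_int G a.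
Proof. by []. Qed.

Lemma two_pi_i_neq0 : two_pi_i != 0 :> C.
Proof.
by rewrite eq_complex/= eqxx/= mulf_neq0// gt_eqF// pi_gt0.
Qed.

Let far_neq (d : R) a w : 0 < d -> d <= rnorm (w - a) -> w != a.
Proof. by move=> d0 h; apply: contraTneq h => ->; rewrite subrr rnorm0 leNgt d0. Qed.

(* the first order variation of the index vanishes, since (w - a) ^ -2 has a
   primitive *)
Let index_step G a b (d : R) : closed_contour G -> 0 < d ->
  on_contour G (fun w => d <= rnorm (w - a)) ->
  on_contour G (fun w => d <= rnorm (w - b)) ->
  rnorm (index_int G b - index_int G a) <=
  2 * (rnorm (b - a) ^+ 2 / d ^+ 3) * contour_length G.
Proof.
move=> cG d0 ha hb.
have ia w : contour_support G w -> cdiff (fun w => (w - a)^-1) w.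
  by move=> /ha h; apply/cdiff_inv_sub/(far_neq d0 h).
have ib w : contour_support G w -> cdiff (fun w => (w - b)^-1) w.
  by move=> /hb h; apply/cdiff_inv_sub/(far_neq d0 h).
have ca : on_contour G (ccont (fun w => (w - a)^-1)) by move=> w /ia/cdiff_ccont.
have cb : on_contour G (ccont (fun w => (w - b)^-1)) by move=> w /ib/cdiff_ccont.
pose q w := (w - a)^-1 * (w - a)^-1.
have cq : on_contour G (ccont q) by move=> w wG; apply: ccontM; exact: ca.
have q0 : contour_integral G q = 0.
  apply: (@contour_integral_FTC _ _ (fun w => -1 * (w - a)^-1)) => // w wG.
  have wa := far_neq d0 (ha w wG).
  have := cderivM (cderiv_cst (-1) w)
    (@cderivV _ (fun w => w - a) w 1 _ (cderiv_sub_cst a w)).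
  rewrite subr_eq0 => /(_ wa); rewrite mul0r add0r mulN1r mulNr opprK mul1r.
  by rewrite -exprVn expr2.
pose h w := (b - a) ^+ 2 * (q w * (w - b)^-1).
have -> : index_int G b - index_int G a = contour_integral G h.
  have E : on_contour G (fun w => h w =
      (w - b)^-1 + ((-1) * (w - a)^-1 + - (b - a) * q w)).
    move=> w wG; have wa := far_neq d0 (ha w wG); have wb := far_neq d0 (hb w wG).
    by rewrite /h /q; field; rewrite !subr_eq0 wa wb.
  rewrite (eq_contour_integral E) contour_integralD//; last first.
    by move=> w wG; apply: ccontD; apply: ccontZ; [exact: ca|exact: cq].
  rewrite contour_integralD; first by rewrite !contour_integralZ// q0 mulr0 addr0 mulN1r.
    by move=> w wG; apply/ccontZ/ca.
  by move=> w wG; apply/ccontZ/cq.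
apply: contour_integral_bound => w wG.
  by apply/ccontZ/ccontM; [exact: cq|exact: cb].
rewrite /h /q rnormM rnormX !rnormM !rnormV ler_wpM2l ?exprn_ge0 ?rnorm_ge0//.
have i1 : (rnorm (w - a))^-1 <= d^-1.
  by rewrite lef_pV2 ?posrE ?(lt_le_trans d0)// ha.
have i2 : (rnorm (w - b))^-1 <= d^-1.
  by rewrite lef_pV2 ?posrE ?(lt_le_trans d0)// hb.
rewrite -exprVn (_ : d^-1 ^+ 3 = d^-1 * d^-1 * d^-1); last by ring.
by rewrite !ler_pM ?mulr_ge0 ?invr_ge0 ?rnorm_ge0.
Qed.

(** Over each of n equal steps the index varies by O(n ^ -2), so its variation
    along the segment is O(1 / n) for every n. *)
Lemma index_const G a b (d : R) : closed_contour G -> 0 < d ->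
  on_segment a b (fun z => on_contour G (fun w => d <= rnorm (w - z))) ->
  index_int G a = index_int G b.
Proof.
move=> cG d0 far; apply/eqP; rewrite eq_sym -subr_eq0; apply/eqP/rnorm_eq0.
pose M := 2 * (rnorm (b - a) ^+ 2 / d ^+ 3) * contour_length G.
have M0 : 0 <= M.
  by rewrite /M !mulr_ge0 ?contour_length_ge0 ?exprn_ge0 ?rnorm_ge0 ?invr_ge0 ?exprn_ge0// ltW.
have bound (n : nat) : rnorm (index_int G b - index_int G a) <= M / n.+1%:R.
  pose c k := segment_pt (a, b) (k%:R / n.+1%:R).
  have n0 : 0 < n.+1%:R :> R by rewrite ltr0n.
  have c01 k : (k <= n.+1)%N -> 0 <= (k%:R / n.+1%:R : R) <= 1.
    by move=> kn; rewrite divr_ge0//= ler_pdivrMr// mul1r ler_nat.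
  have part k : (k <= n.+1)%N -> rnorm (index_int G (c k) - index_int G a) <=
      k%:R * (M / n.+1%:R ^+ 2).
    elim: k => [_|k ih kn].
      by rewrite /c mul0r segment_pt0 subrr rnorm0 mul0r.
    have := rnormDist (index_int G (c k)) (index_int G (c k.+1)) (index_int G a).
    move/le_trans; apply; rewrite -natr1 mulrDl mul1r addrC lerD ?ih ?(ltnW kn)//.
    have := @index_step G (c k) (c k.+1) d cG d0 (far _ (c01 _ (ltnW kn))) (far _ (c01 _ kn)).
    move/le_trans; apply; rewrite /c segment_pt_sub rnormM rnormc.
    have -> : k.+1%:R / n.+1%:R - k%:R / n.+1%:R = n.+1%:R^-1 :> R.
      by rewrite -mulrBl -natr1 addrAC subrr add0r mul1r.
    rewrite ger0_norm ?invr_ge0// /M le_eqVlt; apply/orP; left; apply/eqP.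
    by rewrite exprMn exprVn; ring.
  have := part n.+1 (leqnn _); rewrite /c divff ?gt_eqF// segment_pt1.
  by rewrite expr2 invfM mulrCA mulrA mulrA mulfK ?gt_eqF.
apply/eqP; rewrite eq_le rnorm_ge0 andbT; apply/ler_addgt0Pr => e e0.
rewrite add0r (le_trans (bound (Num.truncn (M / e))))//.
rewrite ler_pdivrMr ?ltr0n// mulrC -ler_pdivrMr// ltW//.
exact: truncnS_gt.
Qed.

(** The ray from the point a to infinity does not meet the contour, and the index
    tends to 0 along it. *)
Lemma index_far G (L : R) a : closed_contour G ->
  on_contour G (fun w => rnorm w <= L) -> L < rnorm a -> index_int G a = 0.
Proof.
move=> cG hL La; pose d := rnorm a - L; have d0 : 0 < d by rewrite subr_gt0.
have l0 := contour_length_ge0 G.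
have [G0|/negP G0] := boolP (G == [::]).
  by rewrite (eqP G0) /index_int contour_integral_nil.
have L0 : 0 <= L.
  case: G G0 hL {cG l0} => // e G _ /on_contour_cons[h _].
  by apply: (le_trans (rnorm_ge0 _) (h 0 _)); rewrite lexx ler01.
have far T : 1 <= T -> on_contour G (fun w => T * d <= rnorm (w - T%:C * a)).
  move=> T1 w /hL wL; have := rnorm_lowerB (T%:C * a) w.
  rewrite -rnormBC rnormM rnormc ger0_norm ?(le_trans ler01)// /d; nra.
have cst T : 1 <= T -> index_int G a = index_int G (T%:C * a).
  move=> T1; apply: (@index_const _ _ _ d) => // t /andP[t0 t1] w wG.
  have -> : segment_pt (a, T%:C * a) t = (1 + t * (T - 1))%:C * a.
    by rewrite /segment_pt /= !(rmorphD, rmorphM, rmorphN, rmorph1)/=; ring.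
  have T2 : 1 <= 1 + t * (T - 1) by rewrite lerDl mulr_ge0// subr_ge0.
  by apply: le_trans (far _ T2 w wG); rewrite ler_peMl// ltW.
apply/rnorm_eq0/eqP; rewrite eq_le rnorm_ge0 andbT; apply/ler_addgt0Pr => e e0.
rewrite add0r.
pose T := 1 + 2 * contour_length G / (d * e).
have T1 : 1 <= T by rewrite lerDl divr_ge0 ?mulr_ge0// ltW.
have T0 : 0 < T by apply: lt_le_trans T1.
rewrite (cst T T1); apply: (@le_trans _ _ (2 * (T * d)^-1 * contour_length G)).
  have Td : 0 < T * d by rewrite mulr_gt0.
  apply: contour_integral_bound => w wG; have h := far T T1 w wG.
    exact/ccont_inv_sub/(far_neq Td h).
  by rewrite rnormV lef_pV2// posrE// (lt_le_trans Td).
rewrite mulrAC ler_pdivrMr ?mulr_gt0// /T.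
have -> : e * ((1 + 2 * contour_length G / (d * e)) * d) = e * d + 2 * contour_length G.
  by field; rewrite !gt_eqF.
by rewrite lerDr mulr_ge0// ltW.
Qed.

End index.

Section homology.
Variable R : realType.
Local Notation C := R[i].
Implicit Types (f g : C -> C) (a b z w : C) (G : seq (C * C)).

(** Riemann sums, which converge uniformly for z away from the contour.  A Cauchy
    integral can then be integrated in z as if it were a finite combination of
    simple fractions, which replaces the exchange of two contour integrals. *)
Lemma cauchy_transform_approx G f (S : set C) (d e : R) : 0 < d -> 0 < e ->
  on_contour G (ccont f) ->
  (forall z, S z -> on_contour G (fun w => d <= rnorm (w - z))) ->
  exists s : seq (C * C), (forall x, x \in s -> contour_support G x.2) /\
  forall z, S z -> rnorm (contour_integral G (fun w => f w * (w - z)^-1) -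
     \sum_(x <- s) x.1 * (x.2 - z)^-1) <= e.
Proof.
move=> d0 e0 cf far.
have zw z w : S z -> contour_support G w -> w != z.
  by move=> Sz wG; apply: contraTneq (far z Sz w wG) => ->; rewrite subrr rnorm0 leNgt d0.
have side (a b : C) (e' : R) : 0 < e' -> on_segment a b (contour_support G) ->
    exists s : seq (C * C), (forall x, x \in s -> contour_support G x.2) /\
    forall z, S z -> rnorm (seg_int (fun w => f w * (w - z)^-1) a b -
     \sum_(x <- s) x.1 * (x.2 - z)^-1) <= e'.
  move=> e'0 abG.
  have K0 : 0 < rnorm (b - a) + 1 by rewrite ltr_wpDl// rnorm_ge0.
  pose P (u v : R) : Prop := exists s : seq (C * C),
    (forall x, x \in s -> contour_support G x.2) /\
    forall z, S z -> rnorm (seg_int (fun w => f w * (w - z)^-1)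
      (segment_pt (a, b) u) (segment_pt (a, b) v) -
     \sum_(x <- s) x.1 * (x.2 - z)^-1) <= e' * (v - u).
  suff [s [s1 s2]] : P 0 1.
    exists s; split => // z /s2; rewrite segment_pt0 segment_pt1 subr0 mulr1.
    by [].
  have ck z : S z -> on_segment a b (ccont (fun w => f w * (w - z)^-1)).
    move=> Sz t t01; apply: ccontM; first exact/cf/abG.
    by apply: ccont_inv_sub; apply: zw => //; exact: abG.
  apply: (@itv_bisection R P) => //.
  - move=> u v u0 uv v1 [s1 [h1 k1]] [s2 [h2 k2]]; exists (s1 ++ s2); split.
      by move=> x; rewrite mem_cat => /orP[/h1|/h2].
    move=> z Sz; have [Q hQ] := seg_int_param (ck z Sz).
    have u01 : 0 <= u <= 1 by lra.
    have v01 : 0 <= v <= 1 by lra.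
    have m01 : 0 <= (u + v) / 2 <= 1 by lra.
    have := k1 z Sz; have := k2 z Sz; rewrite !hQ// big_cat/=.
    move: (\sum_(x <- s1) _) (\sum_(x <- s2) _) => t1 t2 q2 q1.
    have -> : (b - a) * (Q v - Q u) - (t1 + t2) =
      (b - a) * (Q ((u + v) / 2) - Q u) - t1 +
      ((b - a) * (Q v - Q ((u + v) / 2)) - t2) by ring.
    by apply: (le_trans (rnormD _ _)); lra.
  move=> x x01; pose p := segment_pt (a, b) x.
  have pG : contour_support G p by exact: abG.
  pose r := e' / (2 * (rnorm (b - a) + 1)); have r0 : 0 < r by rewrite divr_gt0// mulr_gt0.
  have rd : 0 < r * d / 2 by rewrite divr_gt0// mulr_gt0.
  have [d1 d10 h1] := cf p pG _ rd.
  pose F := rnorm (f p) + 1; have F0 : 0 < F by rewrite ltr_wpDl// rnorm_ge0.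
  pose d2 := Num.min d1 (r * d ^+ 2 / (2 * F)).
  have d20 : 0 < d2.
    rewrite lt_min d10 /=; apply: divr_gt0; first by rewrite mulr_gt0// exprn_gt0.
    by rewrite mulr_gt0.
  exists (d2 / (rnorm (b - a) + 1)); first by rewrite divr_gt0.
  move=> u v u0 ux xv v1; rewrite ltr_pdivlMr// => uv.
  have u01 : 0 <= u <= 1 by lra.
  have v01 : 0 <= v <= 1 by lra.
  exists [:: (f p * (segment_pt (a, b) v - segment_pt (a, b) u), p)]; split.
    by move=> y; rewrite inE => /eqP->.
  move=> z Sz; rewrite big_seq1/=.
  set pu := segment_pt _ u; set pv := segment_pt _ v.
  have -> : f p * (pv - pu) * (p - z)^-1 = seg_int (fun=> f p * (p - z)^-1) pu pv.
    by rewrite seg_int_cst; ring.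
  have cpq : on_segment pu pv (ccont (fun w => f w * (w - z)^-1)).
    by apply: on_segment_sub => //; exact: ck.
  rewrite -[- seg_int _ _ _]mulN1r -seg_intZ; last by move=> t _; exact: ccont_cst.
  rewrite -seg_intD//; last by move=> t _; apply/ccontZ/ccont_cst.
  apply: (@le_trans _ _ (2 * r * rnorm (pv - pu))); last first.
    rewrite segment_pt_sub rnormM rnormc ger0_norm ?subr_ge0//; last lra.
    have -> : 2 * r * ((v - u) * rnorm (b - a)) =
        (e' * (v - u)) * (rnorm (b - a) / (rnorm (b - a) + 1)).
      by rewrite /r; field; rewrite gt_eqF.
    rewrite ler_piMr ?mulr_ge0 ?(ltW e'0)//; first lra.
    by rewrite ler_pdivrMr// mul1r lerDl.
  apply: seg_int_bound.
    by move=> t t01; apply: ccontD; [exact: cpq|apply/ccontZ/ccont_cst].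
  move=> t t01; rewrite segment_pt_pt.
  have q01 := itv01_comb u01 v01 t01; set y := u + _ in q01 *.
  have yuv : u <= y <= v.
    by rewrite /y; case/andP: t01 => *; apply/andP; split; nra.
  set w := segment_pt _ y; have wG : contour_support G w by exact: abG.
  have wz := far z Sz w wG; have pz := far z Sz p pG.
  have nwz := zw z w Sz wG; have npz := zw z p Sz pG.
  have wp : rnorm (w - p) < d2.
    rewrite segment_pt_sub rnormM rnormc.
    have q1 : `|y - x| <= v - u by rewrite ler_norml; lra.
    have := rnorm_ge0 (b - a); have := normr_ge0 (y - x); nra.
  move: wp; rewrite lt_min => /andP[/h1 wp1 wp2].
  have -> : f w * (w - z)^-1 + -1 * (f p * (p - z)^-1) =
     (f w - f p) * (w - z)^-1 + f p * ((p - w) * ((w - z)^-1 * (p - z)^-1)).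
    by field; rewrite !subr_eq0 nwz npz.
  apply: (le_trans (rnormD _ _)); rewrite !rnormM !rnormV.
  have i1 : (rnorm (w - z))^-1 <= d^-1 by rewrite lef_pV2 ?posrE ?(lt_le_trans d0).
  have i2 : (rnorm (p - z))^-1 <= d^-1 by rewrite lef_pV2 ?posrE ?(lt_le_trans d0).
  have -> : r = r * d / 2 * d^-1 + F * (r * d ^+ 2 / (2 * F) * (d^-1 * d^-1)).
    by field; rewrite (gt_eqF d0) (gt_eqF F0).
  rewrite lerD//; first by rewrite ler_pM ?invr_ge0 ?rnorm_ge0// ltW.
  rewrite ler_pM ?mulr_ge0 ?invr_ge0 ?rnorm_ge0//; first by rewrite lerDl.
  rewrite ler_pM ?mulr_ge0 ?invr_ge0 ?rnorm_ge0//.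
    by rewrite -rnormBC ltW.
  by rewrite ler_pM ?invr_ge0 ?rnorm_ge0.
have K0 : 0 < (size G)%:R + 1 :> R by rewrite ltr_wpDl.
pose e1 := e / ((size G)%:R + 1); have e10 : 0 < e1 by rewrite divr_gt0.
suff gen (G' : seq (C * C)) : {subset G' <= G} -> exists s : seq (C * C), (forall x, x \in s -> contour_support G x.2) /\
  forall z, S z -> rnorm (contour_integral G' (fun w => f w * (w - z)^-1) -
     \sum_(x <- s) x.1 * (x.2 - z)^-1) <= (size G')%:R * e1.
  have [//|s [h1 h2]] := gen G; exists s; split => // z /h2/le_trans; apply.
  by rewrite /e1 mulrCA ler_piMr ?(ltW e0)// ler_pdivrMr// mul1r lerDl.
elim: G' => [|[a b] G' ih] sub.
  exists [::]; split => // z _.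
  by rewrite contour_integral_nil big_nil subrr rnorm0 mul0r.
have [|s [h1 h2]] := ih; first by move=> x xG; apply: sub; rewrite inE xG orbT.
have abG : on_segment a b (contour_support G).
  by move=> t t01; exists (a, b); [exact/sub/mem_head|exists t => //; rewrite in_itv].
have [s' [h1' h2']] := side a b e1 e10 abG.
exists (s' ++ s); split.
  by move=> x; rewrite mem_cat => /orP[/h1'|/h1].
move=> z Sz; rewrite contour_integral_cons big_cat/= opprD addrACA.
rewrite (le_trans (rnormD _ _))//= -natr1 mulrDl mul1r [_ * e1 + _]addrC.
by rewrite lerD ?h2 ?h2'.
Qed.

End homology.

(** * Cauchy's theorem in homology form *)

Section homology_theorem.
Variable R : realType.
Local Notation C := R[i].
Implicit Types (f g : C -> C) (a b z w : C) (G : seq (C * C)) (O : set C).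

(** The points that a contour meets or encircles: a compact set, contained in
    every open set in which the contour lies and is homologous to zero. *)
Definition contour_hull G : set C :=
  [set z | contour_support G z \/ index_int G z <> 0].

Lemma contour_hull_bounded G : closed_contour G ->
  exists2 L, 0 < L & forall z, contour_hull G z -> rnorm z <= L.
Proof.
move=> cG; have [|L L0 hL] := @ccont_contour_bounded R G id.
  by move=> z _; apply: cdiff_ccont; exists 1; exact: cderiv_id.
exists L => // z [/hL//|iz]; rewrite leNgt; apply/negP => /(index_far cG hL).
exact: iz.
Qed.

Lemma contour_hull_closed G z : closed_contour G -> ~ contour_hull G z ->
  open_at (~` contour_hull G) z.
Proof.
move=> cG /not_orP[zG iz]; have [d d0 hd] := on_contour_dist zG.
exists (d / 2); first by rewrite divr_gt0.
move=> w wz.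
have far : on_segment z w (fun v => on_contour G (fun u => d / 2 <= rnorm (u - v))).
  move=> t /andP[t0 t1] u /hd hu.
  have h : rnorm (segment_pt (z, w) t - z) < d / 2.
    rewrite -[X in _ - X](segment_pt0 z w) segment_pt_sub subr0 rnormM rnormc.
    by rewrite ger0_norm//; have := rnorm_ge0 (w - z); nra.
  have := rnormDist (segment_pt (z, w) t) u z; lra.
have d20 : 0 < d / 2 by rewrite divr_gt0.
have iw := index_const cG d20 far.
move=> [wG|]; last by rewrite -iw => /(_ (contrapT _)); apply.
have := far 1; rewrite segment_pt1 lexx ler01 => /(_ isT w wG).
by rewrite subrr rnorm0 leNgt d20.
Qed.

Lemma contour_hull_room G O : closed_contour G ->
  (forall z, O z -> open_at O z) -> on_contour G O ->
  (forall a, ~ O a -> index_int G a = 0) ->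
  exists2 d, 0 < d & forall z w, contour_hull G z -> rnorm (w - z) < d -> O w.
Proof.
move=> cG oO GO iO; have [L L0 hL] := contour_hull_bounded cG.
apply: (compact_room L0 hL); first by move=> z; exact: contour_hull_closed.
move=> z hz; apply: oO; case: hz => [/GO//|iz].
by apply: contrapT => /iO.
Qed.

Lemma contour_surround (K O : set C) (L d : R) : 0 < L -> 0 < d ->
  (forall z, K z -> rnorm z <= L) ->
  (forall z w, K z -> rnorm (w - z) < d -> O w) ->
  exists G, [/\ closed_contour G, on_contour G (fun z => O z /\ ~ K z),
    forall f z, (forall w, O w -> cdiff f w) -> K z ->
      contour_integral G (fun w => f w * (w - z)^-1) = two_pi_i * f z &
    forall f, (forall w, O w -> cdiff f w) -> contour_integral G f = 0].
Proof.
move=> L0 d0 KL KO; apply: (@grid_contour R K O (L + 1) d) => //.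
  by rewrite addr_gt0.
move=> z /KL zL; have := absRe_le_rnorm z; have := absIm_le_rnorm z.
by split; lra.
Qed.

Let fractions_int G (s : seq (C * C)) : closed_contour G ->
  (forall x, x \in s -> ~ contour_hull G x.2) ->
  on_contour G (ccont (fun z => \sum_(x <- s) x.1 * (x.2 - z)^-1)) /\
  contour_integral G (fun z => \sum_(x <- s) x.1 * (x.2 - z)^-1) = 0.
Proof.
move=> cG; elim: s => [|x s ih] hs.
  have -> : (fun z : C => \sum_(x <- [::]) x.1 * (x.2 - z)^-1) = fun=> (0 : C).
    by apply/funext => z; rewrite big_nil.
  split=> [z _|]; first exact: ccont_cst.
  by rewrite contour_integralE big1// => e _; rewrite seg_int_cst mul0r.
have [|c1 i1] := ih; first by move=> y ys; apply: hs; rewrite inE ys orbT.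
have [xG /contrapT ix] : ~ contour_support G x.2 /\ ~ index_int G x.2 <> 0.
  by apply/not_orP/hs/mem_head.
have -> : (fun z : C => \sum_(y <- x :: s) y.1 * (y.2 - z)^-1) =
    fun z => (- x.1) * (z - x.2)^-1 + \sum_(y <- s) y.1 * (y.2 - z)^-1.
  apply/funext => z; rewrite big_cons; congr (_ + _).
  by rewrite -[x.2 - z]opprB invrN mulrN mulNr.
have cx : on_contour G (ccont (fun z => (z - x.2)^-1)).
  by move=> z zG; apply: ccont_inv_sub; apply/eqP => zx; apply: xG; rewrite -zx.
split=> [z zG|]; first by apply: ccontD; [apply/ccontZ/cx|exact: c1].
rewrite contour_integralD//; last by move=> z zG; apply/ccontZ/cx.
by rewrite contour_integralZ// -/(index_int G x.2) ix mulr0 i1 addr0.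
Qed.

(** A second contour surrounds the hull of G.  On G the function f is the Cauchy
    integral over this second contour, hence a limit of combinations of simple
    fractions with poles outside the hull; and these integrate to 0 over G. *)
Theorem cauchy_homology O G f : (forall z, O z -> open_at O z) ->
  closed_contour G -> on_contour G O -> (forall a, ~ O a -> index_int G a = 0) ->
  (forall z, O z -> cdiff f z) -> contour_integral G f = 0.
Proof.
move=> oO cG GO iO df.
have [L L0 hL] := contour_hull_bounded cG.
have [d d0 hd] := contour_hull_room cG oO GO iO.
have [Q [cQ QO Qf _]] := contour_surround L0 d0 hL hd.
have cfQ : on_contour Q (ccont f) by move=> w /QO[/df/cdiff_ccont].
have GQ z : contour_support G z -> ~ contour_support Q z.
  by move=> zG /QO[_]; apply; left.
have [|r r0 hr] := @on_contour_room R Q (~` contour_support G).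
  move=> w /QO[_ /not_orP[wG _]]; have [e e0 he] := on_contour_dist wG.
  exists e => // v vw vG; have := he v vG; lra.
have far z : contour_support G z -> on_contour Q (fun w => r <= rnorm (w - z)).
  move=> zG w wQ; rewrite leNgt; apply/negP => h.
  by apply: (hr w wQ z) => //; rewrite rnormBC.
pose F z := contour_integral Q (fun w => f w * (w - z)^-1).
have FE : on_contour G (fun z => F z = two_pi_i * f z).
  by move=> z zG; apply: Qf => //; left.
have cF : on_contour G (ccont F).
  by move=> z /GQ; exact: cauchy_transform_ccont.
have cf : on_contour G (ccont f) by move=> z /GO/df/cdiff_ccont.
suff : contour_integral G F = 0.
  rewrite (eq_contour_integral FE) contour_integralZ// => /eqP.
  by rewrite mulf_eq0 (negPf (two_pi_i_neq0 R)) => /eqP.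
apply/rnorm_eq0/eqP; rewrite eq_le rnorm_ge0 andbT; apply/ler_addgt0Pr => e e0.
rewrite add0r.
have l0 := contour_length_ge0 G.
have K0 : 0 < 2 * contour_length G + 1 by rewrite ltr_wpDl// mulr_ge0.
have [s [sQ hs]] := cauchy_transform_approx r0 (divr_gt0 e0 K0) cfQ far.
have [|cs is0] := @fractions_int G s cG; first by move=> x /sQ/QO[].
have -> : contour_integral G F = contour_integral G
    (fun z => F z + -1 * \sum_(x <- s) x.1 * (x.2 - z)^-1).
  rewrite contour_integralD//; last by move=> z zG; apply/ccontZ/cs.
  by rewrite contour_integralZ// is0 mulr0 addr0.
apply: (@le_trans _ _ (2 * (e / (2 * contour_length G + 1)) * contour_length G)).
  apply: contour_integral_bound => z zG.
    by apply: ccontD; [exact: cF|apply/ccontZ/cs].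
  by rewrite mulN1r; exact: hs.
rewrite (_ : 2 * _ * _ = e * (2 * contour_length G) / (2 * contour_length G + 1)).
  by rewrite ler_pdivrMr// ler_wpM2l ?(ltW e0)// lerDl.
by field; rewrite gt_eqF.
Qed.

End homology_theorem.

(** * Resolvents and the functional calculus *)

Section resolvents.
Variables (R : realType) (H : hilbertType R).
Local Notation C := R[i].
Implicit Types (T S A : H -> H) (z w : C).

(** The Neumann series, as the limit of u_(n+1) = x + A u_n. *)
Lemma neumann A (q : R) : linear A -> 0 <= q -> q < 1 ->
  (forall x, rnorm (A x) <= q * rnorm x) ->
  exists N : H -> H, [/\ linear N, forall x, N x - A (N x) = x,
    forall x, N (x - A x) = x & forall x, rnorm (N x) <= (1 - q)^-1 * rnorm x].
Proof.
move=> linA q0 q1 hA.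
have p0 : 0 < 1 - q by rewrite subr_gt0.
pose u := fix u (x : H) n : H := if n is k.+1 then x + A (u x k) else 0.
have ub x k : rnorm (u x k) <= (1 - q)^-1 * rnorm x.
  elim: k => [|k ih]; first by rewrite /= rnorm0 mulr_ge0 ?rnorm_ge0 ?invr_ge0 ?ltW.
  rewrite (le_trans (rnormD _ _))// (le_trans (lerD (lexx _) (hA _)))//.
  have -> : (1 - q)^-1 * rnorm x = rnorm x + q * ((1 - q)^-1 * rnorm x).
    by field; rewrite gt_eqF.
  by rewrite lerD2l ler_wpM2l.
have uc x n k : rnorm (u x (k + n)%N - u x n) <= q ^+ n * ((1 - q)^-1 * rnorm x).
  elim: n => [|n ih]; first by rewrite addn0 expr0 mul1r subr0.
  rewrite addnS /= opprD addrACA subrr add0r -(linear_opB linA).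
  by rewrite (le_trans (hA _))// exprS -mulrA ler_wpM2l.
have qn (x : H) : (fun n => q ^+ n * ((1 - q)^-1 * rnorm x)) @ \oo --> (0 : R).
  rewrite -(mul0r ((1 - q)^-1 * rnorm x)); apply: cvgMr_tmp.
  by apply: cvg_expr; rewrite ger0_norm.
have /choice[N hN] x : exists l, forall n, rnorm (u x n - l) <=
    q ^+ n * ((1 - q)^-1 * rnorm x).
  apply: (@rnorm_complete R H (u x) (fun n => q ^+ n * ((1 - q)^-1 * rnorm x)) _ (qn x)) => n k /subnK <-; exact: uc.
have small (a M : R) (x : H) : (forall n, a <= M * (q ^+ n * ((1 - q)^-1 * rnorm x))) -> a <= 0.
  move=> h; apply/ler_addgt0Pr => e e0; rewrite add0r.
  have M0 : 0 < `|M| + 1 by rewrite ltr_wpDl.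
  have /cvgrPdist_lt/(_ _ (divr_gt0 e0 M0))[n _ /(_ n (leqnn n))] := qn x.
  rewrite /= sub0r normrN => hn; rewrite (le_trans (h n))//.
  rewrite (le_trans (ler_norm _))// normrM ltW//.
  move: hn; rewrite ltr_pdivlMr//.
  have := normr_ge0 (q ^+ n * ((1 - q)^-1 * rnorm x)); nra.
have NE x : N x - A (N x) = x.
  apply/eqP; rewrite -subr_eq0; apply/eqP/rnorm_eq0.
  apply/eqP; rewrite eq_le rnorm_ge0 andbT; apply: (small _ 2 x) => n.
  have -> : N x - A (N x) - x = - (u x n.+1 - N x) + A (u x n - N x).
    rewrite (linear_opB linA) /= opprB opprD !addrA.
    by rewrite [RHS](ACl (1*5*2*(3*4))%AC)/= addNr addr0.
  have h1 := hN x n; have h2 := hN x n.+1; have h3 := hA (u x n - N x).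
  rewrite (le_trans (rnormD _ _))// rnormN.
  have P0 : 0 <= q ^+ n * ((1 - q)^-1 * rnorm x).
    by rewrite !mulr_ge0 ?exprn_ge0 ?invr_ge0 ?rnorm_ge0// ltW.
  rewrite exprS -mulrA in h2; move: (q ^+ n * _) P0 h1 h2 => t t0 h1 h2.
  have := ler_wpM2l q0 h1; have := ler_piMl t0 (ltW q1); lra.
have inj x y : x - A x = y - A y -> x = y.
  move=> E; apply/eqP; rewrite -subr_eq0; apply/eqP/rnorm_eq0.
  have E2 : x - y = A (x - y).
    rewrite (linear_opB linA); apply/eqP; rewrite -subr_eq0; apply/eqP.
    transitivity ((x - A x) - (y - A y)); last by rewrite E subrr.
    by rewrite !opprD addrACA.
  have := hA (x - y); rewrite -E2; have := rnorm_ge0 (x - y).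
  by move=> h1 h2; apply/eqP; rewrite eq_le h1 andbT; nra.
exists N; split=> //.
- move=> a x y; apply: inj; rewrite NE linA opprD addrACA -scalerBr !NE.
  by [].
- by move=> x; apply: inj; rewrite NE.
- move=> x; apply/ler_addgt0Pr => e e0.
  have := hN x 0%N; rewrite /= sub0r rnormN expr0 mul1r; lra.
Qed.

Section fixed_operator.
Variable T : H -> H.
Local Notation R_ := (resolvent T).

Lemma resolventP z : ~ spectrum T z -> [/\ linear (R_ z),
  exists2 M, 0 < M & forall x, rnorm (R_ z x) <= M * rnorm x,
  forall x, R_ z (z *: x - T x) = x & forall x, z *: R_ z x - T (R_ z x) = x].
Proof.
move=> /contrapT Tz.
have [bS h1 h2] : [set S | inverse_op (z *: id - T) S] (R_ z).
  by apply: (@xgetPex _ (0 : H -> H)).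
have [linS [M M0 hM]] := (bounded_opP _).1 bS.
split=> // [|x|x].
- exists (M + 1); first by rewrite ltr_wpDl.
  move=> x; rewrite (le_trans (hM x))// ler_wpM2r ?rnorm_ge0// lerDl.
  by [].
- exact: (f_equal (fun g => g x) h1).
- exact: (f_equal (fun g => g x) h2).
Qed.

Lemma resolvent_of_inverse z (S : H -> H) (M : R) : 0 <= M -> linear S ->
  (forall x, rnorm (S x) <= M * rnorm x) ->
  (forall x, S (z *: x - T x) = x) -> (forall x, z *: S x - T (S x) = x) ->
  ~ spectrum T z /\ R_ z = S.
Proof.
move=> M0 linS hS h1 h2.
have nz : ~ spectrum T z.
  apply; exists S; split; [|exact/funext|exact/funext].
  by apply/bounded_opP; split => //; exists M.
split=> //; have [_ _ r1 r2] := resolventP nz.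
by apply/funext => x; rewrite -[in RHS](r2 x) h1.
Qed.

(** Neumann's series applies in w - T = (1 - (z - w) R(z)) (z - T). *)
Lemma resolvent_near z (M : R) : ~ spectrum T z -> 0 < M ->
  (forall x, rnorm (R_ z x) <= M * rnorm x) ->
  forall w, rnorm (w - z) < (2 * M)^-1 -> ~ spectrum T w /\
    forall x, rnorm (R_ w x) <= 2 * M * rnorm x.
Proof.
move=> nz M0 hM w wz; have [linR _ r1 r2] := resolventP nz.
pose A x := (z - w) *: R_ z x.
have linA : linear A.
  by move=> a x y; rewrite /A linR scalerDr !scalerA mulrC.
have hA x : rnorm (A x) <= 2^-1 * rnorm x.
  rewrite /A rnormZ rnormBC (le_trans (ler_wpM2l (rnorm_ge0 _) (hM x)))//.
  rewrite mulrA ler_wpM2r ?rnorm_ge0// -ler_pdivlMr//.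
  by rewrite -invfM ltW.
have [||N [linN n1 n2 hN]] := neumann linA _ _ hA.
- by rewrite invr_ge0.
- by rewrite invf_lt1// ltr1n.
have hS x : rnorm (R_ z (N x)) <= 2 * M * rnorm x.
  rewrite (le_trans (hM _))// [2 * M]mulrC -mulrA ler_wpM2l ?(ltW M0)//.
  rewrite (le_trans (hN x))// ler_wpM2r ?rnorm_ge0//.
  by rewrite (_ : (1 - 2^-1 : R)^-1 = 2)//; field.
have wE x : w *: x - T x = (z *: x - T x) - (z - w) *: x.
  by rewrite scalerBl opprB addrAC addrCA subrr addr0.
have [] := @resolvent_of_inverse w (fun x => R_ z (N x)) (2 * M).
- by rewrite mulr_ge0// ltW.
- by move=> a x y; rewrite linN linR.
- exact: hS.
- move=> x; rewrite wE.
  have -> : (z - w) *: x = A (z *: x - T x) by rewrite /A r1.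
  by rewrite n2 r1.
- move=> x; rewrite wE r2; exact: n1.
by move=> nw ->; split.
Qed.

Lemma spectrum_closed z : ~ spectrum T z -> open_at (~` spectrum T) z.
Proof.
move=> nz; have [_ [M M0 hM] _ _] := resolventP nz.
exists (2 * M)^-1; first by rewrite invr_gt0 mulr_gt0.
by move=> w /(resolvent_near nz M0 hM)[].
Qed.

Lemma resolvent_diff z w x : ~ spectrum T z -> ~ spectrum T w ->
  R_ w x - R_ z x = (z - w) *: R_ w (R_ z x).
Proof.
move=> nz nw; have [linz _ z1 z2] := resolventP nz.
have [linw _ w1 w2] := resolventP nw.
rewrite -(linear_opZ linw) scalerBl.
rewrite -{1}[x](z2 x) -{3}[R_ z x](w1 (R_ z x)) -(linear_opB linw).
by congr (R_ w _); rewrite opprB addrA subrK.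
Qed.

(** The derivative is - (R(z) ^ 2 x, y), by two applications of the resolvent
    identity. *)
Lemma resolvent_cdiff x y z : ~ spectrum T z ->
  cdiff (fun w => hdot (R_ w x) y) z.
Proof.
move=> nz; have hS := hdot_semi H.
have [linz [M M0 hM] z1 z2] := resolventP nz.
exists (- hdot (R_ z (R_ z x)) y) => e e0.
pose K := 2 * M * (M * (M * rnorm x)) * rnorm y + 1.
have K0 : 0 < K.
  by rewrite /K ltr_wpDl// !mulr_ge0 ?rnorm_ge0// ltW.
exists (Num.min (2 * M)^-1 (e / K)).
  by rewrite lt_min invr_gt0 mulr_gt0//= divr_gt0.
move=> w; rewrite lt_min => /andP[/(resolvent_near nz M0 hM)[nw hw]].
rewrite ltr_pdivlMr// => wK.
have -> : hdot (R_ w x) y - hdot (R_ z x) y - - hdot (R_ z (R_ z x)) y * (w - z) =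
    (w - z) ^+ 2 * hdot (R_ w (R_ z (R_ z x))) y.
  have e1 := resolvent_diff x nz nw.
  have e2 := resolvent_diff (R_ z x) nz nw.
  have -> : hdot (R_ w x) y - hdot (R_ z x) y = (z - w) * hdot (R_ w (R_ z x)) y.
    by rewrite -(sdotNl hS) -(sdotDl hS) e1 (sdotZl hS).
  have -> : hdot (R_ w (R_ z x)) y = hdot (R_ z (R_ z x)) y +
      (z - w) * hdot (R_ w (R_ z (R_ z x))) y.
    by rewrite -(sdotZl hS) -e2 -(sdotDl hS) addrC subrK.
  by ring.
rewrite rnormM rnormX expr2 -mulrA mulrCA [e * _]mulrC ler_wpM2l ?rnorm_ge0//.
apply: (@le_trans _ _ (rnorm (w - z) * K)); last exact: ltW.
rewrite ler_wpM2l ?rnorm_ge0// /K.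
rewrite (le_trans (cauchy_schwarz _ _))//.
rewrite (@le_trans _ _ (2 * M * (M * (M * rnorm x)) * rnorm y)) ?lerDl//.
rewrite ler_wpM2r ?rnorm_ge0// (le_trans (hw _))//.
rewrite ler_wpM2l ?mulr_ge0 ?(ltW M0)// (le_trans (hM _))//.
by rewrite ler_wpM2l ?(ltW M0).
Qed.

Lemma resolvent_contour_bound (G : seq (C * C)) :
  on_contour G (fun z => ~ spectrum T z) ->
  exists2 M, 0 < M & on_contour G (fun z => forall x, rnorm (R_ z x) <= M * rnorm x).
Proof.
move=> nG; apply: (@on_contour_uniform R
  (fun M z => forall x, rnorm (R_ z x) <= M * rnorm x)).
  by move=> M M' z MM h x; rewrite (le_trans (h x))// ler_wpM2r ?rnorm_ge0.
move=> z /nG nz; have [_ [M M0 hM] _ _] := resolventP nz.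
exists (2 * M)^-1; first by rewrite invr_gt0 mulr_gt0.
by exists (2 * M) => w /(resolvent_near nz M0 hM)[].
Qed.

End fixed_operator.

Lemma resolvent_outside T z : contraction_op T -> 1 < rnorm z ->
  ~ spectrum T z /\
  forall x, rnorm (resolvent T z x) <= (rnorm z - 1)^-1 * rnorm x.
Proof.
move=> /contraction_opP[linT nT] z1.
have z0 : 0 < rnorm z by apply: lt_trans z1.
have zN : z != 0 by apply: contraTneq z0 => ->; rewrite rnorm0 ltxx.
pose A x := z^-1 *: T x.
have linA : linear A by move=> a x y; rewrite /A linT scalerDr !scalerA mulrC.
have hA x : rnorm (A x) <= (rnorm z)^-1 * rnorm x.
  by rewrite /A rnormZ rnormV ler_wpM2l ?invr_ge0 ?rnorm_ge0.
have [||N [linN n1 n2 hN]] := neumann linA _ _ hA.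
- by rewrite invr_ge0 rnorm_ge0.
- by rewrite invf_lt1.
have p0 : 0 < rnorm z - 1 by rewrite subr_gt0.
have hS x : rnorm (z^-1 *: N x) <= (rnorm z - 1)^-1 * rnorm x.
  rewrite rnormZ rnormV (le_trans (ler_wpM2l _ (hN x))) ?invr_ge0 ?rnorm_ge0//.
  rewrite mulrA le_eqVlt; apply/orP; left; apply/eqP; congr (_ * _).
  by field; rewrite !gt_eqF.
have [] := @resolvent_of_inverse T z (fun x => z^-1 *: N x) (rnorm z - 1)^-1.
- by rewrite invr_ge0 ltW.
- by move=> a x y; rewrite linN scalerDr !scalerA mulrC.
- exact: hS.
- move=> x; have -> : z *: x - T x = z *: (x - A x).
    by rewrite scalerBr /A scalerA divff// scale1r.
  by rewrite (linear_opZ linN) scalerA mulVf// scale1r n2.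
- move=> x; rewrite scalerA divff// scale1r (linear_opZ linT).
  exact: n1.
by move=> nz ->; split.
Qed.

Lemma spectrum_contraction T z : contraction_op T -> spectrum T z -> rnorm z <= 1.
Proof.
by move=> cT zT; rewrite leNgt; apply/negP => /(resolvent_outside cT)[].
Qed.

Lemma open_open_at (O : set R[i]^o) (z : R[i]) : open O -> O z -> open_at O z.
Proof. by move=> oO Oz; apply/(@rnorm_nbhsP R (R[i]^o) z O); exact: open_nbhs_nbhs. Qed.

Lemma surroundsP (G : seq (C * C)) (K O : set C) : surrounds G K O ->
  [/\ closed_contour G, on_contour G (fun z => O z /\ ~ K z),
    forall a, K a -> index_int G a = two_pi_i &
    forall a, ~ O a -> index_int G a = 0].
Proof.
move=> [cG GO GK iO]; split=> // a.
  move=> /GK; rewrite winding_numberE => h.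
  by rewrite -[LHS](mulVKf (two_pi_i_neq0 R)) h mulr1.
move=> /iO; rewrite winding_numberE => h.
by rewrite -[LHS](mulVKf (two_pi_i_neq0 R)) h mulr0.
Qed.

Definition calculus_form (f : C -> C) T (G : seq (C * C)) x y : C :=
  two_pi_i^-1 * contour_integral G (fun z => f z * hdot (resolvent T z x) y).

Lemma calculus_kernel_ccont f T G x y : on_contour G (ccont f) ->
  on_contour G (fun z => ~ spectrum T z) ->
  on_contour G (ccont (fun z => f z * hdot (resolvent T z x) y)).
Proof.
move=> cf nG z zG; apply: ccontM; first exact: cf.
exact/cdiff_ccont/resolvent_cdiff/nG.
Qed.

Lemma calculus_exists f T G : on_contour G (ccont f) ->
  on_contour G (fun z => ~ spectrum T z) ->
  exists F : H -> H, bounded_op F /\ forall x y, hdot (F x) y = calculus_form f T G x y.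
Proof.
move=> cf nG; have hS := hdot_semi H.
have [Mf Mf0 hf] := ccont_contour_bounded cf.
have [Mr Mr0 hr] := resolvent_contour_bound nG.
pose M := rnorm (two_pi_i^-1 : C) * (2 * (Mf * Mr) * contour_length G).
have M0 : 0 <= M.
  by rewrite !mulr_ge0 ?rnorm_ge0 ?contour_length_ge0 ?(ltW Mf0) ?(ltW Mr0).
have ck x y := @calculus_kernel_ccont f T G x y cf nG.
have lr z x y a : contour_support G z ->
    resolvent T z (a *: x + y) = a *: resolvent T z x + resolvent T z y.
  by move=> /nG nz; have [linR _ _ _] := resolventP nz; exact: linR.
have fl a x x' y : calculus_form f T G (a *: x + x') y =
    a * calculus_form f T G x y + calculus_form f T G x' y.
  rewrite /calculus_form mulrCA -mulrDr -(contour_integralZ a (ck x y)).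
  rewrite -contour_integralD//; last by move=> z zG; apply/ccontZ/ck.
  congr (_ * _); apply: eq_contour_integral => z zG.
  by rewrite lr// (sdotDl hS) (sdotZl hS); ring.
have fr a x y y' : calculus_form f T G x (a *: y + y') =
    conjc a * calculus_form f T G x y + calculus_form f T G x y'.
  rewrite /calculus_form mulrCA -mulrDr -(contour_integralZ (conjc a) (ck x y)).
  rewrite -contour_integralD//; last by move=> z zG; apply/ccontZ/ck.
  congr (_ * _); apply: eq_contour_integral => z zG.
  by rewrite (sdotDr hS) (sdotZr hS); ring.
have fb x y : rnorm (calculus_form f T G x y) <= M * rnorm x * rnorm y.
  rewrite /calculus_form rnormM /M -!mulrA ler_wpM2l ?rnorm_ge0//.
  have -> : 2 * (Mf * (Mr * (contour_length G * (rnorm x * rnorm y)))) =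
    2 * (Mf * (Mr * rnorm x * rnorm y)) * contour_length G by ring.
  apply: contour_integral_bound => // z zG.
  rewrite rnormM ler_pM ?rnorm_ge0 ?hf//.
  rewrite (le_trans (cauchy_schwarz _ _))// ler_wpM2r ?rnorm_ge0//.
  exact: hr.
have [F [linF hF FE]] : exists F : H -> H, [/\ linear F,
    forall x, rnorm (F x) <= M * rnorm x &
    forall y x, conjc (calculus_form f T G x y) = hdot (id y) (F x)].
  apply: (@riesz_factor R H H H id (fun y x => conjc (calculus_form f T G x y))).
  - by [].
  - by move=> x a y z; rewrite fr rmorphD rmorphM/= conjcK.
  - by move=> y a x z; rewrite fl rmorphD rmorphM.
  - by move=> x; rewrite mulr_ge0 ?rnorm_ge0.
  - by move=> y x; rewrite rnorm_conj mulrC.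
exists F; split; first by apply/bounded_opP; split => //; exists M.
by move=> x y; rewrite (semi_dotC hS) -FE conjcK.
Qed.

(** There is something to select: the grid construction gives a contour around the
    spectrum, and Riesz representation an operator with the form that the contour
    defines. *)
Lemma hfcalcP f T (U : set R[i]^o) : contraction_op T -> open U ->
  spectrum T `<=` U -> holomorphic_on U f ->
  bounded_op (hfcalc f T) /\ exists (A : set R[i]^o) (G : seq (C * C)),
    [/\ open A, holomorphic_on A f, surrounds G (spectrum T) A &
    forall x y, hdot (hfcalc f T x) y = calculus_form f T G x y].
Proof.
move=> cT oU sU hfU.
pose P F := bounded_op F /\
    exists (A : set R[i]^o) (G : seq (R[i] * R[i])),
      [/\ open A, spectrum T `<=` A, holomorphic_on A f,
          surrounds G (spectrum T) A &
          forall x y, hdot (F x) y =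
            two_pi_i^-1 *
            contour_integral G (fun z => f z * hdot (resolvent T z x) y)].
suff : P (hfcalc f T).
  by move=> [bF [A [G [h1 h2 h3 h4 h5]]]]; split => //; exists A, G.
apply: (@xgetPex _ (0 : H -> H) [set F | P F]).
have df z : U z -> cdiff f z by move=> /hfU/derivable_cdiff.
have [d d0 hd] : exists2 d, 0 < d & forall z w, spectrum T z ->
    rnorm (w - z) < d -> U w.
  apply: (@compact_room R (spectrum T) U 1 ltr01).
  - by move=> z /(spectrum_contraction cT).
  - by move=> z; exact: spectrum_closed.
  - by move=> z /sU; exact: open_open_at.
have [G [cG GU Gf G0]] := @contour_surround R (spectrum T) U 1 d ltr01 d0
  (fun z => @spectrum_contraction T z cT) hd.
have [F [bF FE]] : exists F : H -> H, bounded_op F /\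
    forall x y, hdot (F x) y = calculus_form f T G x y.
  apply: calculus_exists => //.
    by move=> z /GU[/df/cdiff_ccont].
  by move=> z /GU[].
exists F; split => //; exists U, G; split => //.
split=> // a.
- move=> Ka; rewrite winding_numberE.
  have := Gf (fun=> 1) a (fun w _ => ex_intro _ 0 (cderiv_cst 1 w)) Ka.
  rewrite (_ : contour_integral _ _ = index_int G a) => [->|].
    by rewrite mulr1 mulVf// two_pi_i_neq0.
  by congr contour_integral; apply/funext => w; rewrite mul1r.
- move=> Ua; rewrite winding_numberE /index_int G0 ?mulr0//.
  by move=> w Uw; apply: cdiff_inv_sub; apply/eqP => wa; apply: Ua; rewrite -wa.
Qed.

End resolvents.

(** * Dilates of the symbol *)

Section dilation.
Variables (R : realType) (H : hilbertType R).
Local Notation C := R[i].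
Variable f : C -> C.
Hypothesis f_disk : forall z, rnorm z < 1 -> cdiff f z.

Lemma ccont_dilate_uniform (G : seq (C * C)) (e : R) : 0 < e ->
  on_contour G (ccont f) -> exists2 d, 0 < d & forall r, 1 - d < r -> r < 1 ->
  on_contour G (fun z => rnorm (f (r%:C * z) - f z) <= e).
Proof.
move=> e0 cf.
have [||M M0 hM] := @on_contour_uniform R (fun M z => 0 < M /\ forall r,
    1 - M^-1 < r -> r < 1 -> rnorm (f (r%:C * z) - f z) <= e) _ G.
- move=> M M' z MM [M0 h]; have M'0 := lt_le_trans M0 MM; split=> // r r1 r2.
  apply: h => //; apply: le_lt_trans r1; rewrite lerD2l lerN2.
  by rewrite lef_pV2.
- move=> z zG; have e2 : 0 < e / 2 by rewrite divr_gt0.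
  have [d d0 hd] := cf z zG _ e2.
  have K0 : 0 < rnorm z + 1 by rewrite ltr_wpDl// rnorm_ge0.
  exists (Num.min (d / 2) 1); first by rewrite lt_min divr_gt0/=.
  exists (2 * (rnorm z + 1) / d) => w; rewrite lt_min => /andP[w1 w2].
  split=> [|r]; first by rewrite divr_gt0// mulr_gt0.
  rewrite invf_div => r1 r2.
  have wz : rnorm (w - z) < d by lra.
  have rwz : rnorm (r%:C * w - z) < d.
    have -> : r%:C * w - z = (w - z) - (1 - r)%:C * w.
      by rewrite rmorphB/= rmorph1; ring.
    apply: (le_lt_trans (rnormB _ _)); rewrite rnormM rnormc ger0_norm; last lra.
    have w3 : rnorm w <= rnorm z + 1 by have := rnorm_lowerB w z; lra.
    have w4 : (1 - r) * rnorm w <= (1 - r) * (rnorm z + 1) by rewrite ler_wpM2l//; lra.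
    have w5 : (1 - r) * (rnorm z + 1) < d / 2.
      rewrite -ltr_pdivlMr//; apply: (@lt_le_trans _ _ (d / (2 * (rnorm z + 1)))).
        lra.
      by rewrite invfM mulrA.
    lra.
  have := rnormDist (f z) (f (r%:C * w)) (f w).
  have := hd _ rwz; have := hd _ wz; rewrite (rnormBC (f w)); lra.
- exists M^-1; first by rewrite invr_gt0.
  by move=> r r1 r2 z /hM[_]; apply.
Qed.

(** On G the dilates f (r z) tend uniformly to f as r tends to 1.  For r close to 1
    the dilate is holomorphic near the hull of G as well as in the disk of radius
    1 / r, so the homology form of Cauchy's theorem moves its integral from G,
    which may be arbitrary, to a contour Q around the closed unit disk. *)
Lemma calculus_dilate (T : H -> H) (A : set R[i]^o) (G : seq (C * C)) x y (e : R) :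
  contraction_op T -> open A -> (forall z, A z -> cdiff f z) ->
  surrounds G (spectrum T) A -> 0 < e ->
  exists2 d, 0 < d & forall r, 0 < r -> 1 - d < r -> r < 1 ->
  forall Q, closed_contour Q ->
    on_contour Q (fun z => 1 < rnorm z /\ r * rnorm z < 1) ->
    (forall a, rnorm a <= 1 -> index_int Q a = two_pi_i) ->
    (forall a, ~ r * rnorm a < 1 -> index_int Q a = 0) ->
  rnorm (calculus_form f T G x y -
    calculus_form (fun z => f (r%:C * z)) T Q x y) <= e.
Proof.
move=> cT oA df /surroundsP[cG GA iK iA] e0.
have GO : on_contour G A by move=> z /GA[].
have nG : on_contour G (fun z => ~ spectrum T z) by move=> z /GA[].
have cf : on_contour G (ccont f) by move=> z /GO/df/cdiff_ccont.
have [Mr Mr0 hr] := resolvent_contour_bound nG.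
pose B := rnorm (two_pi_i^-1 : C) * (2 * (Mr * rnorm x * rnorm y) * contour_length G) + 1.
have B0 : 0 < B.
  rewrite ltr_wpDl// !mulr_ge0 ?rnorm_ge0 ?contour_length_ge0//; exact: ltW.
have [d1 d10 h1] := ccont_dilate_uniform (divr_gt0 e0 B0) cf.
have [L L0 hL] := contour_hull_bounded cG.
have [d2 d20 h2] := contour_hull_room cG (fun z => @open_open_at R A z oA) GO iA.
exists (Num.min d1 (d2 / L)); first by rewrite lt_min d10 divr_gt0.
move=> r r0 rd r1 Q cQ hQ iQ1 iQ0.
have /andP[rd1 rd2] : (1 - d1 < r) && (1 - d2 / L < r).
  by rewrite !ltrBlDr -!ltrBlDl -lt_min; lra.
pose fr z := f (r%:C * z).
have rz z : rnorm (r%:C * z) = r * rnorm z by rewrite rnormM rnormc gtr0_norm.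
pose Ar : set C := [set z | A (r%:C * z)].
have hullA z : contour_hull G z -> Ar z.
  move=> zh; apply: (h2 z) => //.
  rewrite (_ : _ - _ = - ((1 - r)%:C * z)); last by rewrite rmorphB/= rmorph1; ring.
  rewrite rnormN rnormM rnormc ger0_norm; last lra.
  apply: (@le_lt_trans _ _ ((1 - r) * L)); first by rewrite ler_wpM2l ?hL//; lra.
  by rewrite -ltr_pdivlMr//; lra.
have dfr z : Ar z \/ r * rnorm z < 1 -> cdiff fr z.
  move=> hz; have [l hl] : cdiff f (r%:C * z).
    by case: hz => [/df//|hz]; apply: f_disk; rewrite rz.
  by eexists; exact: cderiv_dilate hl.
pose O : set C := [set z | (Ar z \/ r * rnorm z < 1) /\ ~ spectrum T z].
pose h z := fr z * hdot (resolvent T z x) y.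
have dh z : O z -> cdiff h z.
  by move=> [z1 z2]; apply: cdiffM; [exact: dfr|exact: resolvent_cdiff].
have oO z : O z -> open_at O z.
  move=> [z1 /spectrum_closed[e3 e30 he3]].
  have [e4 e40 he4] : exists2 e4, 0 < e4 & forall w, rnorm (w - z) < e4 ->
      Ar w \/ r * rnorm w < 1.
    case: z1 => [z1|z1].
      have [e5 e50 he5] := open_open_at oA z1; exists (e5 / r).
        by rewrite divr_gt0.
      move=> w; rewrite ltr_pdivlMr// mulrC => wz; left; apply: he5.
      by rewrite -mulrBr rz.
    exists ((1 - r * rnorm z) / r); first by rewrite divr_gt0// subr_gt0.
    move=> w; rewrite ltr_pdivlMr// => wz; right.
    have := rnorm_lowerB w z; nra.
  exists (Num.min e3 e4); first by rewrite lt_min e30.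
  by move=> w; rewrite lt_min => /andP[/he3 w1 /he4 w2].
have QO : on_contour Q O.
  move=> z /hQ[z1 z2]; split; first by right.
  by have [] := resolvent_outside cT z1.
have GOO : on_contour G O.
  by move=> z zG; split; [left; apply: hullA; left|exact: nG].
have inv_c S a : on_contour S O -> ~ O a -> on_contour S (ccont (fun w => (w - a)^-1)).
  move=> SO aO w /SO wO; apply: ccont_inv_sub; apply/eqP => wa.
  by apply: aO; rewrite -wa.
have ch S : on_contour S O -> on_contour S (ccont h).
  by move=> SO w /SO/dh/cdiff_ccont.
have E0 : contour_integral (G ++ rev_contour Q) h = 0.
  apply: (cauchy_homology oO _ _ _ dh).
  - by apply: closed_contour_cat => //; exact: closed_contour_rev.
  - by apply: on_contour_cat => //; exact: on_contour_rev.
  move=> a aO; rewrite /index_int contour_integral_cat.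
  rewrite contour_integral_rev -/(index_int G a) -/(index_int Q a); last exact: inv_c.
  have [aT|aT] := pselect (spectrum T a).
    by rewrite iK// iQ1 ?subrr//; exact: spectrum_contraction aT.
  have [aA aR] : ~ Ar a /\ ~ r * rnorm a < 1.
    by split=> h3; apply: aO; split => //; [left|right].
  rewrite iQ0// subr0; apply: contrapT => ia; apply: aA; apply: hullA.
  by right.
have EQ : contour_integral G h = contour_integral Q h.
  move: E0; rewrite contour_integral_cat contour_integral_rev; last exact: ch.
  by move=> /eqP; rewrite subr_eq0 => /eqP.
rewrite /calculus_form -/fr -/h -EQ -mulrBr.
have cF := @calculus_kernel_ccont R H f T G x y cf nG.
have cH := ch G GOO.
have -> : contour_integral G (fun z => f z * hdot (resolvent T z x) y) -
    contour_integral G h = contour_integral G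
    (fun z => f z * hdot (resolvent T z x) y + -1 * h z).
  rewrite contour_integralD//; last by move=> z zG; apply/ccontZ/cH.
  by rewrite contour_integralZ// mulN1r.
apply: (@le_trans _ _ (rnorm (two_pi_i^-1 : C) *
    (2 * (e / B * (Mr * rnorm x * rnorm y)) * contour_length G))).
  rewrite rnormM ler_wpM2l ?rnorm_ge0//; apply: contour_integral_bound => z zG.
    by apply: ccontD; [exact: cF|apply/ccontZ/cH].
  rewrite mulN1r /h -mulrBl rnormM ler_pM ?rnorm_ge0//.
    by rewrite rnormBC; exact: h1.
  rewrite (le_trans (cauchy_schwarz _ _))// ler_wpM2r ?rnorm_ge0//.
  exact: hr.
rewrite (_ : _ * (2 * _ * _) = e * (B - 1) / B).
  by rewrite ler_pdivrMr// ler_wpM2l ?(ltW e0)//; lra.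
by rewrite /B; field; rewrite -/B gt_eqF.
Qed.

End dilation.

(** * Taylor polynomials of the dilates *)

Section expansions.
Variable R : realType.
Local Notation C := R[i].

Lemma ccont_invX (z : C) k : z != 0 -> ccont (fun w => w^-1 ^+ k) z.
Proof.
move=> z0; have ci : ccont (fun w : C => w^-1) z.
  apply/cdiff_ccont; apply: (@cdiffV _ id) => //.
  by exists 1; exact: cderiv_id.
elim: k => [|k ih]; first exact: ccont_cst.
have -> : (fun w : C => w^-1 ^+ k.+1) = fun w => w^-1 * w^-1 ^+ k.
  by apply/funext => w; rewrite exprS.
exact: ccontM.
Qed.

Definition power_coef (Q : seq (C * C)) (g : C -> C) k : C :=
  two_pi_i^-1 * contour_integral Q (fun z => g z * z^-1 ^+ k.+1).

(** Used twice with the same coefficients: the Cauchy kernel yields the Taylor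
    expansion of g, and the matrix coefficients of the resolvent of T yield the
    expansion of g(T) in powers of T. *)
Lemma power_expansion (Q : seq (C * C)) (g kappa : C -> C) (a : nat -> C) (B q : R) n :
  on_contour Q (fun z => z != 0) -> on_contour Q (ccont g) ->
  on_contour Q (ccont kappa) ->
  on_contour Q (fun z => rnorm (g z) <= 1) ->
  on_contour Q (fun z => rnorm (kappa z - \sum_(k < n) a k * z^-1 ^+ k.+1) <=
    B * q ^+ n) ->
  rnorm (two_pi_i^-1 * contour_integral Q (fun z => g z * kappa z) -
    \sum_(k < n) power_coef Q g k * a k) <=
  rnorm (two_pi_i^-1 : C) * (2 * (B * q ^+ n) * contour_length Q).
Proof.
move=> Q0 cg ck g1 hB.
have ci k : on_contour Q (ccont (fun z => g z * z^-1 ^+ k.+1)).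
  by move=> z zQ; apply: ccontM; [exact: cg|apply/ccont_invX/Q0].
have cai k : on_contour Q (ccont (fun z => a k * (g z * z^-1 ^+ k.+1))).
  by move=> z zQ; apply/ccontZ/ci.
have -> : \sum_(k < n) power_coef Q g k * a k = two_pi_i^-1 *
    contour_integral Q (fun z => \sum_(k < n) a k * (g z * z^-1 ^+ k.+1)).
  rewrite (@contour_integral_sum R Q n (fun k z => a k * (g z * z^-1 ^+ k.+1)))//.
  rewrite mulr_sumr; apply: eq_bigr => k _.
  by rewrite /power_coef contour_integralZ//; ring.
have cs : on_contour Q (ccont (fun z => \sum_(k < n) a k * (g z * z^-1 ^+ k.+1))).
  move=> z zQ; elim: n {hB} => [|n ih].
    have -> : (fun z : C => \sum_(k < 0) a k * (g z * z^-1 ^+ k.+1)) = fun=> 0.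
      by apply/funext => w; rewrite big_ord0.
    exact: ccont_cst.
  have -> : (fun z : C => \sum_(k < n.+1) a k * (g z * z^-1 ^+ k.+1)) = fun z =>
      \sum_(k < n) a k * (g z * z^-1 ^+ k.+1) + a n * (g z * z^-1 ^+ n.+1).
    by apply/funext => w; rewrite big_ord_recr.
  by apply: ccontD => //; exact: cai.
have cgk : on_contour Q (ccont (fun z => g z * kappa z)).
  by move=> z zQ; apply: ccontM; [exact: cg|exact: ck].
rewrite -mulrBr rnormM ler_wpM2l ?rnorm_ge0//.
rewrite -[- contour_integral _ _]mulN1r -contour_integralZ// -contour_integralD//;
  last by move=> z zQ; apply/ccontZ/cs.
apply: contour_integral_bound => z zQ.
  by apply: ccontD; [exact: cgk|apply/ccontZ/cs].
have -> : g z * kappa z + -1 * \sum_(k < n) a k * (g z * z^-1 ^+ k.+1) =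
    g z * (kappa z - \sum_(k < n) a k * z^-1 ^+ k.+1).
  rewrite mulrBr mulN1r; congr (_ - _); rewrite mulr_sumr; apply: eq_bigr => k _.
  by ring.
rewrite rnormM -[leRHS]mul1r ler_pM ?rnorm_ge0//; [exact: g1|exact: hB].
Qed.

Lemma cauchy_kernel_expansion (z w : C) n : w != 0 -> w != z ->
  (w - z)^-1 - \sum_(k < n) z ^+ k * w^-1 ^+ k.+1 =
  (z * w^-1) ^+ n * (w - z)^-1.
Proof.
move=> w0 wz; have wz0 : w - z != 0 by rewrite subr_eq0.
elim: n => [|n ih]; first by rewrite big_ord0 subr0 expr0 mul1r.
rewrite big_ord_recr/= opprD addrA ih !exprMn !exprS.
move: (z ^+ n) (w^-1 ^+ n) => p q.
by field; rewrite wz0 w0.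
Qed.

Lemma resolvent_expansion (H : hilbertType R) (T : H -> H) (w : C) x n :
  contraction_op T -> 1 < rnorm w ->
  resolvent T w x = \sum_(k < n) w^-1 ^+ k.+1 *: iter k T x +
    w^-1 ^+ n *: resolvent T w (iter n T x).
Proof.
move=> cT w1; have [nw _] := resolvent_outside cT w1.
have [linR _ r1 r2] := resolventP nw.
have w0 : w != 0.
  by apply: contraTneq w1 => ->; rewrite rnorm0 ltNge ler01.
elim: n => [|n ih]; first by rewrite big_ord0 expr0 scale1r add0r.
rewrite big_ord_recr/= [LHS]ih -addrA; congr (_ + _).
rewrite exprSr -!scalerA -scalerDr; congr (_ *: _).
set u := iter n T x; rewrite -scalerDr.
have -> : u + resolvent T w (T u) = w *: resolvent T w u.
  rewrite -[X in X + _]r1 -(linear_opZ linR) -(linear_opD linR).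
  by rewrite subrK.
by rewrite scalerA mulVf// scale1r.
Qed.

Lemma resolvent_kernel_bound (H : hilbertType R) (T : H -> H) (w : C) x y n (s : R) :
  contraction_op T -> 1 < s -> s <= rnorm w ->
  rnorm (hdot (resolvent T w x) y -
    \sum_(k < n) hdot (iter k T x) y * w^-1 ^+ k.+1) <=
  (s - 1)^-1 * rnorm x * rnorm y * s^-1 ^+ n.
Proof.
move=> cT s1 sw; have w1 : 1 < rnorm w by exact: lt_le_trans sw.
have hS := hdot_semi H; have [linT nT] := (contraction_opP _).1 cT.
have [nw hw] := resolvent_outside cT w1.
rewrite (resolvent_expansion x n cT w1) (sdotDl hS) (sdot_suml hS).
have -> : \sum_(k < n) hdot (w^-1 ^+ k.+1 *: iter k T x) y =
    \sum_(k < n) hdot (iter k T x) y * w^-1 ^+ k.+1.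
  by apply: eq_bigr => k _; rewrite (sdotZl hS) mulrC.
rewrite addrAC subrr add0r (sdotZl hS) rnormM rnormX rnormV mulrC.
have Tn : rnorm (iter n T x) <= rnorm x.
  by elim: n => [|n ih]//=; rewrite (le_trans (nT _)).
have i1 : (rnorm w)^-1 <= s^-1 by rewrite lef_pV2 ?posrE ?(lt_trans ltr01).
rewrite ler_pM ?rnorm_ge0 ?exprn_ge0 ?invr_ge0 ?rnorm_ge0//; last first.
  by rewrite lerXn2r ?nnegrE ?invr_ge0 ?rnorm_ge0 ?(le_trans ler01 (ltW s1)).
rewrite (le_trans (cauchy_schwarz _ _))// ler_wpM2r ?rnorm_ge0//.
rewrite (le_trans (hw _))// ler_pM ?invr_ge0 ?rnorm_ge0 ?subr_ge0 ?(ltW w1)//.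
by rewrite lef_pV2 ?posrE ?subr_gt0// lerD2r.
Qed.

End expansions.

Section polynomial_approximation.
Variable R : realType.
Local Notation C := R[i].
Variable f : C -> C.
Hypothesis f_disk : forall z, rnorm z < 1 -> cdiff f z.
Hypothesis f_bound : forall z, rnorm z < 1 -> rnorm (f z) < 1.

Lemma geometric_small (q K e : R) : 0 <= q -> q < 1 -> 0 <= K -> 0 < e ->
  exists n0, forall n, (n0 <= n)%N -> K * q ^+ n <= e.
Proof.
move=> q0 q1 K0 e0.
have c0 : (fun n => q ^+ n) @ \oo --> (0 : R) by apply: cvg_expr; rewrite ger0_norm.
have K1 : 0 < K + 1 by rewrite ltr_wpDl.
have /cvgrPdist_lt/(_ _ (divr_gt0 e0 K1))[n0 _ hn] := c0.
exists n0 => n /hn; rewrite /= sub0r normrN ger0_norm ?exprn_ge0// ltr_pdivlMr//.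
have := exprn_ge0 n q0; nra.
Qed.

(** The dilate f (r z) is holomorphic in the disk of radius 1 / r > 1.  With
    1 < s < s' < 1 / r and a contour Q outside the disk of radius s', both
    expansions converge geometrically, and |f (r z)| < 1 on the circle of radius
    s.  The contour does not depend on the operator, so that one polynomial serves
    for both diagonal blocks. *)
Lemma dilate_taylor (r : R) : 0 < r -> r < 1 ->
  exists (Q : seq (C * C)) (c : nat -> C) (s : R),
  [/\ 1 < s, closed_contour Q,
    on_contour Q (fun z => 1 < rnorm z /\ r * rnorm z < 1),
    (forall a, rnorm a <= 1 -> index_int Q a = two_pi_i) /\
    (forall a, ~ r * rnorm a < 1 -> index_int Q a = 0) &
    (forall e, 0 < e -> exists n0, forall n, (n0 <= n)%N -> forall z,
        rnorm z = s -> rnorm (\sum_(k < n) c k * z ^+ k) <= 1 + e) /\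
    (forall (H : hilbertType R) (T : H -> H) x y e, contraction_op T -> 0 < e ->
        exists n0, forall n, (n0 <= n)%N ->
        rnorm (calculus_form (fun z => f (r%:C * z)) T Q x y -
          \sum_(k < n) c k * hdot (iter k T x) y) <= e)].
Proof.
move=> r0 r1; pose g z := f (r%:C * z).
have R1 : 1 < r^-1 by rewrite invf_gt1.
pose d := (r^-1 - 1) / 3; have d0 : 0 < d by rewrite divr_gt0// subr_gt0.
have dE : r^-1 = 1 + 3 * d by rewrite /d; field; rewrite gt_eqF.
pose s := 1 + d; pose s' := 1 + 2 * d.
have s1 : 1 < s by rewrite /s; lra.
have ss : s < s' by rewrite /s /s'; lra.
have s'1 : 1 < s' by exact: lt_trans ss.
have s'0 : 0 < s' by exact: lt_trans s'1.
pose O : set C := [set z | r * rnorm z < 1].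
pose K : set C := [set z | rnorm z <= s'].
have OE z : rnorm z < r^-1 -> O z by move=> h; rewrite /O/= -ltr_pdivlMl// mulr1.
have KO z w : K z -> rnorm (w - z) < d -> O w.
  move=> zs wz; apply: OE; have := rnorm_lowerB w z.
  by move: zs; rewrite /K/= dE /s'; lra.
have [Q [cQ QO Qf Q0]] := @contour_surround R K O s' d s'0 d0 (fun z h => h) KO.
have far z : contour_support Q z -> s' < rnorm z.
  by move=> /QO[_ /negP]; rewrite -ltNge.
have dg z : O z -> cdiff g z.
  move=> Oz; have [l hl] : cdiff f (r%:C * z).
    by apply: f_disk; rewrite rnormM rnormc gtr0_norm.
  by eexists; exact: cderiv_dilate hl.
have g1 z : O z -> rnorm (g z) <= 1.
  by move=> Oz; apply/ltW/f_bound; rewrite rnormM rnormc gtr0_norm.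
have QN0 : on_contour Q (fun z => z != 0).
  by move=> z /far h; apply: contraTneq h => ->; rewrite rnorm0 ltNge ltW.
have cg : on_contour Q (ccont g) by move=> z /QO[/dg/cdiff_ccont].
have gQ1 : on_contour Q (fun z => rnorm (g z) <= 1) by move=> z /QO[/g1].
have iQ a : K a -> index_int Q a = two_pi_i.
  move=> Ka; have := Qf (fun=> 1) a (fun w _ => ex_intro _ 0 (cderiv_cst 1 w)) Ka.
  rewrite mulr1 => <-; congr contour_integral; apply/funext => w.
  by rewrite mul1r.
have s'i0 : 0 <= s'^-1 by rewrite invr_ge0 ltW.
have s'i1 : s'^-1 < 1 by rewrite invf_lt1.
have c0 : 0 <= rnorm (two_pi_i^-1 : C) by exact: rnorm_ge0.
have l0 := contour_length_ge0 Q.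
exists Q, (power_coef Q g), s; split=> //.
- by move=> z zQ; have [] := QO z zQ; have := far z zQ; split => //; lra.
- split=> a ha; first by apply: iQ; rewrite /K/=; lra.
  rewrite /index_int Q0// => w Ow; apply: cdiff_inv_sub; apply/eqP => wa.
  by apply: ha; rewrite -wa.
split.
- move=> e e0; pose q := s / s'.
  have q0 : 0 <= q by rewrite divr_ge0 ?(ltW s'0)//; lra.
  have q1 : q < 1 by rewrite /q ltr_pdivrMr// mul1r.
  pose B := (s' - s)^-1.
  have B0 : 0 <= B by rewrite invr_ge0; lra.
  pose M := rnorm (two_pi_i^-1 : C) * (2 * B * contour_length Q).
  have M0 : 0 <= M by rewrite !mulr_ge0.
  have [n0 hn0] := geometric_small q0 q1 M0 e0; exists n0 => n nn z zs.
  have zK : K z by rewrite /K/= zs ltW.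
  have zO : O z by apply: OE; rewrite zs dE /s; lra.
  have wz w : contour_support Q w -> w != z.
    by move=> /far h; apply: contraTneq h => ->; rewrite zs -leNgt ltW.
  have := @power_expansion R Q g (fun w => (w - z)^-1) (fun k => z ^+ k) B q n QN0 cg.
  move=> /(_ _ gQ1 _) h.
  have {h} : rnorm (two_pi_i^-1 * contour_integral Q (fun w => g w * (w - z)^-1) -
      \sum_(k < n) power_coef Q g k * z ^+ k) <=
      rnorm (two_pi_i^-1 : C) * (2 * (B * q ^+ n) * contour_length Q).
    apply: h => w wQ; first exact/ccont_inv_sub/wz.
    rewrite cauchy_kernel_expansion ?QN0 ?wz// rnormM rnormX rnormM !rnormV zs.
    have fw := far w wQ; have fw0 : 0 < rnorm w by apply: lt_trans fw.
    rewrite mulrC ler_pM ?invr_ge0 ?exprn_ge0 ?mulr_ge0 ?invr_ge0 ?rnorm_ge0//.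
    + by lra.
    + have := rnorm_lowerB w z; rewrite zs => h.
      by rewrite lef_pV2 ?posrE; lra.
    + have s0 : 0 <= s by lra.
      rewrite lerXn2r ?nnegrE ?mulr_ge0 ?invr_ge0 ?rnorm_ge0 ?(ltW s'0)//.
      by rewrite ler_wpM2l// lef_pV2 ?posrE// ltW.
  rewrite (Qf g z dg zK) mulKf ?two_pi_i_neq0// => h.
  have := hn0 n nn; rewrite /M => hM.
  have := g1 z zO; have := rnorm_lowerB (\sum_(k < n) power_coef Q g k * z ^+ k) (g z).
  rewrite rnormBC; move: hM h.
  have -> : rnorm (two_pi_i^-1 : C) * (2 * (B * q ^+ n) * contour_length Q) =
    rnorm (two_pi_i^-1 : C) * (2 * B * contour_length Q) * q ^+ n by ring.
  by lra.
move=> H T x y e cT e0.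
pose B := (s' - 1)^-1 * rnorm x * rnorm y.
have B0 : 0 <= B by rewrite !mulr_ge0 ?rnorm_ge0 ?invr_ge0// subr_ge0 ltW.
pose M := rnorm (two_pi_i^-1 : C) * (2 * B * contour_length Q).
have M0 : 0 <= M by do 2 apply: mulr_ge0 => //; exact: mulr_ge0.
have [n0 hn0] := geometric_small s'i0 s'i1 M0 e0; exists n0 => n nn.
have nQ : on_contour Q (fun z => ~ spectrum T z).
  by move=> z /far h; have [] := resolvent_outside cT (lt_trans s'1 h).
apply: le_trans (hn0 n nn).
have -> : M * s'^-1 ^+ n =
    rnorm (two_pi_i^-1 : C) * (2 * (B * s'^-1 ^+ n) * contour_length Q).
  by rewrite /M; ring.
apply: (@power_expansion R Q g (fun z => hdot (resolvent T z x) y)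
  (fun k => hdot (iter k T x) y) B s'^-1 n) => //.
  by move=> z /nQ nz; exact/cdiff_ccont/resolvent_cdiff.
by move=> z /far h; apply: resolvent_kernel_bound => //; exact: ltW.
Qed.

End polynomial_approximation.

(** * The block contraction and the theorem *)

Section block.
Variables (R : realType) (H1 H2 : hilbertType R).
Local Notation C := R[i].
Variables (W1 : H1 -> H1) (W2 : H2 -> H2) (V X : H2 -> H1).
Hypotheses (cW1 : contraction_op W1) (cW2 : contraction_op W2).
Hypotheses (cV : contraction_op V) (bX : bounded_op X).
Hypothesis sylv : (W1 \o X) - (X \o W2) =
  defect_op (adjoint_op W1) \o V \o defect_op W2.

Let dot (u v : H1 * H2) : C := hdot u.1 v.1 + hdot u.2 v.2.

Let hS1 := hdot_semi H1.
Let hS2 := hdot_semi H2.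

Let dot_semi : semi_dot dot.
Proof.
split=> [a u v w|u v|u]; rewrite /dot.
- by rewrite /= !(sdotDl hS1) !(sdotDl hS2) (sdotZl hS1) (sdotZl hS2); ring.
- by rewrite (semi_dotC hS1) (semi_dotC hS2) rmorphD.
- by rewrite !hdotxx -rmorphD/= addr_ge0 ?sqr_ge0.
Qed.

Let dotE u : Re (dot u u) = rnorm u.1 ^+ 2 + rnorm u.2 ^+ 2.
Proof. by rewrite /dot !hdotxx -rmorphD. Qed.

(* the upper triangular operator with diagonal W1, W2 and corner W1 X - X W2: it
   is similar to the diagonal operator through u |-> (u.1 + X u.2, u.2), and a
   contraction by the form of its corner *)
Let T (u : H1 * H2) : H1 * H2 := (W1 u.1 + (W1 (X u.2) - X (W2 u.2)), W2 u.2).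

Let linW1 : linear W1. Proof. by case: cW1. Qed.
Let linW2 : linear W2. Proof. by case: cW2. Qed.
Let linX : linear X. Proof. by case: bX. Qed.

Let linT : linear T.
Proof.
have linZ : linear (fun y => W1 (X y) - X (W2 y)).
  move=> a y z; rewrite (linX a y z) (linW1 a) (linW2 a) (linX a).
  by rewrite scalerBr opprD addrACA.
move=> a u v; rewrite /T /=; congr pair; last exact: linW2.
have /= -> := linZ a u.2 v.2.
by rewrite linW1 [in RHS]scalerDr addrACA.
Qed.

Let T_contraction u : Re (dot (T u) (T u)) <= Re (dot u u).
Proof.
rewrite !dotE /T /=.
have -> : W1 (X u.2) - X (W2 u.2) =
    defect_op (adjoint_op W1) (V (defect_op W2 u.2)).
  by rewrite -[RHS]/((_ \o _ \o _) u.2) -sylv.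
have h1 := defect_row u.1 (V (defect_op W2 u.2)) cW1.
have [_ _ h2] := defect_opP cW2.
have [_ nV] := (contraction_opP _).1 cV.
have h3 : rnorm (V (defect_op W2 u.2)) ^+ 2 <= rnorm (defect_op W2 u.2) ^+ 2.
  by rewrite lerXn2r ?nnegrE ?rnorm_ge0.
by rewrite h2 in h3; lra.
Qed.

Let T_iter k u : iter k T u =
  (iter k W1 (u.1 + X u.2) - X (iter k W2 u.2), iter k W2 u.2).
Proof.
elim: k => [|k ih]; first by rewrite /= addrK; case: u.
rewrite iterS ih /T /= (linear_opB linW1); congr pair.
by rewrite addrA addrNK.
Qed.

Let X' := adjoint_op X.
Let XE x y : hdot (X x) y = hdot x (X' y).
Proof. by have [_ ->] := adjoint_opP bX. Qed.

Let dot_iter k u v : dot (iter k T u) v =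
  hdot (iter k W1 (u.1 + X u.2)) v.1 + hdot (iter k W2 u.2) (v.2 - X' v.1).
Proof.
rewrite T_iter /dot /= (sdotDl hS1) (sdotNl hS1) XE (sdotDr hS2) (sdotNr hS2).
by ring.
Qed.

Variable f : C -> C.
Hypothesis f_disk : forall z, rnorm z < 1 -> cdiff f z.
Hypothesis f_bound : forall z, rnorm z < 1 -> rnorm (f z) < 1.

Let is_calculus (H : hilbertType R) (W F : H -> H) := bounded_op F /\
  exists (A : set R[i]^o) (G : seq (C * C)),
    [/\ open A, holomorphic_on A f, surrounds G (spectrum W) A &
    forall x y, hdot (F x) y = calculus_form f W G x y].

Variables (F1 : H1 -> H1) (F2 : H2 -> H2).
Hypotheses (hF1 : is_calculus W1 F1) (hF2 : is_calculus W2 F2).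

(** Von Neumann's inequality for f(T), with f(T) written out by the similarity
    between T and the diagonal operator; the Taylor polynomials of a dilate f (r z)
    are substituted for f. *)
Lemma block_von_neumann a b x y :
  2 * rnorm (hdot (F1 (a + X b)) x + hdot (F2 b) (y - X' x)) <=
  rnorm a ^+ 2 + rnorm b ^+ 2 + (rnorm x ^+ 2 + rnorm y ^+ 2).
Proof.
set Phi := _ + hdot (F2 b) _; set S := rnorm a ^+ 2 + _ + _.
have S0 : 0 <= S by rewrite /S !addr_ge0 ?sqr_ge0.
apply/ler_addgt0Pr => e e0.
have e1 : 0 < e / 9 by rewrite divr_gt0.
pose e2 := e / 9 / (S + 1); have e20 : 0 < e2 by rewrite divr_gt0// ltr_wpDl.
have [_ [A1 [G1 [oA1 hA1 sG1 E1]]]] := hF1.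
have [_ [A2 [G2 [oA2 hA2 sG2 E2]]]] := hF2.
have [d1 d10 D1] := @calculus_dilate R H1 f f_disk W1 A1 G1 (a + X b) x (e / 9)
  cW1 oA1 (fun z h => derivable_cdiff (hA1 z h)) sG1 e1.
have [d2 d20 D2] := @calculus_dilate R H2 f f_disk W2 A2 G2 b (y - X' x) (e / 9)
  cW2 oA2 (fun z h => derivable_cdiff (hA2 z h)) sG2 e1.
pose t := Num.min (1 / 2) (Num.min (d1 / 2) (d2 / 2)).
have t0 : 0 < t by rewrite !lt_min !divr_gt0.
have : t <= t by []. rewrite {2}/t !le_min => /andP[t1 /andP[t2 t3]].
pose r := 1 - t.
have r0 : 0 < r by rewrite /r; lra.
have r1 : r < 1 by rewrite /r; lra.
have rd1 : 1 - d1 < r by rewrite /r; lra.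
have rd2 : 1 - d2 < r by rewrite /r; lra.
have [Q [c [s [s1 cQ hQ [iQ1 iQ0] [pc tc]]]]] := dilate_taylor f_disk f_bound r0 r1.
have {}D1 := D1 r r0 rd1 r1 Q cQ hQ iQ1 iQ0.
have {}D2 := D2 r r0 rd2 r1 Q cQ hQ iQ1 iQ0.
have [n1 N1] := tc H1 W1 (a + X b) x (e / 9) cW1 e1.
have [n2 N2] := tc H2 W2 b (y - X' x) (e / 9) cW2 e1.
have [n3 N3] := pc e2 e20.
pose n := (n1 + n2 + n3)%N.
have {}N1 := N1 n (leq_trans (leq_addr n2 n1) (leq_addr n3 _)).
have {}N2 := N2 n (leq_trans (leq_addl n1 n2) (leq_addr n3 _)).
have {}N3 := N3 n (leq_addl _ n3).
have := von_neumann_poly dot_semi linT T_contraction s1 (a, b) (x, y) N3.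
have -> : \sum_(k < n) c k * dot (iter k T (a, b)) (x, y) =
    \sum_(k < n) c k * hdot (iter k W1 (a + X b)) x +
    \sum_(k < n) c k * hdot (iter k W2 b) (y - X' x).
  rewrite -big_split/=; apply: eq_bigr => k _.
  by rewrite dot_iter mulrDr.
rewrite -E1 in D1; rewrite -E2 in D2; rewrite !dotE /= -/S.
move: (\sum_(k < n) _) N1 => p1 N1; move: (\sum_(k < n) _) N2 => p2 N2 h.
move: (calculus_form _ W1 _ _ _) D1 N1 => q1 D1 N1.
move: (calculus_form _ W2 _ _ _) D2 N2 => q2 D2 N2.
have T1 := rnormDist q1 (hdot (F1 (a + X b)) x) p1.
have T2 := rnormDist q2 (hdot (F2 b) (y - X' x)) p2.
have T3 := rnormD (hdot (F1 (a + X b)) x - p1) (hdot (F2 b) (y - X' x) - p2).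
have T4 := rnorm_lowerB Phi (p1 + p2).
have E : Phi - (p1 + p2) =
  hdot (F1 (a + X b)) x - p1 + (hdot (F2 b) (y - X' x) - p2).
  by rewrite /Phi; ring.
rewrite -E in T3.
have E3 : e2 * S <= e / 9.
  by rewrite /e2 mulrAC ler_pdivrMr ?ltr_wpDl// ler_wpM2l ?(ltW e1)// lerDl.
lra.
Qed.

Let linF1 : linear F1. Proof. by case: hF1 => -[]. Qed.
Let linF2 : linear F2. Proof. by case: hF2 => -[]. Qed.
Let X'0 : X' 0 = 0.
Proof. by have [[linX' _] _] := adjoint_opP bX; exact: linear_op0. Qed.

Lemma block_contraction1 : contraction_op F1.
Proof.
apply/contraction_opP; split => // a.
have := block_von_neumann a 0 (F1 a) 0.
rewrite (linear_op0 linX) addr0 (linear_op0 linF2) (sdot0l hS2) addr0 hdotxx.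
rewrite !rnorm0 !expr0n/= !addr0 rnormc ger0_norm ?sqr_ge0// => h.
by rewrite -(@ler_pXn2r _ 2) ?nnegrE ?rnorm_ge0//; lra.
Qed.

Lemma block_contraction2 : contraction_op F2.
Proof.
apply/contraction_opP; split => // b.
have := block_von_neumann 0 b 0 (F2 b).
rewrite (sdot0r hS1) add0r X'0 subr0 hdotxx.
rewrite !rnorm0 !expr0n/= !add0r rnormc ger0_norm ?sqr_ge0// => h.
by rewrite -(@ler_pXn2r _ 2) ?nnegrE ?rnorm_ge0//; lra.
Qed.

(** The contraction with diagonal F1, F2 and corner Z = F1 X - X F2, tested on the
    vectors (F1^* x, y) and (x, F2 y), yields
    2 Re (Z y, x) <= |D y| ^ 2 + |E x| ^ 2, with D and E the defect operators of F2
    and of F1^*. *)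
Lemma block_corner : exists2 Y : H2 -> H1, contraction_op Y &
  (F1 \o X) - (X \o F2) = defect_op (adjoint_op F1) \o Y \o defect_op F2.
Proof.
have c1 := block_contraction1; have c2 := block_contraction2.
have [_ adj1] := adjoint_opP (contraction_bounded c1).
have [linD2 _ nD2] := defect_opP c2.
have [linD1 saD1 nD1] := defect_opP (adjoint_contraction c1).
pose Z y := F1 (X y) - X (F2 y).
have linZ : linear Z.
  move=> a y z; rewrite /Z (linX a y z) (linF1 a) (linF2 a) (linX a).
  by rewrite scalerBr opprD addrACA.
have ZE : (F1 \o X) - (X \o F2) = Z by [].
rewrite ZE; apply: douglas_factor => // y x.
have real_bound y' x' : 2 * Re (hdot (Z y') x') <=
    rnorm (defect_op F2 y') ^+ 2 + rnorm (defect_op (adjoint_op F1) x') ^+ 2.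
  rewrite nD2 nD1.
  have := block_von_neumann (adjoint_op F1 x') y' x' (F2 y').
  set a := adjoint_op F1 x'.
  have -> : hdot (F1 (a + X y')) x' + hdot (F2 y') (F2 y' - X' x') =
      (rnorm a ^+ 2 + rnorm (F2 y') ^+ 2)%:C + hdot (Z y') x'.
    rewrite /Z (linear_opD linF1) !(sdotDl hS1) (sdotNl hS1) XE.
    rewrite (sdotDr hS2) (sdotNr hS2) (adj1 a x') -/a !hdotxx rmorphD/=; ring.
  move=> h; have := Re_le_rnorm ((rnorm a ^+ 2 + rnorm (F2 y') ^+ 2)%:C + hdot (Z y') x').
  have -> : Re ((rnorm a ^+ 2 + rnorm (F2 y') ^+ 2)%:C + hdot (Z y') x') =
      rnorm a ^+ 2 + rnorm (F2 y') ^+ 2 + Re (hdot (Z y') x').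
    by case: (hdot (Z y') x').
  by lra.
apply: le_mul_of_scaling; rewrite ?rnorm_ge0// => t t0.
have [u u1 uE] := unimodular_mul (hdot (Z y) x).
pose s := Num.sqrt t; have s0 : 0 < s by rewrite sqrtr_gt0.
have sE : s ^+ 2 = t by rewrite sqr_sqrtr// ltW.
have := real_bound ((s%:C * u) *: y) (s^-1%:C *: x).
rewrite (linear_opZ linZ) (linear_opZ linD2) (linear_opZ linD1).
rewrite (sdotZl hS1) (sdotZr hS1) conjc_real.
have -> : s%:C * u * (s^-1%:C * hdot (Z y) x) = (rnorm (hdot (Z y) x))%:C.
  rewrite -uE; have ss : s%:C * s^-1%:C = 1 :> C.
    by rewrite -rmorphM/= divff ?gt_eqF.
  by rewrite mulrACA ss mul1r.
rewrite !rnormZ rnormM u1 mulr1 !rnormc !exprMn !real_normK ?num_real//=.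
by rewrite exprVn sE [_ / t]mulrC.
Qed.

End block.

Theorem theorem3p2 (R : realType) (H1 H2 : hilbertType R)
    (W1 : H1 -> H1) (W2 : H2 -> H2) (V : H2 -> H1)
    (hW1 : contraction_op W1) (hW2 : contraction_op W2)
    (hV : contraction_op V)
    (hdisj : spectrum W1 `&` spectrum W2 = set0)
    (f : R[i]^o -> R[i]^o) (U : set R[i]^o)
    (hfD : holomorphic_on unit_disk f)
    (hfDD : forall z, unit_disk z -> unit_disk (f z))
    (hU : open U) (hsU : spectrum W1 `|` spectrum W2 `<=` U)
    (hfU : holomorphic_on U f)
    (X : H2 -> H1) (hX : bounded_op X)
    (hsylv : (W1 \o X) - (X \o W2) =
             defect_op (adjoint_op W1) \o V \o defect_op W2) :
  exists2 Y : H2 -> H1, contraction_op Y &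
    (hfcalc f W1 \o X) - (X \o hfcalc f W2) =
    defect_op (adjoint_op (hfcalc f W1)) \o Y \o defect_op (hfcalc f W2).
Proof.
have disk z : rnorm z < 1 -> unit_disk z by rewrite /unit_disk /= rnormE ltcR.
apply: (block_corner hW1 hW2 hV hX hsylv (f := f)).
- by move=> z /disk/hfD/derivable_cdiff.
- by move=> z /disk/hfDD; rewrite /unit_disk /= rnormE ltcR.
- by apply: (hfcalcP hW1 hU) => // z Wz; apply: hsU; left.
- by apply: (hfcalcP hW2 hU) => // z Wz; apply: hsU; right.
Qed.
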